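(* Let $X$ be a real random variable with $\mathbb{E}|X|^2<\infty$, and write $\mu=\mathbb{E}X$, $\sigma^2=\operatorname{Var}(X)$. Let $(X_{k,n})_{1\le k\le n,\ n\ge1}$ be a triangular array of independent random variables, each with the same distribution as $X$, and set $S_{n,n}=\sum_{k=1}^n X_{k,n}$. Let $I$ be an interval with $\mathbb{P}(X\in I)=1$, and let $f$ be a real function defined (at least) on $I$ which, on some neighbourhood of $\mu$, is three times differentiable with bounded third derivative. Define \[ a_n=\sqrt{\log n},\qquad b_n=n f(\mu)+\frac{f''(\mu)}{2}\sum_{k=1}^n\frac{1}{k}\,\mathbb{E}\big[|X-\mu|^2\mathbf{1}_{\{|X-\mu|\le \sigma k\}}\big]. \] Then, as $n\to\infty$, \[ \frac{\sum_{k=1}^n f(S_{k,k}/k)-b_n}{a_n}\xrightarrow{d}\sigma f'(\mu)\,\mathcal{N}, \] where $\mathcal{N}$ is a standard normal random variable.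
   Context: $\xrightarrow{d}$ denotes convergence in distribution. Note that the sums $S_{1,1},S_{2,2},\dots$ are mutually independent (they are built from different rows of the array). *)

(* Defs.v *)
From HB Require Import structures.
From mathcomp Require Import all_boot all_order all_algebra.
From mathcomp Require Import all_classical all_reals all_analysis.
Set Implicit Arguments. Unset Strict Implicit. Unset Printing Implicit Defensive.
Import Order.TTheory GRing.Theory Num.Theory.
Import numFieldNormedType.Exports.
Local Open Scope classical_set_scope.
Local Open Scope ring_scope.

Definition mutually_independent d (T : measurableType d) (R : realType)
    (P : probability T R) (I : eqType) (A : set I) (Y : I -> T -> R) : Prop :=
  forall (J : seq I), uniq J -> (forall j, j \in J -> A j) ->
  forall B : I -> set R, (forall j, measurable (B j)) ->
    P (\big[setI/setT]_(j <- J) (Y j @^-1` B j)) =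
    (\prod_(j <- J) P (Y j @^-1` B j))%E.

Definition cvg_distr_scaled_std_normal d (T : measurableType d) (R : realType)
    (P : probability T R) (Y : nat -> T -> R) (c : R) : Prop :=
  forall g : R -> R, continuous g -> (exists M : R, forall x, `|g x| <= M) ->
    ('E_P[g \o Y n])%E @[n --> \oo] -->
      (\int[normal_prob (0:R) 1]_x (g (c * x))%:E)%E.

(* Main.v *)
(** Centre the variables at [mu], truncate those of row [k] at height [sigma k],
    and let [C k] be the centred average of the truncated row [k]. Then
    [E (C k)^2 ~ sigma^2 / k], and this truncation level makes
    [sum_k E (C k)^4], [sum_k |E (truncated variable)|] and [sum_k P(row k is
    affected by the truncation)] finite. Taylor expansion of [f] at [mu] splits
    the normalised sum into three parts.
    - [f'(mu) sum_k C k] has independent terms with total variance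
      [~ sigma^2 log n] (a logarithmic Cesaro mean), and obeys Lyapunov's
      condition since [sum_k E (C k)^4] is bounded: this is the Gaussian limit.
    - [sum_k ((C k)^2 - E (C k)^2)] is bounded in [L^2], hence killed by
      [sqrt (log n)].
    - The cubic remainder is controlled by [|c|^3 <= eta c^2 + c^4 / eta] with
      [eta] of order [1 / sqrt (log n)], outside rows whose probabilities are
      summable.
    Characteristic functions enter as [E cos (t A + th)] for all real [t], [th].
    Together with tightness their convergence gives convergence in distribution
    because on compact sets a continuous function is a uniform limit of
    trigonometric polynomials, namely Bernstein polynomials in [sin (t x)]. *)
Require Import Defs.
From HB Require Import structures.
From mathcomp Require Import all_boot all_order all_algebra.
From mathcomp Require Import all_classical all_reals all_analysis.
From mathcomp Require Import measurable_realfun.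
From mathcomp Require Import ring lra.
Import Order.TTheory GRing.Theory Num.Theory.
Import numFieldNormedType.Exports.
Set Implicit Arguments. Unset Strict Implicit. Unset Printing Implicit Defensive.
Local Open Scope classical_set_scope.
Local Open Scope ring_scope.

(** * Real-valued expectations and bounded measurable functions *)

Section expectation.
Context d (T : measurableType d) (R : realType) (P : probability T R).
Implicit Types (U V : T -> R) (c : R).

(** Only two moments are available, and the level [s k] for row [k] is the one at which each sum
    over rows collapses to [E Y^2], where [Y] is the centred variable. For a fixed value [y] at most
    [|y| / s] indices satisfy [s k < |y|]; hence [sum_k E (|Y|; |Y| > s k) <= E Y^2 / s] and
    [sum_k k P (|Y| > s k) <= E Y^2 / s^2], the expected number of truncated entries. On the other
    side, [sum_k k^-3 E (Y^4; |Y| <= s k) <= 2 s^2 E Y^2]. The same truncated second moments have to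
    appear in [b_n]: two moments give no rate for their convergence, so replacing them by [sigma^2]
    could shift the centring by more than [sqrt (log n)]. The cubic term is interpolated between
    [c^2] and [c^4], the powers whose moments are computed anyway. With [eta] of order
    [1 / sqrt (log n)] the factor [1 / eta] cancels the normalisation, so boundedness of
    [sum_k E (C k)^4] does not suffice there: a fixed number of rows is set aside, and only the
    small tail of that series is used. *)

Definition itg U := P.-integrable setT (EFin \o U).

(** A real rather than an extended number, so that [ring], [lra] and [nra] work on moments; [itg]
    supplies the finiteness. *)
Definition Ex U : R := Rintegral P setT U.

(** Truncated variables and cosines are bounded, and bounded functions, unlike integrable ones, are
    closed under products. Most integrability conditions are therefore discharged through this
    predicate. *)
Definition bmf U := measurable_fun setT U /\ exists M, forall w, `|U w| <= M.

Lemma bmf_itg U : bmf U -> itg U.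
Proof.
move=> [mU [M MU]]; apply: measurable_bounded_integrable => //.
  by rewrite (le_lt_trans (probability_le1 P _)) ?ltry.
by exists M; split; [exact: num_real|move=> x Mx w _; exact: le_trans (MU w) (ltW Mx)].
Qed.

Lemma itg_measurable U : itg U -> measurable_fun setT U.
Proof. by move/measurable_int/measurable_EFinP. Qed.

Lemma itgD U V : itg U -> itg V -> itg (fun w => U w + V w).
Proof. by move=> iU iV; exact: (@integrableD _ _ _ P setT measurableT _ _ iU iV). Qed.

Lemma itgZ c U : itg U -> itg (fun w => c * U w).
Proof. by move=> iU; exact: (@integrableZl _ _ _ P setT measurableT c _ iU). Qed.

Lemma itgB U V : itg U -> itg V -> itg (fun w => U w - V w).
Proof. by move=> iU iV; exact: (@integrableB _ _ _ P setT measurableT _ _ iU iV). Qed.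

Lemma itg_cst c : itg (fun=> c).
Proof. by apply: bmf_itg; split=> //; exists `|c|. Qed.

Lemma itg_sum I (r : seq I) (F : I -> T -> R) :
  (forall i, itg (F i)) -> itg (fun w => \sum_(i <- r) F i w).
Proof.
move=> iF; elim: r => [|i r IH].
  by under eq_fun do rewrite big_nil; exact: itg_cst.
by under eq_fun do rewrite big_cons; exact: itgD.
Qed.

Lemma itg_le U V : measurable_fun setT U -> itg V ->
  (forall w, `|U w| <= V w) -> itg U.
Proof.
move=> mU iV UV; apply: (le_integrable measurableT _ _ iV).
  exact/measurable_EFinP.
by move=> w _; rewrite /= lee_fin (le_trans (UV w))// ler_norm.
Qed.

Lemma itg_norm U : itg U -> itg (fun w => `|U w|).
Proof.
move=> iU; have mU := itg_measurable iU.
by have /= := @integrable_norm _ _ _ P setT _ iU.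
Qed.

Lemma eq_Ex U V : U =1 V -> Ex U = Ex V.
Proof. by move=> UV; congr Ex; exact/funext. Qed.

Lemma ExD U V : itg U -> itg V -> Ex (fun w => U w + V w) = Ex U + Ex V.
Proof. exact: RintegralD. Qed.

Lemma ExB U V : itg U -> itg V -> Ex (fun w => U w - V w) = Ex U - Ex V.
Proof. exact: RintegralB. Qed.

Lemma ExZ c U : itg U -> Ex (fun w => c * U w) = c * Ex U.
Proof. by move=> iU; exact: RintegralZl. Qed.

Lemma Ex_cst c : Ex (fun=> c) = c.
Proof. by rewrite /Ex Rintegral_cst//= probability_setT mulr1. Qed.

Lemma Ex_sum I (r : seq I) (F : I -> T -> R) : (forall i, itg (F i)) ->
  Ex (fun w => \sum_(i <- r) F i w) = \sum_(i <- r) Ex (F i).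
Proof.
move=> iF; elim: r => [|i r IH].
  by rewrite big_nil; under eq_Ex do rewrite big_nil; rewrite Ex_cst.
rewrite big_cons; under eq_Ex do rewrite big_cons.
by rewrite ExD// ?IH//; exact: itg_sum.
Qed.

Lemma Ex_le U V : itg U -> itg V -> (forall w, U w <= V w) -> Ex U <= Ex V.
Proof. by move=> iU iV UV; exact: le_Rintegral. Qed.

Lemma Ex_ge0 U : (forall w, 0 <= U w) -> 0 <= Ex U.
Proof. by move=> U0; exact: Rintegral_ge0. Qed.

Lemma norm_Ex U : itg U -> `|Ex U| <= Ex (fun w => `|U w|).
Proof. by move=> iU; exact: le_normr_Rintegral. Qed.

Lemma norm_Ex_le U V : itg U -> itg V -> (forall w, `|U w| <= V w) ->
  `|Ex U| <= Ex V.
Proof.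
move=> iU iV UV; apply: le_trans (norm_Ex iU) _.
by apply: Ex_le => //; exact: itg_norm.
Qed.

Lemma norm_Ex_bnd U c : itg U -> (forall w, `|U w| <= c) -> `|Ex U| <= c.
Proof.
move=> iU Uc; rewrite -[leRHS]Ex_cst; apply: norm_Ex_le => //; exact: itg_cst.
Qed.

Lemma Ex_indic (A : set T) : measurable A -> (Ex \1_A)%:E = P A.
Proof.
move=> mA; rewrite /Ex /Rintegral integral_indic// setIT fineK//.
exact: fin_num_measure.
Qed.

Lemma expectationE U : itg U -> ('E_P[U] = (Ex U)%:E)%E.
Proof.
move=> iU; rewrite expectation.unlock /Ex /Rintegral fineK//.
exact: integrable_fin_num.
Qed.

Lemma bmf_cst c : bmf (fun=> c).
Proof. by split => //; exists `|c|. Qed.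

Lemma bmfD U V : bmf U -> bmf V -> bmf (fun w => U w + V w).
Proof.
move=> [mU [M UM]] [mV [N VN]]; split; first exact: measurable_funD.
by exists (M + N) => w; rewrite (le_trans (ler_normD _ _))// lerD.
Qed.

Lemma bmfM U V : bmf U -> bmf V -> bmf (fun w => U w * V w).
Proof.
move=> [mU [M UM]] [mV [N VN]]; split; first exact: measurable_funM.
by exists (M * N) => w; rewrite normrM ler_pM.
Qed.

Lemma bmfZ c U : bmf U -> bmf (fun w => c * U w).
Proof. by move=> bU; apply: bmfM => //; exact: bmf_cst. Qed.

Lemma bmfB U V : bmf U -> bmf V -> bmf (fun w => U w - V w).
Proof.
move=> bU bV; under eq_fun do rewrite -[X in _ - X]mul1r -mulNr.
by apply: bmfD => //; exact: bmfZ.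
Qed.

Lemma bmfX U n : bmf U -> bmf (fun w => U w ^+ n).
Proof.
move=> bU; elim: n => [|n IH].
  by under eq_fun do rewrite expr0; exact: bmf_cst.
by under eq_fun do rewrite exprS; exact: bmfM.
Qed.

Lemma bmf_sum I (r : seq I) (F : I -> T -> R) :
  (forall i, bmf (F i)) -> bmf (fun w => \sum_(i <- r) F i w).
Proof.
move=> iF; elim: r => [|i r IH].
  by under eq_fun do rewrite big_nil; exact: bmf_cst.
by under eq_fun do rewrite big_cons; exact: bmfD.
Qed.

Lemma bmf_prod I (r : seq I) (F : I -> T -> R) :
  (forall i, bmf (F i)) -> bmf (fun w => \prod_(i <- r) F i w).
Proof.
move=> iF; elim: r => [|i r IH].
  by under eq_fun do rewrite big_nil; exact: bmf_cst.
by under eq_fun do rewrite big_cons; exact: bmfM.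
Qed.

Lemma bmf_indic (A : set T) : measurable A -> bmf \1_A.
Proof.
move=> mA; split; first exact: measurable_indic.
by exists 1 => w; rewrite indicE; case: (_ \in _); rewrite ?normr1 ?normr0.
Qed.

End expectation.

(** * Extension of identities from indicators to bounded functions *)

Lemma bmf_comp d (T : measurableType d) d' (T' : measurableType d')
  (R : realType) (Y : T -> T') (h : T' -> R) :
  measurable_fun setT Y -> bmf h -> bmf (fun w => h (Y w)).
Proof.
move=> mY [mh [M hM]]; split; first exact: measurableT_comp mh mY.
by exists M => w; exact: hM.
Qed.

(** The sum counts the integers of [[1, x]], so it is the integer part of [x]. This is the
    discretisation error in the layer cake argument. *)
Lemma count_le_approx (R : realType) (N : nat) (x : R) : 0 <= x <= N%:R ->
  `|x - \sum_(1 <= i < N.+1) (i%:R <= x)%R%:R| <= 1.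
Proof.
move=> /andP[x0 xN].
(* The bound [x <= N] is lost when [N] decreases. The claim is therefore restated for every
   [x >= 0], the third conjunct recording that the count saturates at [N]. *)
suff : (\sum_(1 <= i < N.+1) (i%:R <= x)%R%:R : R) <= x /\
   (Num.min x N%:R <= 1 + \sum_(1 <= i < N.+1) (i%:R <= x)%R%:R) /\
   (N%:R <= x -> (\sum_(1 <= i < N.+1) (i%:R <= x)%R%:R : R) = N%:R).
  by case=> h1 []; rewrite min_l// ler_norml => h2 _; apply/andP; split; lra.
clear xN; elim: N => [|N [IH1 [IH2 IH3]]].
  rewrite big_geq//; split => //; split => //.
  by rewrite addr0 ge_min ler01 orbT.
rewrite big_nat_recr//=; case: (lerP N.+1%:R x) => xN.
  have xN' : N%:R <= x by rewrite (le_trans _ xN)// ler_nat.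
  rewrite IH3//.
  rewrite -natr1 in xN; rewrite -natr1 xN /= mulr1n; split; first by [].
  split; last by [].
  lra.
rewrite addr0; split => //; split => //.
case: (lerP N%:R x) => xN'.
  rewrite IH3//; rewrite -natr1 in xN.
  by rewrite addrC ltW.
by move: IH2; rewrite min_l// ltW.
Qed.

Lemma indic_comp (T : Type) (R : realType) (Y : T -> R) (B : set R) w :
  \1_B (Y w) = \1_(Y @^-1` B) w :> R.
Proof. by rewrite !indicE; congr (nat_of_bool _)%:R; apply/idP/idP; rewrite !inE. Qed.

Section bounded_linear.
Context d (T : measurableType d) (R : realType).

(** Common form of [E h(Y)], [E (h(Y) Z)] and the integral of [h] against the Gaussian density, as
    functionals of [h] continuous for the sup norm. The passage from indicators to bounded functions
    is then proved once for all of them. *)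
Definition bounded_linear (L : (T -> R) -> R) :=
  (forall (c : R) U V, bmf U -> bmf V ->
    L (fun w => c * U w + V w) = c * L U + L V) /\
  exists C : R, forall U (M : R), bmf U -> (forall w, `|U w| <= M) ->
    `|L U| <= C * M.

(* Layer cake: up to [1 / N], a [0, 1]-valued [g] is the average of the
   indicators of [i / N <= g]. *)
Lemma bounded_linear_eq0 L : bounded_linear L ->
  (forall B, measurable B -> L \1_B = 0) -> forall U, bmf U -> L U = 0.
Proof.
move=> [linL [C LC]] L1 U bU.
have L0 : L (fun=> 0) = 0.
  have := L1 _ (@measurable0 _ T); congr (L _ = _).
  by apply/funext => w; rewrite indicE in_set0.
have LZ (c : R) V : bmf V -> L (fun w => c * V w) = c * L V.
  move=> bV; rewrite -[RHS]addr0 -L0 -linL//; last exact: bmf_cst.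
  by congr L; apply/funext => w; rewrite addr0.
have [TE|[w0]] : (forall w : T, False) \/ exists w : T, True.
- have [?|h] := pselect (exists w : T, True); first by right.
  by left => w; apply: h; exists w.
- by rewrite -L0; congr L; apply/funext => w; case: (TE w).
move=> _.
(* Affine rescaling: [U] is a combination of a [[0, 1]]-valued function and of the constant 1, which
   is itself an indicator. *)
suff H01 (g : T -> R) : measurable_fun setT g -> (forall x, 0 <= g x <= 1) ->
    L g = 0.
  have [mU [M UM]] := bU.
  have K0 : 0 < `|M| + 1 by rewrite ltr_wpDl.
  have UK w : `|U w| <= `|M| + 1.
    by rewrite (le_trans (UM w))// (le_trans (ler_norm _))// lerDl.
  move: (`|M| + 1) K0 UK => K K0 UK.
  pose g w := (2 * K)^-1 * (U w + K).
  have bg : bmf g by apply: bmfZ; apply: bmfD => //; exact: bmf_cst.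
  have gE : L g = 0.
    apply: H01; first by case: bg.
    move=> w; have := UK w; rewrite ler_norml => /andP[h1 h2].
    rewrite /g mulr_ge0 ?invr_ge0/=; [|lra|lra].
    by rewrite mulrC ler_pdivrMr; lra.
  have -> : U = (fun w => 2 * K * g w + (- K) * \1_setT w).
    apply/funext => w; rewrite /g mulrA mulfV ?mul1r ?indicT ?mulr1 ?addrK//.
    by rewrite gt_eqF// mulr_gt0.
  have b1 : bmf (\1_setT : T -> R) by exact: bmf_indic.
  by rewrite linL ?gE ?LZ ?L1 ?mulr0 ?addr0//; exact: bmfZ.
move=> mg g01.
have bg : bmf g.
  by split => //; exists 1 => x; have /andP[? ?] := g01 x; rewrite ger0_norm.
apply/eqP; rewrite -normr_le0; apply/ler_addgt0Pl => e e0; rewrite addr0.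
have [N NM] : exists N : nat, C / e < N.+1%:R.
  have [N _ H] := nbhs_infty_gtr (C / e).
  by exists N; apply: H => /=.
have N0 : (0 : R) < N.+1%:R by rewrite ltr0n.
pose B i := g @^-1` [set y | i%:R / N.+1%:R <= y].
have mB i : measurable (B i).
  rewrite -[B i]setTI; apply: mg => //.
  by rewrite [X in measurable X](_ : _ = `[i%:R / N.+1%:R, +oo[%classic)//;
    apply/seteqP; split => y /=; rewrite in_itv/= andbT.
have L1sum m : L (fun w => \sum_(1 <= i < m.+1) \1_(B i) w) = 0.
  elim: m => [|m IH].
    by rewrite -[RHS]L0; congr L; apply/funext => w; rewrite big_geq.
  transitivity (L (fun w => 1 * \1_(B m.+1) w + \sum_(1 <= i < m.+1) \1_(B i) w)).
    by congr L; apply/funext => w; rewrite big_nat_recr//= mul1r addrC.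
  rewrite linL ?IH ?L1 ?mulr0 ?addr0//; first exact: bmf_indic.
  by apply: bmf_sum => i; exact: bmf_indic.
pose gN (w : T) : R := N.+1%:R^-1 * \sum_(1 <= i < N.+2) \1_(B i) w.
have bs : bmf (fun w => \sum_(1 <= i < N.+2) \1_(B i) w : R).
  by apply: bmf_sum => i; exact: bmf_indic.
have bgN : bmf gN by exact: bmfZ.
have gNE : L gN = 0 by rewrite /gN LZ// L1sum mulr0.
have gNg w : `|g w - gN w| <= N.+1%:R^-1.
  have := @count_le_approx R N.+1 (g w * N.+1%:R).
  have /andP[g0 g1] := g01 w.
  move=> /(_ _)/wrap[]; first by rewrite mulr_ge0 ?ler0n//= ler_piMl ?ler0n.
  rewrite (eq_bigr (fun i => \1_(B i) w)) => [H|i _]; last first.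
    by rewrite indicE /B -ler_pdivrMr//; congr (nat_of_bool _)%:R; apply/idP/idP;
       rewrite inE.
  have -> : g w - gN w = N.+1%:R^-1 * (g w * N.+1%:R - \sum_(1 <= i < N.+2) \1_(B i) w).
    by rewrite /gN mulrBr mulrCA mulVf ?mulr1// gt_eqF.
  by rewrite normrM gtr0_norm ?invr_gt0// ler_piMr ?invr_ge0.
have -> : L g = L (fun w => g w - gN w).
  transitivity (L (fun w => (-1) * gN w + g w)).
    by rewrite linL// gNE mulr0 add0r.
  by congr L; apply/funext => w; rewrite mulN1r addrC.
apply: le_trans (LC _ _ _ gNg) _; first exact: bmfB.
by rewrite ler_pdivrMr// mulrC -ler_pdivrMr// ltW.
Qed.

Lemma bounded_linear_eq L1 L2 : bounded_linear L1 -> bounded_linear L2 ->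
  (forall B, measurable B -> L1 \1_B = L2 \1_B) ->
  forall U, bmf U -> L1 U = L2 U.
Proof.
move=> [l1 [C1 b1]] [l2 [C2 b2]] H U bU; apply/eqP; rewrite -subr_eq0; apply/eqP.
apply: (@bounded_linear_eq0 (fun U => L1 U - L2 U)) => //; last first.
  by move=> B mB; rewrite H// subrr.
split=> [c V W bV bW|]; first by rewrite l1// l2//; ring.
exists (C1 + C2) => V M bV VM; rewrite (le_trans (ler_normB _ _))//.
by rewrite mulrDl lerD ?b1 ?b2.
Qed.

End bounded_linear.

Lemma bounded_linear_Ex d (T : measurableType d) d' (T' : measurableType d')
  (R : realType) (P : probability T R) (Y : T -> T') (Z : T -> R) :
  measurable_fun setT Y -> bmf Z ->
  bounded_linear (fun h => Ex P (fun w => h (Y w) * Z w)).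
Proof.
move=> mY bZ.
have iY (g : T' -> R) : bmf g -> itg P (fun w => g (Y w) * Z w).
  by move=> bg; apply: bmf_itg; apply: bmfM => //; exact: bmf_comp bg.
split=> [c U V bU bV|].
  rewrite -(ExZ _ (iY _ bU)) -ExD; [|exact/itgZ/iY|exact: iY].
  by apply: eq_Ex => w; rewrite mulrDl mulrA.
have [mZ [M ZM]] := bZ; exists M => U N bU UN.
apply: norm_Ex_bnd; first exact: iY.
by move=> w; rewrite normrM mulrC ler_pM.
Qed.

Lemma bounded_linear_Ex1 d (T : measurableType d) d' (T' : measurableType d')
  (R : realType) (P : probability T R) (Y : T -> T') :
  measurable_fun setT Y -> bounded_linear (fun h => Ex P (fun w => h (Y w))).
Proof.
move=> mY.
rewrite (_ : (fun _ => _) = (fun h => Ex P (fun w => h (Y w) * (fun=> 1) w))).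
  by apply: bounded_linear_Ex => //; exact: bmf_cst.
by apply/funext => h; apply: eq_Ex => w; rewrite mulr1.
Qed.

(** * Independence of functions of disjoint sets of coordinates *)

Section independence.
Context d (T : measurableType d) (R : realType) (P : probability T R).

Lemma indep_indic_bmf (Y Z : T -> R) (h : R -> R) :
  measurable_fun setT Y -> bmf Z -> bmf h ->
  (forall B, measurable B ->
    Ex P (fun w => \1_B (Y w) * Z w) = Ex P (fun w => \1_B (Y w)) * Ex P Z) ->
  Ex P (fun w => h (Y w) * Z w) = Ex P (fun w => h (Y w)) * Ex P Z.
Proof.
move=> mY bZ bh HB.
apply: (@bounded_linear_eq _ _ _ (fun h => Ex P (fun w => h (Y w) * Z w))
  (fun h => Ex P (fun w => h (Y w)) * Ex P Z)) => //.
  exact: bounded_linear_Ex.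
have [l [C b]] := bounded_linear_Ex1 P mY.
split=> [c U V bU bV|]; first by rewrite l//; ring.
exists (C * `|Ex P Z|) => U M bU UM.
by rewrite normrM mulrAC ler_wpM2r// b.
Qed.

Context (I : eqType) (A : set I) (Y : I -> T -> R).
Hypothesis mY : forall j, measurable_fun setT (Y j).
Hypothesis indY : mutually_independent P A Y.

Lemma prod_indicE (J : seq I) (B : I -> set R) w :
  \prod_(j <- J) \1_(B j) (Y j w) =
  \1_(\big[setI/setT]_(j <- J) (Y j @^-1` B j)) w :> R.
Proof.
elim: J => [|j J IH]; first by rewrite !big_nil indicT.
by rewrite !big_cons IH indicI indic_comp.
Qed.

Lemma measurable_preim j (B : set R) : measurable B -> measurable (Y j @^-1` B).
Proof. by move=> mB; rewrite -[X in measurable X]setTI; exact: mY. Qed.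

(** Independence is the case where every factor is an indicator. Coordinates are upgraded to bounded
    functions one at a time: by [indep_indic_bmf] it is enough to treat [j] as an indicator, and
    then [j] can be moved to the second list, where the induction hypothesis applies. *)
Lemma Ex_prod_mix (J1 J2 : seq I) (h : I -> R -> R) (B : I -> set R) :
  uniq (J1 ++ J2) -> (forall j, j \in J1 ++ J2 -> A j) ->
  (forall j, bmf (h j)) -> (forall j, measurable (B j)) ->
  Ex P (fun w => (\prod_(j <- J1) h j (Y j w)) * \prod_(j <- J2) \1_(B j) (Y j w)) =
  (\prod_(j <- J1) Ex P (fun w => h j (Y j w))) *
  \prod_(j <- J2) Ex P (fun w => \1_(B j) (Y j w)).
Proof.
move=> + + bh; elim: J1 J2 B => [|j J1 IH] J2 B /= u JA mB.
  under eq_Ex do rewrite big_nil mul1r prod_indicE.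
  rewrite big_nil mul1r; apply: EFin_inj.
  rewrite Ex_indic; last first.
    by apply: bigsetI_measurable => i _; exact: measurable_preim.
  rewrite indY// -prodEFin; apply: eq_bigr => i _.
  under eq_Ex do rewrite indic_comp.
  by rewrite Ex_indic//; exact: measurable_preim.
have bhY i : bmf (fun w => h i (Y i w)) by exact: bmf_comp.
have bBY (C : I -> set R) : (forall i, measurable (C i)) ->
    forall i, bmf (fun w => \1_(C i) (Y i w)).
  by move=> mC i; apply: bmf_comp => //; exact: bmf_indic.
have bZ (C : I -> set R) : (forall i, measurable (C i)) ->
  bmf (fun w => (\prod_(j <- J1) h j (Y j w)) * \prod_(j <- J2) \1_(C j) (Y j w)).
  by move=> mC; apply: bmfM; apply: bmf_prod => // i; exact: bBY.
move: u => /andP[]; rewrite mem_cat negb_or => /andP[jJ1 jJ2] u.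
rewrite big_cons; under eq_Ex do rewrite big_cons -mulrA.
rewrite (@indep_indic_bmf _ _ _ (mY j) (bZ B mB) (bh j)) => [|D mD].
  by rewrite IH// ?mulrA// => i iJ; apply: JA; rewrite inE iJ orbT.
(* The test set [D] is assigned to index [j]; the factors over [J2] are unchanged because [j] is not
   in [J2]. *)
pose B' i := if i == j then D else B i.
have mB' i : measurable (B' i) by rewrite /B'; case: ifP.
have B'J i : i \in J2 -> B' i = B i.
  by rewrite /B'; case: eqP => // -> iJ; rewrite iJ in jJ2.
have := IH (j :: J2) B'.
rewrite big_cons.
have B'j : B' j = D by rewrite /B' eqxx.
under [in X in _ -> _ -> _ -> X = _]eq_Ex do rewrite big_cons B'j.
rewrite B'j [X in _ * (_ * X)](eq_big_seq (fun i => Ex P (fun w => \1_(B i) (Y i w)))); last first.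
  by move=> i iJ; rewrite B'J.
rewrite mulrCA -IH//; last by move=> i iJ; apply: JA; rewrite inE iJ orbT.
move=> <-//; last first.
- move=> i; rewrite mem_cat inE => iJ; apply: JA.
  by rewrite inE mem_cat; case/or3P: iJ => ->; rewrite ?orbT.
- by rewrite (perm_uniq (permEl (perm_catCA J1 [:: j] J2)))/= mem_cat negb_or jJ1 jJ2.
apply: eq_Ex => w; rewrite mulrCA; congr (_ * (_ * _)).
by apply: eq_big_seq => i iJ; rewrite B'J.
Qed.

Lemma Ex_prod (J : seq I) (h : I -> R -> R) :
  uniq J -> (forall j, j \in J -> A j) -> (forall j, bmf (h j)) ->
  Ex P (fun w => \prod_(j <- J) h j (Y j w)) =
  \prod_(j <- J) Ex P (fun w => h j (Y j w)).
Proof.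
move=> uJ JA bh; have := @Ex_prod_mix J [::] h (fun=> setT).
rewrite cats0 big_nil mulr1 => <-//.
by apply: eq_Ex => w; rewrite big_nil mulr1.
Qed.

(* Row sums, their powers and their cosines all lie in this span, on which the
   independence of disjoint index sets follows from that of single coordinates. *)
Inductive pspan (J : seq I) : (T -> R) -> Prop :=
| pspan_prod h : (forall j, bmf (h j)) ->
    pspan J (fun w => \prod_(j <- J) h j (Y j w))
| pspanD U V : pspan J U -> pspan J V -> pspan J (fun w => U w + V w)
| pspanZ c U : pspan J U -> pspan J (fun w => c * U w).

Lemma pspan_bmf J U : pspan J U -> bmf U.
Proof.
elim=> [h bh|????? ?|????]; [|exact: bmfD|exact: bmfZ].
by apply: bmf_prod => j; exact: bmf_comp.
Qed.

Lemma pspan_cst J c : pspan J (fun=> c).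
Proof.
rewrite (_ : (fun=> c) = fun w => c * \prod_(j <- J) (fun _ _ => 1) j (Y j w)).
  by apply: pspanZ; apply: (@pspan_prod J (fun _ _ => 1)) => j; exact: bmf_cst.
by apply/funext => w; rewrite big1 ?mulr1.
Qed.

Lemma pspanM J U V : pspan J U -> pspan J V -> pspan J (fun w => U w * V w).
Proof.
move=> sU sV; elim: sU => [h bh|U1 U2 _ IH1 _ IH2|c U1 _ IH].
- elim: sV => [h' bh'|U1 U2 _ IH1 _ IH2|c U1 _ IH].
  + under eq_fun do rewrite -big_split/=.
    by apply: (@pspan_prod J (fun j x => h j x * h' j x)) => j; exact: bmfM.
  + by under eq_fun do rewrite mulrDr; exact: pspanD.
  + by under eq_fun do rewrite mulrCA; exact: pspanZ.
- by under eq_fun do rewrite mulrDl; exact: pspanD.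
- by under eq_fun do rewrite -mulrA; exact: pspanZ.
Qed.

Lemma pspanX J U n : pspan J U -> pspan J (fun w => U w ^+ n).
Proof.
move=> sU; elim: n => [|n IH].
  by under eq_fun do rewrite expr0; exact: pspan_cst.
by under eq_fun do rewrite exprS; exact: pspanM.
Qed.

Lemma pspanB J U V : pspan J U -> pspan J V -> pspan J (fun w => U w - V w).
Proof.
move=> sU sV; under eq_fun do rewrite -[X in _ - X]mul1r -mulNr.
by apply: pspanD => //; exact: pspanZ.
Qed.

Lemma pspan_sum J (K : eqType) (r : seq K) (F : K -> T -> R) :
  (forall k, k \in r -> pspan J (F k)) ->
  pspan J (fun w => \sum_(k <- r) F k w).
Proof.
elim: r => [|k r IH] H.
  by under eq_fun do rewrite big_nil; exact: pspan_cst.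
under eq_fun do rewrite big_cons; apply: pspanD.
  by apply: H; rewrite mem_head.
by apply: IH => i ir; apply: H; rewrite inE ir orbT.
Qed.

(** Indices of [J'] outside [J] receive the constant function 1. *)
Lemma pspan_sub J J' U : uniq J -> uniq J' -> {subset J <= J'} ->
  pspan J U -> pspan J' U.
Proof.
move=> uJ uJ' JJ'; elim=> [h bh|????? ?|????]; [|exact: pspanD|exact: pspanZ].
rewrite (_ : (fun _ => _) = fun w => \prod_(j <- J')
    (fun j => if j \in J then h j else (fun=> 1)) j (Y j w)).
  apply: (@pspan_prod J' (fun j => if j \in J then h j else (fun=> 1))) => j.
  by case: ifP => // _; exact: bmf_cst.
apply/funext => w; rewrite [RHS](bigID (mem J))/= [X in _ = _ * X]big1 ?mulr1; last first.
  by move=> j /negbTE ->.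
rewrite -[RHS]big_filter [RHS](eq_big_seq (fun j => h j (Y j w))); last first.
  by move=> j; rewrite mem_filter => /andP[/= ->].
apply: perm_big; apply: uniq_perm => //; first exact: filter_uniq.
move=> j; rewrite mem_filter/=; case: (boolP (j \in J)) => //= /JJ'; exact.
Qed.

Lemma pspan_gen J j (h : R -> R) : uniq J -> j \in J -> bmf h ->
  pspan J (fun w => h (Y j w)).
Proof.
move=> uJ jJ bh; apply: (@pspan_sub [:: j]) => //.
  by move=> i; rewrite inE => /eqP ->.
have := @pspan_prod [:: j] (fun=> h) (fun=> bh).
by under eq_fun do rewrite big_seq1.
Qed.

(** Both sides are bilinear, so only products have to be treated, and two products over disjoint
    lists form a single product over [J ++ J']. *)
Lemma Ex_pspanM J J' U V : uniq (J ++ J') -> (forall j, j \in J ++ J' -> A j) ->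
  pspan J U -> pspan J' V -> Ex P (fun w => U w * V w) = Ex P U * Ex P V.
Proof.
move=> uJ JA sU sV.
have iS K W : pspan K W -> itg P W by move=> sW; apply/bmf_itg; exact: pspan_bmf sW.
have iM U1 V1 : pspan J U1 -> pspan J' V1 -> itg P (fun w => U1 w * V1 w).
  by move=> /pspan_bmf ? /pspan_bmf ?; apply: bmf_itg; exact: bmfM.
elim: sU => [h bh|U1 U2 s1 IH1 s2 IH2|c U1 s1 IH].
- have sh := pspan_prod J bh.
  elim: sV => [h' bh'|U1 U2 s1 IH1 s2 IH2|c U1 s1 IH].
  + pose g j := if j \in J then h j else h' j.
    have gJ' j : j \in J' -> g j = h' j.
      move=> jJ'; rewrite /g; case: ifPn => // jJ.
      move: uJ; rewrite cat_uniq => /and3P[_ /hasPn/(_ j jJ')].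
      by rewrite /= jJ.
    have -> : (fun w => (\prod_(j <- J) h j (Y j w)) * (\prod_(j <- J') h' j (Y j w)))
      = (fun w => \prod_(j <- J ++ J') g j (Y j w)).
      apply/funext => w; rewrite big_cat/=; congr (_ * _).
        by apply: eq_big_seq => j jJ; rewrite /g jJ.
      by apply: eq_big_seq => j jJ; rewrite gJ'.
    have bg j : bmf (g j) by rewrite /g; case: ifP.
    move: (uJ); rewrite cat_uniq => /and3P[uJ1 _ uJ2].
    rewrite !Ex_prod// => [|j jJ|j jJ]; last 2 first.
    * by apply: JA; rewrite mem_cat jJ orbT.
    * by apply: JA; rewrite mem_cat jJ.
    rewrite big_cat/=; congr (_ * _).
      by apply: eq_big_seq => j jJ; rewrite /g jJ.
    by apply: eq_big_seq => j jJ; rewrite gJ'.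
  + under eq_Ex do rewrite mulrDr.
    by rewrite (ExD (iM _ _ sh s1) (iM _ _ sh s2)) IH1 IH2 (ExD (iS _ _ s1) (iS _ _ s2)) mulrDr.
  + under eq_Ex do rewrite mulrCA.
    by rewrite (ExZ _ (iM _ _ sh s1)) IH (ExZ _ (iS _ _ s1)) mulrCA.
- under eq_Ex do rewrite mulrDl.
  by rewrite (ExD (iM _ _ s1 sV) (iM _ _ s2 sV)) IH1 IH2 (ExD (iS _ _ s1) (iS _ _ s2)) mulrDl.
- under eq_Ex do rewrite -mulrA.
  by rewrite (ExZ _ (iM _ _ s1 sV)) IH (ExZ _ (iS _ _ s1)) mulrA.
Qed.

End independence.

(** * The Gaussian cosine transform *)

Section gaussian.
Variable R : realType.
Notation lam := (@lebesgue_measure R).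
Notation N01 := (normal_prob (0 : R) 1).
Let pdf : R -> R := normal_pdf (0 : R) 1.

Let pdfE x : pdf x = normal_peak 1 * expR (- x ^+ 2 / 2).
Proof. by rewrite /pdf normal_pdfE ?oner_neq0// /normal_fun subr0 expr1n. Qed.

Let mpdf : measurable_fun setT pdf.
Proof. exact: measurable_normal_pdf. Qed.

Let pdf_ge0 x : 0 <= pdf x.
Proof. exact: normal_pdf_ge0. Qed.

Let ipdf : lam.-integrable setT (EFin \o pdf).
Proof. exact: integrable_normal_pdf. Qed.

Let iM (h : R -> R) : bmf h -> lam.-integrable setT (EFin \o (fun x => h x * pdf x)).
Proof.
move=> [mh [M hM]].
apply: (@le_integrable _ _ _ lam _ measurableT _ (fun x => M%:E * (EFin \o pdf) x)%E).
- by apply/measurable_EFinP; exact: measurable_funM.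
- move=> x _ /=; rewrite lee_fin !normrM ler_wpM2r//.
  by rewrite (le_trans (hM x))// ler_norm.
- exact: integrableZl.
Qed.

(** On indicators this is the definition of [normal_prob] by its density; both sides are bounded
    linear functionals of [h]. *)
Lemma Ex_normalE (h : R -> R) : bmf h ->
  Ex N01 h = Rintegral lam setT (fun x => h x * pdf x).
Proof.
apply: (@bounded_linear_eq _ _ _ (Ex N01)
  (fun h => Rintegral lam setT (fun x => h x * pdf x))).
- exact: (@bounded_linear_Ex1 _ _ _ _ _ N01 id).
- split=> [c U V bU bV|].
    rewrite -(RintegralZl c measurableT (iM bU)).
    rewrite -(RintegralD measurableT (integrableZl measurableT c (iM bU)) (iM bV)).
    by apply: eq_Rintegral => x _; rewrite mulrDl mulrA.
  exists 1 => U M bU UM; apply: le_trans (le_normr_Rintegral _ (iM bU)) _ => //.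
  rewrite mul1r -[leRHS]mulr1.
  have <- : Rintegral lam setT pdf = 1.
    by rewrite /Rintegral integral_normal_pdf.
  rewrite -RintegralZl//; apply: le_Rintegral => //.
  + exact: integrable_norm (iM bU).
  + exact: (integrableZl measurableT M ipdf).
  + move=> x _; have := ler_wpM2r (pdf_ge0 x) (UM x).
    by rewrite normrM (ger0_norm (pdf_ge0 x)).
- move=> B mB; apply: EFin_inj; rewrite Ex_indic// /Rintegral fineK; last first.
    by apply: (integrable_fin_num measurableT); apply: iM; exact: bmf_indic.
  transitivity (\int[lam]_(x in B) (pdf x)%:E)%E => //.
  rewrite [LHS]integral_mkcond; congr (integral _ _ _); apply/funext => x.
  by rewrite patchE indicE; case: (x \in B); rewrite ?mul1r ?mul0r.
Qed.

(** Domination by the Gaussian density of variance 2: [|x| <= 1 + x^2 / 4 <= exp (x^2 / 4)], and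
    this factor turns [exp (- x^2 / 2)] into [exp (- x^2 / 4)]. *)
Let ixpdf : lam.-integrable setT (EFin \o (fun x => `|x| * pdf x)).
Proof.
pose s := Num.sqrt (2 : R).
have s0 : s != 0 by rewrite gt_eqF// sqrtr_gt0.
have := integrable_normal_pdf (0 : R) s.
move=> /(integrableZl measurableT (normal_peak 1 / normal_peak s)).
apply: le_integrable => //.
  by apply/measurable_EFinP; apply: measurable_funM => //; exact: measurableT_comp.
move=> x _ /=; rewrite lee_fin normrM normr_id (ger0_norm (pdf_ge0 _)).
rewrite [leRHS]ger0_norm; last first.
  by rewrite mulr_ge0 ?divr_ge0 ?normal_peak_ge0// normal_pdf_ge0.
rewrite normal_pdfE// /normal_fun subr0 mulrA divfK; last by rewrite gt_eqF// normal_peak_gt0.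
rewrite pdfE mulrCA ler_wpM2l ?normal_peak_ge0// /s sqr_sqrtr//.
have -> : - x ^+ 2 / 2 = - (x ^+ 2 / 4) + - x ^+ 2 / (2 *+ 2) by field.
rewrite expRD expRN mulrA mulrC -[leRHS]mulr1 ler_wpM2l ?expR_ge0//.
rewrite mulrC ler_pdivrMl ?expR_gt0// mulr1.
apply: le_trans (expR_ge1Dx _).
rewrite -real_normK ?num_real//; have := sqr_ge0 (`|x| / 2 - 1).
by set y := `|x|; nra.
Qed.

Let dpdf (x : R) : is_derive x 1 pdf (- x * pdf x).
Proof.
have -> : pdf = (fun x => normal_peak 1 * expR (- x ^+ 2 / 2)).
  by apply/funext => y; rewrite pdfE.
apply: is_derive_eq.
by rewrite /GRing.scale /=; field.
Qed.

(** The fundamental theorem of calculus on [[-n, n]], then dominated convergence of the restrictions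
    of [f], with [|f|] as dominating function. *)
Let Rintegral_derive_line (F f : R -> R) :
  (forall x : R, is_derive x 1 F (f x)) -> continuous f ->
  lam.-integrable setT (EFin \o f) ->
  F n%:R - F (- n%:R) @[n --> \oo] --> 0 ->
  Rintegral lam setT f = 0.
Proof.
move=> dF cf intf F0.
have cF : continuous F.
  move=> x; apply: differentiable_continuous; apply/derivable1_diffP.
  exact: (@ex_derive _ _ _ _ _ _ _ (dF x)).
pose fn (n : nat) := f \_ `[- n%:R, n%:R].
have H1 n : (\int[lam]_x (EFin \o fn n) x = (F n%:R - F (- n%:R))%:E)%E.
  rewrite /fn -restrict_EFin -integral_mkcond; case: n => [|n].
    by rewrite oppr0 subrr set_itv1 integral_set1.
  rewrite EFinB; apply: continuous_FTC2 => //.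
  - by rewrite (@lt_trans _ _ 0)// ?oppr_lt0 ltr0n.
  - exact: continuous_subspaceT.
  - split.
    + by move=> x _; exact: (@ex_derive _ _ _ _ _ _ _ (dF x)).
    + by apply: cvg_at_right_filter; exact: cF.
    + by apply: cvg_at_left_filter; exact: cF.
  - by move=> x _; rewrite derive1E; exact: (@derive_val _ _ _ _ _ _ _ (dF x)).
have H2 : (\int[lam]_x (EFin \o fn n) x @[n --> \oo] --> \int[lam]_x (f x)%:E)%E.
  apply: (@dominated_cvg _ _ _ lam _ measurableT (fun n => EFin \o fn n) (EFin \o f)
     (abse \o (EFin \o f))).
  - move=> n; apply/measurable_EFinP; rewrite /fn.
    apply/(measurable_restrictT f (measurable_itv _)).
    by apply: measurable_funTS; exact: continuous_measurable_fun.
  - move=> x _; apply: cvg_near_cst.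
    have [N _ HN] := nbhs_infty_gtr `|x|.
    exists N => // n /= Nn.
    rewrite /fn patchE mem_set//= in_itv/= -ler_norml ltW//.
    exact: HN.
  - by [].
  - exact: integrable_abse.
  - move=> n x _ /=; rewrite lee_fin /fn patchE.
    by case: ifP => // _; rewrite normr0.
rewrite /Rintegral.
suff -> : (\int[lam]_x (f x)%:E = 0)%E by [].
apply: (cvg_unique _ H2); first exact: ereal_hausdorff.
rewrite (_ : (fun n => _) = (fun n => (F n%:R - F (- n%:R))%:E)); last exact/funext.
by apply: cvg_EFin => //; exact: nearW.
Qed.

Let pdf_cvg0 : pdf n%:R @[n --> \oo] --> 0.
Proof.
(* The majorant comes from [- n^2 / 2 <= 1 / 2 - n], that is, [(n - 1)^2 >= 0]. *)
apply: (@squeeze_cvgr _ _ _ _ (cst 0) (fun n => normal_peak 1 * expR (2^-1) * expR (- n%:R))).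
- apply: nearW => n; rewrite pdf_ge0/= pdfE -mulrA ler_wpM2l ?normal_peak_ge0//.
  rewrite -expRD ler_expR.
  by have := sqr_ge0 (n%:R - 1 : R); nra.
- exact: cvg_cst.
- rewrite -[X in _ --> X](mulr0 (normal_peak 1 * expR 2^-1)).
  by apply: cvgMr; exact: cvgn_expR.
Qed.

Let pdfN x : pdf (- x) = pdf x.
Proof. by rewrite !pdfE sqrrN. Qed.

Let bmf_cos (t th : R) : bmf (fun x : R => cos (t * x + th)).
Proof.
split; last by exists 1 => x; exact: cos_max.
apply: continuous_measurable_fun => x; apply: continuous_comp; last exact: continuous_cos.
by apply: cvgD; [apply: cvgMr; exact: cvg_id|exact: cvg_cst].
Qed.

Let bmf_sin (t th : R) : bmf (fun x : R => sin (t * x + th)).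
Proof.
split; last by exists 1 => x; exact: sin_max.
apply: continuous_measurable_fun => x; apply: continuous_comp; last exact: continuous_sin.
by apply: cvgD; [apply: cvgMr; exact: cvg_id|exact: cvg_cst].
Qed.

Let ixsin (t th : R) :
  lam.-integrable setT (EFin \o (fun x => x * sin (t * x + th) * pdf x)).
Proof.
apply: (le_integrable measurableT _ _ ixpdf).
  apply/measurable_EFinP; apply: measurable_funM => //.
  by apply: measurable_funM => //; case: (bmf_sin t th).
move=> x _ /=; rewrite lee_fin !normrM normr_id ler_wpM2r// ler_piMr//.
exact: sin_max.
Qed.

(* The derivative of [- pdf x * sin (t x + th)] integrates to 0. *)
Let gauss_parts (t th : R) :
  Rintegral lam setT (fun x => x * sin (t * x + th) * pdf x) =
  t * Rintegral lam setT (fun x => cos (t * x + th) * pdf x).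
Proof.
rewrite -(RintegralZl t measurableT (iM (bmf_cos t th))).
apply/eqP; rewrite -subr_eq0; apply/eqP.
rewrite -(RintegralB measurableT (ixsin t th) (integrableZl measurableT t (iM (bmf_cos t th)))).
have dF (x : R) : is_derive x 1 (fun x => - (pdf x * sin (t * x + th)))
   (x * sin (t * x + th) * pdf x - t * (cos (t * x + th) * pdf x)).
  have dp := dpdf x.
  apply: is_derive_eq; rewrite /GRing.scale /=; ring.
apply: (Rintegral_derive_line dF).
- move=> x; have dp := dpdf x.
  apply: differentiable_continuous; apply/derivable1_diffP.
  exact: ex_derive.
- exact: (integrableB measurableT (ixsin t th) (integrableZl measurableT t (iM (bmf_cos t th)))).
- apply: norm_cvg0.
  apply: (@squeeze_cvgr _ _ _ _ (cst 0) (fun n => 2 * pdf n%:R)).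
  + apply: nearW => n; rewrite normr_ge0/= pdfN -opprB normrN opprK addrC.
    have h y : `|pdf n%:R * sin y| <= pdf n%:R.
      by rewrite normrM (ger0_norm (pdf_ge0 _)) ler_piMr// sin_max.
    by rewrite mulr_natl mulr2n (le_trans (ler_normB _ _))// lerD.
  + exact: cvg_cst.
  + by rewrite -[X in _ --> X](mulr0 (2 : R)); apply: cvgMr; exact: pdf_cvg0.
Qed.

(** The phase [th] gathers the real and imaginary parts of the characteristic function in one real
    family. *)
Let phi (th t : R) := Rintegral lam setT (fun x => cos (t * x + th) * pdf x).

(** Differentiation under the integral, dominated by [|x| pdf x], produces the integral of
    [- x sin (t x + th) pdf x]; [gauss_parts] turns it into a multiple of [phi th t], which gives
    the equation [y' = - t y]. *)
Let dphi (th t : R) : is_derive t 1 (phi th) (- t * phi th t).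
Proof.
pose f (t x : R) := cos (t * x + th) * pdf x.
have d1 (u x : R) : is_derive u 1 (f ^~ x) (- (x * sin (u * x + th) * pdf x)).
  by apply: is_derive_eq; rewrite /GRing.scale /=; ring.
have d1E (u x : R) : partial1of2 f u x = - (x * sin (u * x + th) * pdf x).
  by rewrite partial1of2E; exact: (@derive_val _ _ _ _ _ _ _ (d1 u x)).
have Ia : `]t - 1, t + 1[%classic t by rewrite /= in_itv/=; apply/andP; split; lra.
have h1 x : `]t - 1, t + 1[%classic x -> lam.-integrable setT (EFin \o f x).
  by move=> _; exact: iM.
have h2 x y : `]t - 1, t + 1[%classic x -> setT y -> derivable (f ^~ y) x 1.
  by move=> _ _; exact: (@ex_derive _ _ _ _ _ _ _ (d1 x y)).
have h3 x y : `]t - 1, t + 1[%classic x -> setT y -> `|partial1of2 f x y| <= `|y| * pdf y.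
  move=> _ _; rewrite d1E normrN !normrM (ger0_norm (pdf_ge0 _)) ler_wpM2r// ler_piMr//.
  exact: sin_max.
have h4 y : 0 <= `|y| * pdf y by rewrite mulr_ge0.
apply: DeriveDef; first exact: (derivable_under_integral measurableT Ia h1 h2 h4 ixpdf h3).
rewrite -derive1E (differentiation_under_integral measurableT Ia h1 h2 h4 ixpdf h3).
rewrite mulNr -gauss_parts -[RHS]mulN1r -(RintegralZl _ measurableT (ixsin t th)).
by apply: eq_Rintegral => x _; rewrite d1E mulN1r.
Qed.

(** By this differential equation, [phi th t * exp (t^2 / 2)] is constant in [t], and its value at 0
    is [cos th]. *)
Lemma Ex_normal_cos (t th : R) :
  Ex N01 (fun x => cos (t * x + th)) = expR (- t ^+ 2 / 2) * cos th.
Proof.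
rewrite (Ex_normalE (bmf_cos t th)).
have H (u : R) : is_derive u 1 (fun u => phi th u * expR (u ^+ 2 / 2)) 0.
  have dp := dphi th u.
  by apply: is_derive_eq; rewrite /GRing.scale /=; field.
have := is_derive_0_is_cst t 0 H.
rewrite expr0n/= mul0r expR0 mulr1 => E.
have -> : Rintegral lam setT (fun x => cos (t * x + th) * pdf x) = phi th t by [].
have e0 : expR (t ^+ 2 / 2) != 0 by rewrite gt_eqF ?expR_gt0.
apply: (mulIf e0); rewrite E.
rewrite mulrAC -expRD mulNr addNr expR0 mul1r /phi.
under eq_Rintegral do rewrite mul0r add0r.
by rewrite RintegralZl// /Rintegral integral_normal_pdf mulr1.
Qed.

End gaussian.

(** * Deviation indicators and limits of expectations *)

Definition tail (R : realType) (L : R) : set R := [set y | L < `|y|].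

Lemma measurable_tail (R : realType) (L : R) : measurable (tail L).
Proof.
rewrite (_ : tail L = (fun y : R => `|y|) @^-1` `]L, +oo[).
  rewrite -[X in measurable X]setTI.
  have mn : measurable_fun setT (fun y : R => `|y|) by exact: measurableT_comp.
  exact: mn.
by apply/seteqP; split => y /=; rewrite in_itv/= andbT.
Qed.

Lemma bmf_tail (R : realType) (L : R) : bmf (\1_(tail L) : R -> R).
Proof. by apply: bmf_indic; exact: measurable_tail. Qed.

Lemma tail_le (R : realType) (L y : R) : L < `|y| -> \1_(tail L) y = 1 :> R.
Proof. by move=> Ly; rewrite indicE mem_set. Qed.

Section Ex_limits.
Context d (T : measurableType d) (R : realType) (P : probability T R).

Lemma Ex_dominated (U : nat -> T -> R) (V : T -> R) (W : T -> R) :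
  (forall n, measurable_fun setT (U n)) -> measurable_fun setT V -> itg P W ->
  (forall n w, `|U n w| <= W w) -> (forall w, U n w @[n --> \oo] --> V w) ->
  Ex P (U n) @[n --> \oo] --> Ex P V.
Proof.
move=> mU mV iW UW UV.
have VW w : `|V w| <= W w.
  have : `|U n w| @[n --> \oo] --> `|V w| by apply: cvg_norm; exact: UV.
  move=> /cvg_lim <-//; apply: limr_le; first by apply: is_cvg_norm; apply/cvg_ex; exists (V w); exact: UV.
  by apply: nearW => n; exact: UW.
have iV : itg P V by exact: itg_le VW.
rewrite /Ex /Rintegral; apply: fine_cvg; rewrite fineK; last exact: integrable_fin_num.
apply: (@dominated_cvg _ _ _ P _ measurableT (fun n => EFin \o U n) (EFin \o V) (EFin \o W)) => //.
- by move=> n; apply/measurable_EFinP.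
- by move=> w _; apply: cvg_EFin; [exact: nearW|exact: UV].
- by move=> n w _; rewrite /= lee_fin.
Qed.

Lemma tail_cvg0 (Z : T -> R) : measurable_fun setT Z ->
  Ex P (fun w => \1_(tail n%:R) (Z w)) @[n --> \oo] --> 0.
Proof.
move=> mZ; rewrite -[X in _ --> X](Ex_cst P 0).
apply: (@Ex_dominated _ _ (fun=> 1)) => //.
- by move=> n; case: (bmf_comp mZ (bmf_tail n%:R)).
- exact: itg_cst.
- by move=> n w; rewrite indicE; case: (_ \in _); rewrite ?normr1 ?normr0.
- move=> w; apply: cvg_near_cst.
  have [N _ HN] := nbhs_infty_gtr `|Z w|.
  exists N => // n /= Nn.
  by rewrite indicE memNset// /tail/= => /(lt_trans (HN _ Nn)); rewrite ltxx.
Qed.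

(** The two functions differ by at most [e] where [|Z| <= L], and by at most [2 M] on the deviation
    event. *)
Lemma Ex_approx (Z : T -> R) (g h : R -> R) (e M L : R) :
  measurable_fun setT Z -> bmf g -> bmf h ->
  (forall x, `|g x| <= M) -> (forall x, `|h x| <= M) ->
  (forall x, `|x| <= L -> `|g x - h x| <= e) -> 0 <= e ->
  `|Ex P (fun w => g (Z w)) - Ex P (fun w => h (Z w))| <=
     e + 2 * M * Ex P (fun w => \1_(tail L) (Z w)).
Proof.
move=> mZ bg bh gM hM gh e0.
have bgZ := bmf_comp mZ bg; have bhZ := bmf_comp mZ bh.
have btZ := bmf_comp mZ (bmf_tail L).
rewrite -ExB; [|exact: bmf_itg|exact: bmf_itg].
rewrite -(ExZ _ (bmf_itg P btZ)) -[X in X + _](Ex_cst P e) -ExD; [|exact: itg_cst|exact/itgZ/bmf_itg].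
apply: norm_Ex_le.
- by apply: itgB; exact: bmf_itg.
- by apply: itgD; [exact: itg_cst|apply: itgZ; exact: bmf_itg].
move=> w; rewrite indicE.
have M0 : 0 <= M by exact: le_trans (normr_ge0 _) (gM 0).
case: (boolP (Z w \in tail L)) => [_|].
  rewrite mulr1 (le_trans (ler_normB _ _))//.
  by have := gM (Z w); have := hM (Z w); lra.
rewrite notin_setE /tail/= => /negP; rewrite -leNgt => /gh.
by rewrite mulr0 addr0.
Qed.

End Ex_limits.

(** * Uniform approximation by trigonometric polynomials *)

Section bernstein.
Variable R : realType.

(** The Bernstein polynomial [sum_k binom(n, k) x^k (1 - x)^(n - k) h(k)], that is, the mean of [h]
    at a binomial variable, computed by conditioning on one trial. In this form positivity and
    moments follow by plain induction. *)
Fixpoint bern (x : R) n (h : nat -> R) : R :=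
  if n is n'.+1 then
    (1 - x) * bern x n' h + x * bern x n' (fun k => h k.+1)
  else h 0%N.

Lemma bern_le x n h h' : 0 <= x <= 1 ->
  (forall k, (k <= n)%N -> h k <= h' k) -> bern x n h <= bern x n h'.
Proof.
move=> /andP[x0 x1]; elim: n h h' => [|n IH] h h' hh'; first exact: hh'.
rewrite /= lerD// ler_wpM2l ?subr_ge0//; apply: IH => k kn; apply: hh' => //.
exact: leq_trans kn _.
Qed.

(** The binomial variance [n x (1 - x)] plus the square of the shifted mean. The shift [c] absorbs
    the passage from [k] to [k.+1] in the recursion. *)
Lemma bern_quad x n (a b c : R) :
  bern x n (fun k => a + b * (k%:R + c) ^+ 2) =
  a + b * (n%:R * (x * (1 - x)) + (n%:R * x + c) ^+ 2).
Proof.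
elim: n c => [|n IH] c /=; first by rewrite !mul0r !add0r.
have E : (fun k => a + b * (k.+1%:R + c) ^+ 2) = (fun k => a + b * (k%:R + (1 + c)) ^+ 2).
  by apply/funext => k; rewrite -natr1 addrA.
by rewrite E !IH -!natr1; ring.
Qed.

Lemma bern_norm x n h M : 0 <= x <= 1 ->
  (forall k, (k <= n)%N -> `|h k| <= M) -> `|bern x n h| <= M.
Proof.
move=> x01 hM.
have E a : bern x n (fun=> a) = a.
  have := bern_quad x n a 0 0; rewrite mul0r addr0 => {2}<-.
  by congr (bern _ _ _); apply/funext => k; rewrite mul0r addr0.
rewrite ler_norml -{1}(E (- M)) -{2}(E M) !bern_le// => k kn.
  by have := hM k kn; rewrite ler_norml => /andP[].
by have := hM k kn; rewrite ler_norml => /andP[].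
Qed.

(** Compactness of [[0, 1]] gives a uniform radius [1 / (N + 1)] within which the increment is at
    most [e]. Farther away, [C = 2 M (N + 1)^2] makes the quadratic term exceed the trivial bound
    [2 M]. A quadratic modulus is the kind that [bern_quad] averages exactly. *)
Lemma quad_modulus (G : R -> R) (M e : R) : continuous G ->
  (forall x, `|G x| <= M) -> 0 < e ->
  exists2 C, 0 <= C & forall u v, 0 <= u <= 1 -> `|G v - G u| <= e + C * (v - u) ^+ 2.
Proof.
move=> cG GM e0.
pose Q (n : nat) (u : R) := forall v, `|v - u| < n.+1%:R^-1 -> `|G v - G u| <= e.
have /compact_near_coveringP/(_ nat \oo Q _) : compact `[0 : R, 1] by exact: segment_compact.
move=> /(_ _)/wrap[].
  move=> x _.
  have /cvgrPdist_le/(_ (e / 2)) := cG x.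
  move=> /(_ _)/wrap[]; first by rewrite divr_gt0.
  move=> [r /= r0 Hr].
  have [N _ HN] : \forall n \near \oo, n.+1%:R^-1 < r / 2.
    by apply: near_infty_natSinv_lt (PosNum (divr_gt0 r0 (@ltr0n R 2))).
  exists (ball x (r / 2), [set n | (N <= n)%N]) => /=.
    by split; [apply: nbhsx_ballx; rewrite divr_gt0|exists N].
  move=> [u n] /= [xu Nn] v vu.
  have xv : ball x r v.
    rewrite /ball/=; rewrite /ball/= in xu.
    have := HN _ Nn => /= nr.
    rewrite -(subrK u x) -addrA (le_lt_trans (ler_normD _ _))//.
    by have := lt_trans vu nr; rewrite (distrC u v); lra.
  have xu' : ball x r u by rewrite /ball/= (lt_trans xu)// ltr_pdivrMr// ltr_pMr// ltr1n.
  rewrite -(subrK (G x) (G v)) -addrA (le_trans (ler_normD _ _))//.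
  by have := Hr _ xv; have := Hr _ xu'; rewrite (distrC (G v)) /=; lra.
move=> [N _ /(_ N (leqnn N))] HQ.
have M0 : 0 <= M by exact: le_trans (normr_ge0 _) (GM 0).
exists (2 * M * N.+1%:R ^+ 2); first by rewrite !mulr_ge0 ?exprn_ge0.
move=> u v u01.
have := HQ u; rewrite /= in_itv/= => /(_ u01 v).
case: (ltP `|v - u| N.+1%:R^-1) => [_ /(_ isT)|vu _].
  move=> /le_trans; apply; rewrite lerDl mulr_ge0 ?sqr_ge0//.
  by rewrite !mulr_ge0 ?exprn_ge0.
apply: (@le_trans _ _ (2 * M)).
  by rewrite (le_trans (ler_normB _ _))//; have := GM u; have := GM v; lra.
apply: ler_wpDl; first exact: ltW.
rewrite -[leRHS]mulrA ler_peMr ?mulr_ge0//.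
rewrite -[X in _ * X]real_normK ?num_real// -exprMn exprn_ege1//.
by rewrite -ler_pdivrMl// mulr1.
Qed.

(** The phases make sines available, as [sin u = cos (u - pi / 2)]. *)
Inductive trigpoly : (R -> R) -> Prop :=
| trig_cos t th : trigpoly (fun x => cos (t * x + th))
| trigD h1 h2 : trigpoly h1 -> trigpoly h2 -> trigpoly (fun x => h1 x + h2 x)
| trigZ c h : trigpoly h -> trigpoly (fun x => c * h x).

Lemma trig_cst c : trigpoly (fun=> c).
Proof.
have := trigZ c (trig_cos 0 0); congr trigpoly; apply/funext => x.
by rewrite mul0r addr0 cos0 mulr1.
Qed.

(** Product to sum: [sin u cos v] is half of [sin (u + v) + sin (u - v)]. The recursion for [bern]
    at [(1 + sin (t x)) / 2] multiplies by such sines. *)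
Lemma trigMsin t h : trigpoly h -> trigpoly (fun x => sin (t * x) * h x).
Proof.
elim=> [s th|h1 h2 _ H1 _ H2|c h1 _ H1].
- have H u v : sin u * cos v = 2^-1 * cos (u + v + (- (pi / 2))) + 2^-1 * cos (u - v + (- (pi/2))) :> R.
    by rewrite !cosBpihalf !sinD sinN cosN; field.
  under eq_fun do rewrite H; apply: trigD; apply: trigZ.
    have := trig_cos (t + s) (th - pi / 2); congr trigpoly; apply/funext => x.
    by congr cos; ring.
  have := trig_cos (t - s) (- th - pi / 2); congr trigpoly; apply/funext => x.
  by congr cos; ring.
- by under eq_fun do rewrite mulrDr; exact: trigD.
- by under eq_fun do rewrite mulrCA; exact: trigZ.
Qed.

Lemma trig_bern t n (h : nat -> R) :
  trigpoly (fun x => bern ((1 + sin (t * x)) / 2) n h).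
Proof.
elim: n h => [|n IH] h /=; first exact: trig_cst.
have -> : (fun x => (1 - (1 + sin (t * x)) / 2) * bern ((1 + sin (t * x)) / 2) n h +
    (1 + sin (t * x)) / 2 * bern ((1 + sin (t * x)) / 2) n (fun k => h k.+1)) =
  (fun x => 2^-1 * (bern ((1 + sin (t * x)) / 2) n h +
    ((-1) * (sin (t * x) * bern ((1 + sin (t * x)) / 2) n h) +
    (bern ((1 + sin (t * x)) / 2) n (fun k => h k.+1) +
    sin (t * x) * bern ((1 + sin (t * x)) / 2) n (fun k => h k.+1))))).
  by apply/funext => x; field.
apply: trigZ; apply: trigD => //; apply: trigD; first by apply: trigZ; exact: trigMsin.
by apply: trigD => //; exact: trigMsin.
Qed.

(* Turns a continuous function of [x] into one of [sin x]. *)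
Lemma sin_retract : exists2 psi : R -> R, continuous psi &
  forall x, `|x| <= 2^-1 -> psi (sin x) = x.
Proof.
have p2 : 1 <= pi / 2 :> R by rewrite ler_pdivlMr// mul1r pi_ge2.
pose s : R := sin 2^-1.
have inpi (x : R) : `|x| <= 2^-1 -> x \in `[(- (pi / 2)), pi / 2].
  by rewrite ler_norml in_itv/= => /andP[? ?]; apply/andP; split; lra.
have s1 : s < 1.
  rewrite /s -[ltRHS]sin_pihalf ltr_sin; [lra| |].
    by apply: inpi; rewrite ger0_norm.
  by rewrite in_itv/= lexx andbT; lra.
have s0 : 0 < s by apply: sin_gt0_pihalf; apply/andP; split; lra.
(* Clamping to [[-s, s]] keeps the argument inside the open interval [(-1, 1)], where [asin] is
   continuous; with [s = sin (1 / 2)] it changes nothing on the sines of points of [[-1/2, 1/2]]. *)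
pose clamp (u : R) := Num.max (- s) (Num.min s u).
exists (fun u => asin (clamp u)).
  move=> u; apply: (@continuous_comp _ _ _ clamp (@asin R)).
    by apply: continuous_max; [exact: cvg_cst|apply: continuous_min; [exact: cvg_cst|exact: cvg_id]].
  apply: continuous_asin; rewrite /clamp lt_max gt_max gt_min s1 orTb andbT.
  by apply/andP; split; [apply/orP; left; lra|lra].
move=> x x2; have xp := inpi _ x2.
move: (x2); rewrite ler_norml => /andP[xl xr].
have hs : sin x <= s.
  rewrite /s le_eqVlt; move: xr; rewrite le_eqVlt => /predU1P[->|xr]; first by rewrite eqxx.
  by rewrite ltr_sin ?inpi ?xr ?orbT// ger0_norm.
have hs' : - s <= sin x.
  rewrite /s -sinN le_eqVlt; move: xl; rewrite le_eqVlt => /predU1P[->|xl]; first by rewrite eqxx.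
  by rewrite ltr_sin ?inpi ?xl ?orbT// normrN ger0_norm.
by rewrite /clamp (min_idPr hs) (max_idPr hs') sinK.
Qed.

(** For [|x| <= L] the point [x / (2 L)] is recovered from its sine, so [g x = G y] with
    [y = (1 + sin (x / (2 L))) / 2] in [[0, 1]], and [G] is replaced by its Bernstein polynomial.
    The bound [M] survives on the whole line, because [y] never leaves [[0, 1]] and [bern] is an
    average. *)
Lemma trig_approx (g : R -> R) (M e L : R) : continuous g ->
  (forall x, `|g x| <= M) -> 0 < e -> 0 < L ->
  exists2 h, trigpoly h &
    (forall x, `|h x| <= M) /\ (forall x, `|x| <= L -> `|g x - h x| <= e).
Proof.
move=> cg gM e0 L0; have [psi cpsi psiK] := sin_retract.
pose G u := g (2 * L * psi (2 * u - 1)).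
have cG : continuous G.
  move=> u; apply: continuous_comp; last exact: cg.
  apply: cvgMr; apply: continuous_comp; last exact: cpsi.
  by apply: cvgB; [apply: cvgMr; exact: cvg_id|exact: cvg_cst].
have GM u : `|G u| <= M by exact: gM.
have e20 : 0 < e / 2 by rewrite divr_gt0.
have [C C0 HC] := quad_modulus cG GM e20.
have [n Hn] : exists n : nat, C / (e / 2) < n.+1%:R.
  have [N _ H] := nbhs_infty_gtr (C / (e / 2)).
  by exists N; apply: H => /=.
have n0 : (0 : R) < n.+1%:R by rewrite ltr0n.
pose x01 x : R := (1 + sin ((2 * L)^-1 * x)) / 2.
have Hx01 x : 0 <= x01 x <= 1.
  by have := sin_geN1 ((2 * L)^-1 * x); have := sin_le1 ((2 * L)^-1 * x); rewrite /x01; lra.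
exists (fun x => bern (x01 x) n.+1 (fun k => G (k%:R / n.+1%:R))); first exact: trig_bern.
split=> [x|x xL]; first exact: bern_norm.
pose y := x01 x; have y01 : 0 <= y <= 1 := Hx01 x.
have -> : g x = G y.
  rewrite /G /y /x01 (_ : 2 * _ - 1 = sin ((2 * L)^-1 * x)); last by field.
  have L20 : 0 < 2 * L by rewrite mulr_gt0.
  rewrite psiK ?mulVKf ?gt_eqF// normrM gtr0_norm ?invr_gt0//.
  by rewrite ler_pdivrMl// mulrAC divff ?pnatr_eq0// mul1r.
(* Averaging the quadratic modulus around the binomial mean [(n + 1) y] leaves [C / (n + 1)^2] times
   the variance, which is at most [C / (n + 1) < e / 2]. *)
have Hq : `|bern y n.+1 (fun k => G (k%:R / n.+1%:R)) - G y| <= e.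
  have B k : `|G (k%:R / n.+1%:R) - G y| <= e / 2 + C / n.+1%:R ^+ 2 * (k%:R + - (n.+1%:R * y)) ^+ 2.
    apply: le_trans (HC _ _ y01) _; rewrite lerD2l.
    rewrite le_eqVlt; apply/orP; left; apply/eqP.
    by field; rewrite gt_eqF.
  have yb : y * (1 - y) <= 1 by nra.
  have Cb : C / n.+1%:R ^+ 2 * (n.+1%:R * (y * (1 - y))) <= e / 2.
    rewrite (_ : _ * _ = C / n.+1%:R * (y * (1 - y))); last by field; rewrite gt_eqF.
    apply: (@le_trans _ _ (C / n.+1%:R)).
      by rewrite ler_piMr// divr_ge0// ltW.
    by rewrite ler_pdivrMr// mulrC -ler_pdivrMr// ltW.
  have Q a b : bern y n.+1 (fun k => a + b * (k%:R + - (n.+1%:R * y)) ^+ 2) =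
      a + b * (n.+1%:R * (y * (1 - y))).
    by rewrite bern_quad subrr expr0n/= addr0.
  move: (C / n.+1%:R ^+ 2) B Cb => cf B Cb.
  rewrite ler_distl; apply/andP; split.
    apply: (@le_trans _ _ (bern y n.+1 (fun k => (G y - e / 2) + (- cf) * (k%:R + - (n.+1%:R * y)) ^+ 2))).
      by rewrite Q mulNr; lra.
    by apply: bern_le => // k _; have := B k; rewrite ler_distl mulNr => /andP[]; lra.
  apply: (@le_trans _ _ (bern y n.+1 (fun k => (G y + e / 2) + cf * (k%:R + - (n.+1%:R * y)) ^+ 2))).
    by apply: bern_le => // k _; have := B k; rewrite ler_distl => /andP[]; lra.
  by rewrite Q; lra.
by rewrite distrC.
Qed.

Lemma trigpoly_bmf h : trigpoly h -> bmf h.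
Proof.
elim=> [t th|? ? ? ? ? ?|? ? ? ?]; [|exact: bmfD|exact: bmfZ].
split; last by exists 1 => x; exact: cos_max.
apply: continuous_measurable_fun => x; apply: continuous_comp; last exact: continuous_cos.
by apply: cvgD; [apply: cvgMr; exact: cvg_id|exact: cvg_cst].
Qed.

End bernstein.

(** * From cosines and tightness to convergence in distribution *)

Section weak_convergence.
Context d (T : measurableType d) (R : realType) (P : probability T R).
Context d' (T' : measurableType d') (P' : probability T' R).
Variables (Y : nat -> T -> R) (Z : T' -> R).
Hypothesis mY : forall n, measurable_fun setT (Y n).
Hypothesis mZ : measurable_fun setT Z.
Hypothesis cvg_cos : forall t th,
  Ex P (fun w => cos (t * Y n w + th)) @[n --> \oo] --> Ex P' (fun w => cos (t * Z w + th)).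
Hypothesis tightY : forall e, 0 < e -> exists2 L, 0 < L &
  \forall n \near \oo, Ex P (fun w => \1_(tail L) (Y n w)) <= e.

Lemma cvg_trigpoly h : trigpoly h ->
  Ex P (fun w => h (Y n w)) @[n --> \oo] --> Ex P' (fun w => h (Z w)).
Proof.
elim=> [t th|h1 h2 t1 IH1 t2 IH2|c h1 t1 IH1]; first exact: cvg_cos.
- have b1 := trigpoly_bmf t1; have b2 := trigpoly_bmf t2.
  under eq_fun do rewrite (ExD (bmf_itg P (bmf_comp (mY _) b1)) (bmf_itg P (bmf_comp (mY _) b2))).
  rewrite (ExD (bmf_itg P' (bmf_comp mZ b1)) (bmf_itg P' (bmf_comp mZ b2))).
  exact: cvgD.
- have b1 := trigpoly_bmf t1.
  under eq_fun do rewrite (ExZ _ (bmf_itg P (bmf_comp (mY _) b1))).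
  rewrite (ExZ _ (bmf_itg P' (bmf_comp mZ b1))).
  exact: cvgMr.
Qed.

Lemma tail_mono (L L' : R) y : L <= L' -> \1_(tail L') y <= \1_(tail L) y :> R.
Proof.
move=> LL'; rewrite !indicE; case: (boolP (y \in tail L')) => [|_].
  by rewrite inE /tail/= => /(le_lt_trans LL') h; rewrite mem_set.
by case: (_ \in _).
Qed.

(** One level [L] serves both for the limit and for all large [n]. Inside [[-L, L]] the function [g]
    is close to a trigonometric polynomial with the same global bound [M], so the tails cost only a
    multiple of [M]. *)
Lemma cvg_continuous_bounded (g : R -> R) : continuous g ->
  (exists M, forall x, `|g x| <= M) ->
  Ex P (fun w => g (Y n w)) @[n --> \oo] --> Ex P' (fun w => g (Z w)).
Proof.
move=> cg [M gM].
have bg : bmf g by split; [exact: continuous_measurable_fun|exists M].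
have M0 : 0 <= M by exact: le_trans (normr_ge0 _) (gM 0).
apply/cvgrPdist_le => e e0.
(* The total error is [3 e1 + 4 M e1]: [e1] for the trigonometric polynomial and [e1 + 2 M e1] for
   each of the two replacements of [g]. *)
pose e1 := e / (5 + 4 * M).
have K0 : 0 < 5 + 4 * M by lra.
have e10 : 0 < e1 by rewrite divr_gt0.
have eE : e = 5 * e1 + 4 * M * e1 by rewrite /e1; field; rewrite gt_eqF.
have [L1 L10 HL1] := tightY e10.
have [L2 HL2] : exists L2 : nat, Ex P' (fun w => \1_(tail L2%:R) (Z w)) <= e1.
  have /cvgr0Pnorm_le/(_ e1 e10)[N _ HN] := tail_cvg0 P' mZ.
  by exists N; apply: le_trans (HN N _) => /=; rewrite ?ler_norm.
pose L := Num.max L1 L2%:R.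
have L0 : 0 < L by rewrite /L lt_max L10.
have [h th [hM gh]] := trig_approx cg gM e10 L0.
have bh := trigpoly_bmf th.
have btY n K := bmf_itg P (bmf_comp (mY n) (bmf_tail K)).
have btZ K := bmf_itg P' (bmf_comp mZ (bmf_tail K)).
have HZ := Ex_approx P' mZ bg bh gM hM gh (ltW e10).
have HZ' : Ex P' (fun w => \1_(tail L) (Z w)) <= e1.
  apply: le_trans HL2; apply: Ex_le => // w.
  by apply: tail_mono; rewrite /L le_max lexx orbT.
have /cvgrPdist_le/(_ e1 e10) Hh := cvg_trigpoly th.
near=> n.
have HY := Ex_approx P (mY n) bg bh gM hM gh (ltW e10).
have HY' : Ex P (fun w => \1_(tail L) (Y n w)) <= e1.
  apply: (@le_trans _ _ (Ex P (fun w => \1_(tail L1) (Y n w)))).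
    by apply: Ex_le => // w; apply: tail_mono; rewrite /L le_max lexx.
  by near: n.
have Hn : `|Ex P' (fun w => h (Z w)) - Ex P (fun w => h (Y n w))| <= e1 by near: n.
have B1 : 2 * M * Ex P (fun w => \1_(tail L) (Y n w)) <= 2 * M * e1 by rewrite ler_wpM2l// mulr_ge0.
have B2 : 2 * M * Ex P' (fun w => \1_(tail L) (Z w)) <= 2 * M * e1 by rewrite ler_wpM2l// mulr_ge0.
move: HZ HY Hn B1 B2; rewrite !ler_norml => /andP[? ?] /andP[? ?] /andP[? ?] ? ?.
by apply/andP; split; lra.
Unshelve. all: by end_near. Qed.

End weak_convergence.

(** * Taylor estimates of elementary functions *)

Section elementary.
Variable R : realType.

(** By the mean value theorem [g x = dg z * x] with [|z| <= |x|]. Each use raises the order by one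
    with the same constant; the factorials of Taylor's formula are given up, since only orders
    matter. The estimates for [sin] and [cos] below are successive uses of it, starting from
    [|sin|, |cos| <= 1]. *)
Lemma derive_pow_bound (g dg : R -> R) (c e : R) n :
  0 <= c -> (forall x : R, `|x| < e -> is_derive x 1 g (dg x)) -> g 0 = 0 ->
  (forall x : R, `|x| < e -> `|dg x| <= c * `|x| ^+ n) ->
  forall x : R, `|x| < e -> `|g x| <= c * `|x| ^+ n.+1.
Proof.
move=> c0 dF g0 dgc x xe.
have MV (a b : R) : a < b -> `|a| < e -> `|b| < e ->
    exists2 z, a <= z <= b & g b - g a = dg z * (b - a).
  move=> ab ae be.
  have inab (z : R) : a <= z <= b -> `|z| < e.
    move: ae be; rewrite !ltr_norml => /andP[? ?] /andP[? ?] /andP[? ?].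
    by apply/andP; split; lra.
  have [z|z|z] := @MVT R g dg a b ab.
  - rewrite in_itv/= => /andP[h1 h2]; apply: dF; apply: inab.
    by rewrite !ltW.
  - apply: derivable_within_continuous => y; rewrite in_itv/= => yab.
    have dy := dF y (inab y yab).
    exact: (@ex_derive _ _ _ _ _ _ _ dy).
  by rewrite in_itv/= => /andP[? ?] ->; exists z => //; rewrite !ltW.
have mono (z : R) : `|z| <= `|x| -> `|dg z| <= c * `|x| ^+ n.
  move=> zx; apply: le_trans (dgc _ (le_lt_trans zx xe)) _.
  by rewrite ler_wpM2l// lerXn2r ?nnegrE.
rewrite exprSr mulrA.
have e0 : 0 < e by exact: le_lt_trans xe.
have [x0|x0|->] := ltgtP x 0.
- have [||z /andP[z1 z2]] := MV _ _ x0 => //; first by rewrite normr0.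
  rewrite g0 !sub0r => /eqP; rewrite eqr_oppLR => /eqP ->.
  rewrite mulrN opprK normrM ler_wpM2r// mono// ler0_norm// ler0_norm ?(ltW x0)// lerN2//.
- have [||z /andP[z1 z2]] := MV _ _ x0 => //; first by rewrite normr0.
  rewrite g0 !subr0 => ->.
  by rewrite normrM ler_wpM2r// mono// ger0_norm// ger0_norm ?(ltW x0).
- by rewrite g0 normr0 mulr0.
Qed.

Let ltS (x : R) : `|x| < `|x| + 1. Proof. by rewrite ltrDl. Qed.

Lemma cos_lip (a u : R) : `|cos (a + u) - cos a| <= `|u|.
Proof.
have := @derive_pow_bound (fun u => cos (a + u) - cos a) (fun u => - sin (a + u)) 1 _ 0 ler01 _ _ _ _ (ltS u).
rewrite expr1 mul1r; apply.
- by move=> x _; apply: is_derive_eq; rewrite /GRing.scale /=; ring.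
- by rewrite addr0 subrr.
- by move=> x _; rewrite normrN mul1r expr0 sin_max.
Qed.

Lemma sin_lip (u : R) : `|sin u| <= `|u|.
Proof.
have := @derive_pow_bound sin cos 1 _ 0 ler01 _ _ _ _ (ltS u).
rewrite expr1 mul1r; apply.
- by rewrite sin0.
- by move=> x _; rewrite mul1r expr0 cos_max.
Qed.

Lemma cos_taylor1 (u : R) : `|1 - cos u| <= `|u| ^+ 2.
Proof.
have := @derive_pow_bound (fun u => 1 - cos u) sin 1 _ 1 ler01 _ _ _ _ (ltS u).
rewrite mul1r; apply.
- by move=> x _; apply: is_derive_eq; rewrite /GRing.scale /=; ring.
- by rewrite cos0 subrr.
- by move=> x _; rewrite mul1r expr1 sin_lip.
Qed.

Lemma sin_taylor (u : R) : `|u - sin u| <= `|u| ^+ 3.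
Proof.
have := @derive_pow_bound (fun u => u - sin u) (fun u => 1 - cos u) 1 _ 2 ler01 _ _ _ _ (ltS u).
rewrite mul1r; apply.
- by rewrite sin0 subrr.
- by move=> x _; rewrite mul1r cos_taylor1.
Qed.

Lemma cos_taylor (u : R) : `|cos u - 1 + u ^+ 2 / 2| <= u ^+ 4.
Proof.
rewrite -[leRHS]ger0_norm ?exprn_even_ge0// normrX.
have := @derive_pow_bound (fun u => cos u - 1 + u ^+ 2 / 2) (fun u => u - sin u) 1 _ 3 ler01 _ _ _ _ (ltS u).
rewrite mul1r; apply.
- by move=> x _; apply: is_derive_eq; rewrite /GRing.scale /=; field.
- by rewrite cos0 expr0n/= mul0r subrr addr0.
- by move=> x _; rewrite mul1r sin_taylor.
Qed.

(** The upper bound is [exp (- x) <= 1 / (1 + x) <= 1 - x + x^2], the last step because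
    [(1 - x + x^2) (1 + x) = 1 + x^3]. *)
Lemma expRN_taylor (x : R) : 0 <= x -> `|expR (- x) - 1 + x| <= x ^+ 2.
Proof.
move=> x0; have h1 := expR_ge1Dx (- x); have h2 := expR_ge1Dx x.
have h3 : expR (- x) * expR x = 1 by rewrite -expRD addNr expR0.
have h4 := expR_gt0 (- x).
rewrite ger0_norm; last by lra.
suff : expR (- x) <= 1 - x + x ^+ 2 by lra.
have : expR (- x) * (1 + x) <= (1 - x + x ^+ 2) * (1 + x).
  apply: (@le_trans _ _ 1); first by rewrite -[leRHS]h3 ler_wpM2l// ltW.
  have -> : (1 - x + x ^+ 2) * (1 + x) = 1 + x ^+ 3 by ring.
  by rewrite lerDl exprn_ge0.
by rewrite ler_pM2r//; lra.
Qed.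

End elementary.

(** * Moments and cosine transforms of sums over independent blocks *)

Section block_sums.
Context d (T : measurableType d) (R : realType) (P : probability T R).
Context (I : eqType) (A : set I) (Y : I -> T -> R).
Hypothesis mY : forall j, measurable_fun setT (Y j).
Hypothesis indY : mutually_independent P A Y.
Context (K : eqType) (J : K -> seq I) (U : K -> T -> R).

Local Notation flat r := (flatten [seq J k | k <- r]).

Let sub_flat k r : k \in r -> {subset J k <= flat r}.
Proof. by move=> kr j jJ; apply/flattenP; exists (J k) => //; exact: map_f. Qed.

Let uniqJ k r : uniq (flat r) -> k \in r -> uniq (J k).
Proof.
elim: r => //= k0 r IH; rewrite cat_uniq => /and3P[u0 _ u]; rewrite inE => /orP[/eqP ->//|].
exact: IH.
Qed.

Lemma pspan_sum_flat r : uniq (flat r) -> (forall k, k \in r -> pspan Y (J k) (U k)) ->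
  pspan Y (flat r) (fun w => \sum_(k <- r) U k w).
Proof.
move=> u sU; apply: pspan_sum => k kr.
apply: pspan_sub (sU k kr) => //; first exact: uniqJ kr.
exact: sub_flat.
Qed.

Let iS L V : pspan Y L V -> itg P V.
Proof. by move=> s; apply/bmf_itg; exact: pspan_bmf s. Qed.

(** The cross term has zero mean since the blocks are disjoint and centred. Blocks are left general
    because the lemma is used at two scales: single entries inside a row, and whole rows inside the
    array. *)
Lemma Ex_sum2 r : uniq (flat r) -> (forall j, j \in flat r -> A j) ->
  (forall k, k \in r -> pspan Y (J k) (U k)) -> (forall k, k \in r -> Ex P (U k) = 0) ->
  Ex P (fun w => \sum_(k <- r) U k w) = 0 /\
  Ex P (fun w => (\sum_(k <- r) U k w) ^+ 2) = \sum_(k <- r) Ex P (fun w => U k w ^+ 2).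
Proof.
elim: r => [|k r IH] /=.
  move=> *; split; first by under eq_Ex do rewrite big_nil; rewrite Ex_cst.
  by under eq_Ex do rewrite big_nil expr0n/=; rewrite Ex_cst big_nil.
move=> uu fA sU E0.
have kk : k \in k :: r by rewrite mem_head.
have rr i : i \in r -> i \in k :: r by rewrite inE orbC => ->.
have [_ _ u] := and3P (etrans (esym (cat_uniq _ _)) uu).
have fA' j : j \in flat r -> A j by move=> jr; apply: fA; rewrite mem_cat jr orbT.
have [IH1 IH2] := IH u fA' (fun i ir => sU i (rr i ir)) (fun i ir => E0 i (rr i ir)).
have sS := pspan_sum_flat u (fun i ir => sU i (rr i ir)).
have sk := sU k kk.
set S := (fun w => \sum_(i <- r) U i w) in IH1 sS.
split.
  under eq_Ex do rewrite big_cons.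
  by rewrite (ExD (iS sk) (iS sS)) IH1 E0// addr0.
transitivity (Ex P (fun w => U k w ^+ 2 + (2 * (U k w * S w) + S w ^+ 2))).
  by apply: eq_Ex => w; rewrite big_cons -/(S w); ring.
have i1 := iS (pspanX 2 sk); have i2 := iS (pspanX 2 sS).
have i3 : itg P (fun w => U k w * S w).
  by apply: bmf_itg; apply: bmfM; [exact: pspan_bmf sk|exact: pspan_bmf sS].
rewrite (ExD i1 (itgD (itgZ 2 i3) i2)) (ExD (itgZ 2 i3) i2) (ExZ _ i3).
rewrite (Ex_pspanM mY indY uu fA sk sS) E0// mul0r mulr0 add0r big_cons.
by congr (_ + _); rewrite -IH2.
Qed.

(** In the expansion of [(U + S)^4] the terms [U^3 S] and [U S^3] vanish in mean, which leaves
    [6 E U^2 E S^2]; this is the cross term of [3 (E U^2 + E S^2)^2]. *)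
Lemma Ex_sum4 r : uniq (flat r) -> (forall j, j \in flat r -> A j) ->
  (forall k, k \in r -> pspan Y (J k) (U k)) -> (forall k, k \in r -> Ex P (U k) = 0) ->
  Ex P (fun w => (\sum_(k <- r) U k w) ^+ 4) <=
    \sum_(k <- r) Ex P (fun w => U k w ^+ 4) +
    3 * (\sum_(k <- r) Ex P (fun w => U k w ^+ 2)) ^+ 2.
Proof.
elim: r => [|k r IH] /=.
  move=> *; under eq_Ex do rewrite big_nil expr0n/=.
  by rewrite Ex_cst !big_nil expr0n/= mulr0 addr0.
move=> uu fA sU E0.
have kk : k \in k :: r by rewrite mem_head.
have rr i : i \in r -> i \in k :: r by rewrite inE orbC => ->.
have [_ _ u] := and3P (etrans (esym (cat_uniq _ _)) uu).
have fA' j : j \in flat r -> A j by move=> jr; apply: fA; rewrite mem_cat jr orbT.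
have IH4 := IH u fA' (fun i ir => sU i (rr i ir)) (fun i ir => E0 i (rr i ir)).
have [IH1 IH2] := Ex_sum2 u fA' (fun i ir => sU i (rr i ir)) (fun i ir => E0 i (rr i ir)).
have sS := pspan_sum_flat u (fun i ir => sU i (rr i ir)).
have sk := sU k kk.
set S := (fun w => \sum_(i <- r) U i w) in IH1 sS.
rewrite !big_cons.
have -> : Ex P (fun w => (\sum_(j <- k :: r) U j w) ^+ 4) =
  Ex P (fun w => U k w ^+ 4 + (4 * (U k w ^+ 3 * S w) + (6 * (U k w ^+ 2 * S w ^+ 2) +
    (4 * (U k w * S w ^+ 3) + S w ^+ 4)))).
  by apply: eq_Ex => w; rewrite big_cons -/(S w); ring.
have ik n := iS (pspanX n sk); have iSS n := iS (pspanX n sS).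
have iM V W : pspan Y (J k) V -> pspan Y (flat r) W -> itg P (fun w => V w * W w).
  by move=> s1 s2; apply: bmf_itg; apply: bmfM; [exact: pspan_bmf s1|exact: pspan_bmf s2].
have j1 := iM _ _ (pspanX 3 sk) sS.
have j2 := iM _ _ (pspanX 2 sk) (pspanX 2 sS).
have j3 := iM _ _ sk (pspanX 3 sS).
rewrite (ExD (ik 4) (itgD (itgZ 4 j1) (itgD (itgZ 6 j2) (itgD (itgZ 4 j3) (iSS 4))))).
rewrite (ExD (itgZ 4 j1) (itgD (itgZ 6 j2) (itgD (itgZ 4 j3) (iSS 4)))).
rewrite (ExD (itgZ 6 j2) (itgD (itgZ 4 j3) (iSS 4))) (ExD (itgZ 4 j3) (iSS 4)).
rewrite (ExZ _ j1) (ExZ _ j2) (ExZ _ j3).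
rewrite (Ex_pspanM mY indY uu fA (pspanX 3 sk) sS).
rewrite (Ex_pspanM mY indY uu fA (pspanX 2 sk) (pspanX 2 sS)).
rewrite (Ex_pspanM mY indY uu fA sk (pspanX 3 sS)).
rewrite IH1 E0// IH2 !(mulr0, mul0r, add0r).
move: IH4; rewrite -/S.
set a := \sum_(i <- r) _; set b := \sum_(i <- r) _.
set x4 := Ex P (fun w => S w ^+ 4); set u2 := Ex P (fun w => U k w ^+ 2).
move=> IH4; have := sqr_ge0 u2; nra.
Qed.

Hypothesis cosU : forall k, pspan Y (J k) (fun w => cos (U k w)).
Hypothesis sinU : forall k, pspan Y (J k) (fun w => sin (U k w)).

(** The sine produced by the addition formula is a cosine of phase [th - pi / 2], so an induction
    that is uniform in [th] closes on cosines alone. *)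
Lemma pspan_cos_flat r th : uniq (flat r) ->
  pspan Y (flat r) (fun w => cos (\sum_(k <- r) U k w + th)).
Proof.
elim: r th => [|k r IH] th /=.
  by move=> _; under eq_fun do rewrite big_nil add0r; exact: pspan_cst.
move=> uu; have [uk _ u] := and3P (etrans (esym (cat_uniq _ _)) uu).
have E w : cos (\sum_(j <- k :: r) U j w + th) =
   cos (U k w) * cos (\sum_(j <- r) U j w + th) -
   sin (U k w) * cos (\sum_(j <- r) U j w + (th - pi / 2)).
  by rewrite big_cons -addrA cosD addrA cosBpihalf.
rewrite (funext E).
have sl V : pspan Y (J k) V -> pspan Y (J k ++ flat r) V.
  by apply: pspan_sub => // j jJ; rewrite mem_cat jJ.
have sr V : pspan Y (flat r) V -> pspan Y (J k ++ flat r) V.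
  by apply: pspan_sub => // j jJ; rewrite mem_cat jJ orbT.
by apply: pspanB; apply: pspanM; [exact: sl|exact/sr/IH|exact: sl|exact/sr/IH].
Qed.

(** Lindeberg replacement of one block at a time, every other factor being bounded by 1. In real
    form the imaginary part of the characteristic function of a block appears as the separate error
    [E sin (U k)], small when [U k] is centred. *)
Lemma Ex_cos_sum r th : uniq (flat r) -> (forall j, j \in flat r -> A j) ->
  `|Ex P (fun w => cos (\sum_(k <- r) U k w + th)) -
    expR (- (\sum_(k <- r) Ex P (fun w => U k w ^+ 2)) / 2) * cos th| <=
  \sum_(k <- r) (`|Ex P (fun w => cos (U k w)) - expR (- Ex P (fun w => U k w ^+ 2) / 2)|
     + `|Ex P (fun w => sin (U k w))|).
Proof.
elim: r th => [|k r IH] th /=.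
  move=> _ _; under eq_Ex do rewrite big_nil add0r.
  by rewrite Ex_cst !big_nil oppr0 mul0r expR0 mul1r subrr normr0.
move=> uu fA; have [uk _ u] := and3P (etrans (esym (cat_uniq _ _)) uu).
have fA' j : j \in flat r -> A j by move=> jr; apply: fA; rewrite mem_cat jr orbT.
have E w : cos (\sum_(j <- k :: r) U j w + th) =
   cos (U k w) * cos (\sum_(j <- r) U j w + th) -
   sin (U k w) * cos (\sum_(j <- r) U j w + (th - pi / 2)).
  by rewrite big_cons -addrA cosD addrA cosBpihalf.
under eq_Ex do rewrite E.
have iM V W : pspan Y (J k) V -> pspan Y (flat r) W -> itg P (fun w => V w * W w).
  by move=> s1 s2; apply: bmf_itg; apply: bmfM; [exact: pspan_bmf s1|exact: pspan_bmf s2].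
have sc t := pspan_cos_flat t u.
rewrite (ExB (iM _ _ (cosU k) (sc th)) (iM _ _ (sinU k) (sc (th - pi / 2)))).
rewrite (Ex_pspanM mY indY uu fA (cosU k) (sc th)).
rewrite (Ex_pspanM mY indY uu fA (sinU k) (sc (th - pi / 2))).
have cb t : `|Ex P (fun w => cos (\sum_(j <- r) U j w + t))| <= 1.
  by apply: norm_Ex_bnd; [exact: iS (sc t)|move=> w; exact: cos_max].
have := IH th u fA'; have := cb th; have := cb (th - pi / 2).
rewrite !big_cons.
rewrite (_ : - (_ + _) / 2 = - Ex P (fun w => U k w ^+ 2) / 2 + - (\sum_(j <- r) Ex P (fun w => U j w ^+ 2)) / 2); last by rewrite opprD mulrDl.
rewrite expRD.
set Cs := Ex P (fun w => cos (\sum_(j <- r) U j w + th)).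
set Ss := Ex P (fun w => cos (\sum_(j <- r) U j w + (th - pi / 2))).
set c := Ex P _; set s := Ex P _; set es := expR (- (\sum_(j <- r) _) / 2).
have : 0 <= Ex P (fun w => U k w ^+ 2) by apply: Ex_ge0 => w; exact: sqr_ge0.
set u2 := Ex P _; set D := \sum_(j <- r) _ => u20 S1 C1 HD.
have eu0 := expR_ge0 (- u2 / 2).
have eu1 : expR (- u2 / 2) <= 1 by rewrite expR_le1; lra.
set eu := expR (- u2 / 2) in eu0 eu1 *.
have -> : c * Cs - s * Ss - eu * es * cos th =
  ((c - eu) * Cs + eu * (Cs - es * cos th)) - s * Ss by ring.
apply: le_trans (ler_normB _ _) _; rewrite addrAC; apply: lerD; last first.
  by rewrite normrM ler_piMr.
apply: le_trans (ler_normD _ _) _; apply: lerD; rewrite normrM ?ler_piMr//.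
by rewrite (ger0_norm eu0) (le_trans (ler_piMl _ eu1)).
Qed.

End block_sums.

(** The functions [h j] may be unbounded: the addition formula peels off one coordinate at a time,
    and only its sine and cosine enter the span. *)
Lemma pspan_cos_sum d (T : measurableType d) (R : realType) (I : eqType)
  (Y : I -> T -> R) (J J' : seq I) (h : I -> R -> R) (t th : R) :
  uniq J' -> {subset J <= J'} -> (forall j, measurable_fun setT (h j)) ->
  pspan Y J' (fun w => cos (t * (\sum_(j <- J) h j (Y j w)) + th)).
Proof.
move=> uJ' JJ' mh; elim: J th JJ' => [|j J IH] th JJ'.
  by under eq_fun do rewrite big_nil mulr0 add0r; exact: pspan_cst.
have E w : cos (t * (\sum_(i <- j :: J) h i (Y i w)) + th) =
   cos (t * h j (Y j w)) * cos (t * (\sum_(i <- J) h i (Y i w)) + th) -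
   sin (t * h j (Y j w)) * cos (t * (\sum_(i <- J) h i (Y i w)) + (th - pi / 2)).
  by rewrite big_cons mulrDr -addrA cosD addrA cosBpihalf.
have JJ i : i \in J -> i \in J' by move=> iJ; apply: JJ'; rewrite inE iJ orbT.
have jJ' : j \in J' by apply: JJ'; rewrite mem_head.
have mth : measurable_fun setT (fun y => t * h j y) by exact: measurable_funM.
rewrite (funext E); apply: pspanB; apply: pspanM.
- apply: (pspan_gen Y (h := fun y => cos (t * h j y)) uJ' jJ').
  split; last by exists 1 => y; exact: cos_max.
  apply: (measurableT_comp _ mth); apply: continuous_measurable_fun; exact: continuous_cos.
- exact: IH.
- apply: (pspan_gen Y (h := fun y => sin (t * h j y)) uJ' jJ').
  split; last by exists 1 => y; exact: sin_max.
  apply: (measurableT_comp _ mth); apply: continuous_measurable_fun; exact: continuous_sin.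
- exact: IH.
Qed.

(** * Harmonic sums and logarithmic means *)

Section asymptotics.
Variable R : realType.

Definition harm n : R := \sum_(1 <= k < n.+1) k%:R^-1.

Lemma ln_S_le k : (0 < k)%N -> ln k.+1%:R <= ln k%:R + k%:R^-1 :> R.
Proof.
move=> k0; have k0' : 0 < k%:R :> R by rewrite ltr0n.
have -> : k.+1%:R = k%:R * (1 + k%:R^-1) :> R.
  by rewrite mulrDr mulr1 mulfV ?gt_eqF// natr1.
rewrite lnM ?posrE// ?addr_gt0 ?invr_gt0// lerD2l le_ln1Dx// ?(lt_trans _ (invr_gt0 _))//.
by rewrite (@lt_trans _ _ 0) ?ltrN10 ?invr_gt0.
Qed.

Lemma ln_S_ge k : (0 < k)%N -> ln k%:R + k.+1%:R^-1 <= ln k.+1%:R :> R.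
Proof.
move=> k0; have k0' : 0 < k%:R :> R by rewrite ltr0n.
have k1' : 0 < k.+1%:R :> R by rewrite ltr0n.
have -> : k%:R = k.+1%:R * (1 + - k.+1%:R^-1) :> R.
  by rewrite mulrBr mulr1 mulfV ?gt_eqF// -natr1 addrK.
have h : k.+1%:R^-1 < 1 :> R by rewrite invf_lt1// ltr1n ltnS.
rewrite lnM ?posrE//; last by rewrite subr_gt0.
rewrite -addrA gerDl -lerBrDr sub0r le_ln1Dx//.
by rewrite ltrN2.
Qed.

Lemma harm_ge n : (0 < n)%N -> ln n%:R <= harm n.
Proof.
case: n => // n _; suff : ln n.+2%:R <= harm n.+1.
  by apply: le_trans; rewrite ler_ln ?posrE ?ltr0n// ler_nat.
elim: n => [|n IH].
  rewrite /harm big_nat1 invr1.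
  by have := ln_S_le (isT : (0 < 1)%N); rewrite ln1 add0r invr1.
rewrite /harm big_nat_recr//= (le_trans (ln_S_le _))// lerD2r.
exact: IH.
Qed.

Lemma harm_le n : (0 < n)%N -> harm n <= 1 + ln n%:R.
Proof.
case: n => // n _; elim: n => [|n IH].
  by rewrite /harm big_nat1 invr1 ln1 addr0.
rewrite /harm big_nat_recr//=; apply: le_trans (_ : 1 + ln n.+1%:R + n.+2%:R^-1 <= _).
  by rewrite lerD2r; exact: IH.
by rewrite -addrA lerD2l; exact: ln_S_ge.
Qed.

Lemma near_ln (L : R) : \forall n \near \oo, L <= ln n%:R :> R.
Proof.
have [N _ HN] := nbhs_infty_gtr (expR L).
exists N => // n /= Nn.
by rewrite -[leLHS]expRK ler_ln ?posrE ?expR_gt0// ?(lt_trans (expR_gt0 L))// ?ltW//; exact: HN.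
Qed.

Definition nrm n : R := Num.sqrt (ln n%:R).

Lemma near_nrm (L : R) : \forall n \near \oo, L <= nrm n.
Proof.
have [N _ HN] := near_ln (L ^+ 2).
exists N => // n /= Nn; rewrite (le_trans (ler_norm L))// -sqrtr_sqr ler_wsqrtr//.
exact: HN.
Qed.

Lemma nrm_sqr n : (0 < n)%N -> nrm n ^+ 2 = ln n%:R.
Proof. by move=> n0; rewrite sqr_sqrtr// ln_ge0// ler1n. Qed.

Lemma summable_tail (u : nat -> R) (S : R) : (forall k, 0 <= u k) ->
  (forall n, \sum_(1 <= k < n.+1) u k <= S) -> forall e, 0 < e ->
  exists2 K, (0 < K)%N & forall K' n, (K <= K')%N -> \sum_(K' <= k < n) u k <= e.
Proof.
move=> u0 uS e e0.
pose U n := \sum_(1 <= k < n.+1) u k.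
have Und : nondecreasing_seq U.
  apply/nondecreasing_seqP => n; rewrite /U [leRHS]big_nat_recr//= lerDl//.
have Ucv : cvgn U.
  apply: nondecreasing_is_cvgn => //; exists S => _ [n _ <-]; exact: uS.
have UL n : U n <= limn U by exact: nondecreasing_cvgn_le.
have /cvgrPdist_le/(_ e e0)[N _ HN] := Ucv.
exists N.+1 => // K' n NK.
have [nK|Kn] := leqP n K'; first by rewrite big_geq// ltW.
have {}HN := HN N (leqnn N); rewrite /= ger0_norm ?subr_ge0// in HN.
apply: (@le_trans _ _ (U n.-1 - U N)).
  rewrite /U prednK; last exact: leq_ltn_trans Kn.
  rewrite (@big_cat_nat _ _ _ N.+1 1 n)//=; last exact: leq_trans NK (ltnW Kn).
  rewrite addrC addrK (@big_cat_nat _ _ _ K' N.+1 n)//=; last exact: ltnW.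
  by rewrite lerDr sumr_ge0.
by rewrite (le_trans _ HN)// lerB.
Qed.

(** The total weight [harm n] differs from [ln n] by at most 1, so replacing one by the other, like
    the first [K] terms, costs a bounded amount; the later terms cost at most [e / 4] times
    [harm n]. *)
Lemma log_cesaro (v : nat -> R) (V : R) : v n @[n --> \oo] --> V ->
  (\sum_(1 <= k < n.+1) k%:R^-1 * v k) / ln n%:R @[n --> \oo] --> V.
Proof.
move=> vV; apply/cvgrPdist_le => e e0.
have e40 : 0 < e / 4 by rewrite divr_gt0.
have /cvgrPdist_le/(_ (e / 4) e40)[K0 _ HK] := vV.
pose K := K0.+1.
pose B := \sum_(1 <= k < K) k%:R^-1 * `|V - v k|.
near=> n.
have n0 : (0 < n)%N by near: n; exists 1%N.
have Kn : (K <= n.+1)%N by near: n; exists K => // n /= /leqW.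
have l1 : 1 <= ln n%:R :> R by near: n; exact: near_ln.
have lB : 4 * B / e <= ln n%:R by near: n; exact: near_ln.
have lV : 4 * `|V| / e <= ln n%:R by near: n; exact: near_ln.
have l0 : 0 < ln n%:R :> R by exact: lt_le_trans l1.
set l := ln n%:R in l1 lB lV l0 *.
have -> : V - (\sum_(1 <= k < n.+1) k%:R^-1 * v k) / l =
    (V * (l - harm n) + \sum_(1 <= k < n.+1) k%:R^-1 * (V - v k)) / l.
  have -> : \sum_(1 <= k < n.+1) k%:R^-1 * (V - v k) =
      V * harm n - \sum_(1 <= k < n.+1) k%:R^-1 * v k.
    rewrite /harm mulr_sumr -sumrB; apply: eq_bigr => k _; ring.
  by field; rewrite gt_eqF.
rewrite normrM normfV (gtr0_norm l0) ler_pdivrMr//.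
apply: le_trans (ler_normD _ _) _.
have h1 : `|V * (l - harm n)| <= `|V|.
  rewrite normrM ler_piMr//; have := harm_ge n0; have := harm_le n0; rewrite -/l => ? ?.
  by rewrite ler_norml; apply/andP; split; lra.
have h2 : `|\sum_(1 <= k < n.+1) k%:R^-1 * (V - v k)| <= B + e / 4 * harm n.
  apply: le_trans (ler_norm_sum _ _ _) _.
  rewrite (@big_cat_nat _ _ _ K)//=; apply: lerD.
    by apply: ler_sum => k _; rewrite normrM ger0_norm// invr_ge0.
  apply: (@le_trans _ _ (\sum_(K <= k < n.+1) k%:R^-1 * (e / 4))).
    rewrite big_nat_cond [leRHS]big_nat_cond; apply: ler_sum => k /andP[/andP[Kk _] _].
    have k0 : 0 <= k%:R^-1 :> R by rewrite invr_ge0.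
    rewrite normrM (ger0_norm k0) ler_wpM2l//.
    by apply: HK => /=; exact: ltnW.
  rewrite -mulr_suml mulrC ler_wpM2l ?(ltW e40)// /harm (@big_cat_nat _ _ _ K 1 n.+1)//=.
  by rewrite lerDr sumr_ge0// => k _; rewrite invr_ge0.
have h3 := harm_le n0; rewrite -/l in h3.
rewrite ler_pdivrMr// in lB; rewrite ler_pdivrMr// in lV.
have h4 : e / 4 * harm n <= e / 4 * (1 + l) by rewrite ler_wpM2l// ltW.
apply: (le_trans (lerD h1 h2)); nra.
Unshelve. all: by end_near. Qed.

End asymptotics.

(** * Convergence in probability and Slutsky's argument *)

Section convergence_in_probability.
Context d (T : measurableType d) (R : realType) (P : probability T R).

(** Convergence to 0 in probability, with probabilities written as expectations of indicators so
    that they add up with moments. *)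
Definition cvp0 (U : nat -> T -> R) := forall e, 0 < e ->
  forall dl, 0 < dl -> \forall n \near \oo, Ex P (fun w => \1_(tail e) (U n w)) <= dl.

Lemma tail01 (e y : R) : 0 <= (\1_(tail e) y : R) <= 1.
Proof. by rewrite indicE; case: (_ \in _); rewrite ?ler01 ?lexx. Qed.

Lemma tail_imp (e y b : R) : 0 <= b -> (e < `|y| -> 1 <= b) -> \1_(tail e) y <= b.
Proof.
move=> b0 H; rewrite indicE; case: (boolP (y \in tail e)) => // /set_mem h.
exact: H.
Qed.

Lemma itg_tail (e : R) (U : T -> R) : measurable_fun setT U ->
  itg P (fun w => \1_(tail e) (U w)).
Proof. by move=> mU; apply: bmf_itg; apply: bmf_comp => //; exact: bmf_tail. Qed.

Lemma Ex_tail_le (e : R) (U V : T -> R) : measurable_fun setT U -> itg P V ->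
  (forall w, 0 <= V w) -> (forall w, e < `|U w| -> 1 <= V w) ->
  Ex P (fun w => \1_(tail e) (U w)) <= Ex P V.
Proof.
move=> mU iV V0 UV; apply: Ex_le => //; first exact: itg_tail.
by move=> w; apply: tail_imp => //; exact: UV.
Qed.

Lemma chebyshev2 (e : R) (U : T -> R) : 0 < e -> bmf U ->
  Ex P (fun w => \1_(tail e) (U w)) <= e^-2 * Ex P (fun w => U w ^+ 2).
Proof.
move=> e0 bU; have b2 := bmf_itg P (bmfX 2 bU).
rewrite -(ExZ _ b2); apply: Ex_tail_le.
- by case: bU.
- exact: itgZ.
- by move=> w; rewrite mulr_ge0 ?sqr_ge0 ?invr_ge0 ?exprn_ge0 ?ltW.
- move=> w eU; rewrite ler_pdivlMl ?exprn_gt0// mulr1 -[leRHS]real_normK ?num_real//.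
  by rewrite lerXn2r ?nnegrE ?(ltW e0) ?(ltW eU).
Qed.

Lemma cvp0D (U V : nat -> T -> R) :
  (forall n, measurable_fun setT (U n)) -> (forall n, measurable_fun setT (V n)) ->
  cvp0 U -> cvp0 V -> cvp0 (fun n w => U n w + V n w).
Proof.
move=> mU mV cU cV e e0 dl dl0.
have e20 : 0 < e / 2 by rewrite divr_gt0.
have d20 : 0 < dl / 2 by rewrite divr_gt0.
near=> n.
have H1 : Ex P (fun w => \1_(tail (e / 2)) (U n w)) <= dl / 2 by near: n; exact: cU.
have H2 : Ex P (fun w => \1_(tail (e / 2)) (V n w)) <= dl / 2 by near: n; exact: cV.
apply: (@le_trans _ _ (Ex P (fun w => \1_(tail (e / 2)) (U n w) + \1_(tail (e / 2)) (V n w)))); last first.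
  rewrite ExD; [lra|exact: itg_tail|exact: itg_tail].
apply: Ex_tail_le.
- exact: measurable_funD.
- by apply: itgD; exact: itg_tail.
- by move=> w; have /andP[? _] := tail01 (e / 2) (U n w); have /andP[? _] := tail01 (e / 2) (V n w); rewrite addr_ge0.
move=> w euv; have [hU|hU] := ltP (e / 2) `|U n w|.
  by rewrite (tail_le hU) lerDl; have /andP[] := tail01 (e / 2) (V n w).
have [hV|hV] := ltP (e / 2) `|V n w|.
  by rewrite (tail_le hV) lerDr; have /andP[] := tail01 (e / 2) (U n w).
by have := ler_normD (U n w) (V n w); lra.
Unshelve. all: by end_near. Qed.

Section slutsky.
Variables (A U : nat -> T -> R).
Hypothesis mA : forall n, measurable_fun setT (A n).
Hypothesis mU : forall n, measurable_fun setT (U n).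
Hypothesis U0 : cvp0 U.

(** As cosine is 1-Lipschitz, [U] changes the integrand by at most [|t| e1] where [|U| <= e1], and
    by at most 2 elsewhere. *)
Lemma slutsky_cos (t th l : R) :
  Ex P (fun w => cos (t * A n w + th)) @[n --> \oo] --> l ->
  Ex P (fun w => cos (t * (A n w + U n w) + th)) @[n --> \oo] --> l.
Proof.
move=> cA; apply/cvgrPdist_le => e e0.
have /cvgrPdist_le/(_ (e / 2)) := cA.
move=> /(_ _)/wrap[]; first by rewrite divr_gt0.
move=> HA.
pose e1 := e / (4 * (`|t| + 1)).
have t10 : 0 < 4 * (`|t| + 1) by rewrite mulr_gt0// ltr_wpDl.
have e10 : 0 < e1 by rewrite divr_gt0.
have te1 : `|t| * e1 <= e / 4.
  rewrite /e1 mulrA ler_pdivrMr//.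
  have -> : e / 4 * (4 * (`|t| + 1)) = e * (`|t| + 1) by field.
  by rewrite mulrC ler_wpM2l ?(ltW e0)// lerDl.
near=> n.
have HU : Ex P (fun w => \1_(tail e1) (U n w)) <= e / 8.
  by near: n; apply: U0 => //; rewrite divr_gt0.
have mc V : measurable_fun setT V -> bmf (fun w : T => cos (t * V w + th)).
  move=> mV; split; last by exists 1 => w; exact: cos_max.
  apply: measurableT_comp; first by apply: continuous_measurable_fun; exact: continuous_cos.
  by apply: measurable_funD => //; exact: measurable_funM.
have mAU : measurable_fun setT (fun w => A n w + U n w) by exact: measurable_funD.
have H2 : `|Ex P (fun w => cos (t * (A n w + U n w) + th)) - Ex P (fun w => cos (t * A n w + th))|
   <= e / 4 + 2 * (e / 8).
  rewrite -ExB; [|exact: bmf_itg (mc _ mAU)|exact: bmf_itg (mc _ (mA n))].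
  apply: (@le_trans _ _ (Ex P (fun w => e / 4 + 2 * \1_(tail e1) (U n w)))); last first.
    by rewrite ExD ?ExZ ?Ex_cst ?lerD2l ?ler_wpM2l//; try exact: itg_cst; try apply: itgZ; exact: itg_tail.
  apply: norm_Ex_le.
  - by apply: itgB; apply: bmf_itg; exact: mc.
  - by apply: itgD; [exact: itg_cst|apply: itgZ; exact: itg_tail].
  move=> w.
  have [hU|hU] := ltP e1 `|U n w|.
    rewrite (tail_le hU) (le_trans (ler_normB _ _))//.
    by have := cos_max (t * (A n w + U n w) + th); have := cos_max (t * A n w + th); lra.
  have /andP[t0 _] := tail01 e1 (U n w).
  have -> : t * (A n w + U n w) + th = (t * A n w + th) + t * U n w by ring.
  apply: le_trans (cos_lip _ _) _; rewrite normrM.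
  apply: (@le_trans _ _ (`|t| * e1)); first by rewrite ler_wpM2l.
  by rewrite (le_trans te1)// lerDl mulr_ge0.
have H1 : `|l - Ex P (fun w => cos (t * A n w + th))| <= e / 2 by near: n; exact: HA.
move: H1 H2; rewrite !ler_norml => /andP[? ?] /andP[? ?]; apply/andP; split; lra.
Unshelve. all: by end_near. Qed.

Lemma slutsky_tight (Kb : R) : (forall n, bmf (A n)) ->
  (\forall n \near \oo, Ex P (fun w => A n w ^+ 2) <= Kb) ->
  forall e, 0 < e -> exists2 L, 0 < L &
  \forall n \near \oo, Ex P (fun w => \1_(tail L) (A n w + U n w)) <= e.
Proof.
move=> bA HK e e0.
have e20 : 0 < e / 2 by rewrite divr_gt0.
(* With this [L], [|Kb| = (L - 1) e / 2 <= L^2 e / 2], which is what Chebyshev's inequality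
   needs. *)
pose L := 1 + 2 * `|Kb| / e.
have L1 : 1 <= L by rewrite /L lerDl divr_ge0 ?mulr_ge0// ltW.
have L0 : 0 < L by exact: lt_le_trans L1.
exists (L + 1); first by rewrite addr_gt0.
near=> n.
have HU : Ex P (fun w => \1_(tail 1) (U n w)) <= e / 2 by near: n; exact: U0.
have HA : Ex P (fun w => \1_(tail L) (A n w)) <= e / 2.
  apply: le_trans (chebyshev2 L0 (bA n)) _.
  rewrite ler_pdivrMl ?exprn_gt0//.
  have : Ex P (fun w => A n w ^+ 2) <= Kb by near: n.
  move=> /le_trans; apply; apply: le_trans (ler_norm _) _.
  have : `|Kb| = (L - 1) * (e / 2) by rewrite /L; field; rewrite gt_eqF.
  move=> ->; rewrite ler_wpM2r ?(ltW e20)//; nra.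
apply: (@le_trans _ _ (Ex P (fun w => \1_(tail L) (A n w) + \1_(tail 1) (U n w)))); last first.
  rewrite ExD; [lra|exact: itg_tail|exact: itg_tail].
apply: Ex_tail_le.
- exact: measurable_funD.
- by apply: itgD; exact: itg_tail.
- by move=> w; have /andP[? _] := tail01 L (A n w); have /andP[? _] := tail01 1 (U n w); rewrite addr_ge0.
move=> w euv; have [hU|hU] := ltP L `|A n w|.
  by rewrite (tail_le hU) lerDl; have /andP[] := tail01 1 (U n w).
have [hV|hV] := ltP 1 `|U n w|.
  by rewrite (tail_le hV) lerDr; have /andP[] := tail01 L (A n w).
by have := ler_normD (A n w) (U n w); lra.
Unshelve. all: by end_near. Qed.

End slutsky.

End convergence_in_probability.

(** * Limit theorem for abstract centred row averages *)

Section rows.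
Context d (T : measurableType d) (R : realType) (P : probability T R).
Context (I : eqType) (A : set I) (Y : I -> T -> R).
Hypothesis mY : forall j, measurable_fun setT (Y j).
Hypothesis indY : mutually_independent P A Y.
Variables (J : nat -> seq I) (C : nat -> T -> R).
Hypothesis uJ : forall n, uniq (flatten [seq J k | k <- index_iota 1 n.+1]).
Hypothesis JA : forall n j, j \in flatten [seq J k | k <- index_iota 1 n.+1] -> A j.
Hypothesis sC : forall k, pspan Y (J k) (C k).
Hypothesis cosC : forall k t th, pspan Y (J k) (fun w => cos (t * C k w + th)).
Hypothesis C0 : forall k, Ex P (C k) = 0.
Variables (v S4 : R).
Hypothesis C2 : forall k, (0 < k)%N -> Ex P (fun w => C k w ^+ 2) <= v / k%:R.
Hypothesis C2lim :
  (\sum_(1 <= k < n.+1) Ex P (fun w => C k w ^+ 2)) / ln n%:R @[n --> \oo] --> v.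
Hypothesis C4 : forall n, \sum_(1 <= k < n.+1) Ex P (fun w => C k w ^+ 4) <= S4.

Let bC k : bmf (C k). Proof. exact: pspan_bmf (sC k). Qed.
Let iC k n : itg P (fun w => C k w ^+ n). Proof. by apply: bmf_itg; exact: bmfX. Qed.

Let v0 : 0 <= v.
Proof.
have := @C2 1%N isT; rewrite divr1; apply: le_trans.
by apply: Ex_ge0 => w; exact: sqr_ge0.
Qed.

Lemma sum_C2_le n : \sum_(1 <= k < n.+1) Ex P (fun w => C k w ^+ 2) <= v * harm R n.
Proof.
rewrite /harm mulr_sumr big_nat_cond [leRHS]big_nat_cond.
by apply: ler_sum => k /andP[/andP[k1 _] _]; exact: C2.
Qed.

Let sC' (c : R) k : pspan Y (J k) (fun w => c * C k w).
Proof. exact: pspanZ. Qed.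

Let C0' (c : R) k : Ex P (fun w => c * C k w) = 0.
Proof. by rewrite ExZ ?C0 ?mulr0//; exact: bmf_itg. Qed.

Let Ex_scale2 (c : R) k : Ex P (fun w => (c * C k w) ^+ 2) = c ^+ 2 * Ex P (fun w => C k w ^+ 2).
Proof. by rewrite -(ExZ _ (iC k 2)); apply: eq_Ex => w; rewrite exprMn. Qed.

Let Ex_scale4 (c : R) k : Ex P (fun w => (c * C k w) ^+ 4) = c ^+ 4 * Ex P (fun w => C k w ^+ 4).
Proof. by rewrite -(ExZ _ (iC k 4)); apply: eq_Ex => w; rewrite exprMn. Qed.

(** Both [E cos U] and [exp (- E U^2 / 2)] equal [1 - E U^2 / 2] up to [E U^4], the second because
    [(E U^2)^2 <= E U^4]. As [U] is centred, [E sin U = - E (U - sin U)] is of third order, and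
    [|u|^3 <= eta u^2 + u^4 / eta] reduces it to even moments. *)
Lemma row_cos_error (c eta : R) k : 0 < eta ->
  `|Ex P (fun w => cos (c * C k w)) - expR (- Ex P (fun w => (c * C k w) ^+ 2) / 2)|
     + `|Ex P (fun w => sin (c * C k w))| <=
  (2 + eta^-1) * Ex P (fun w => (c * C k w) ^+ 4) + eta * Ex P (fun w => (c * C k w) ^+ 2).
Proof.
move=> eta0; pose U w := c * C k w.
have bU : bmf U by exact: bmfZ.
have iU n : itg P (fun w => U w ^+ n) by apply: bmf_itg; exact: bmfX.
have bcos : bmf (fun w => cos (U w)).
  split; last by exists 1 => w; exact: cos_max.
  by apply: measurableT_comp; [apply: continuous_measurable_fun; exact: continuous_cos|case: bU].
have bsin : bmf (fun w => sin (U w)).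
  split; last by exists 1 => w; exact: sin_max.
  by apply: measurableT_comp; [apply: continuous_measurable_fun; exact: continuous_sin|case: bU].
rewrite -/(U _); set E2 := Ex P (fun w => U w ^+ 2); set E4 := Ex P (fun w => U w ^+ 4).
have E20 : 0 <= E2 by apply: Ex_ge0 => w; exact: sqr_ge0.
have E24 : E2 ^+ 2 <= E4.
  have : 0 <= Ex P (fun w => (U w ^+ 2 - E2) ^+ 2) by apply: Ex_ge0 => w; exact: sqr_ge0.
  have -> : Ex P (fun w => (U w ^+ 2 - E2) ^+ 2) =
     Ex P (fun w => U w ^+ 4 - (2 * E2 * U w ^+ 2 - E2 ^+ 2)).
    by apply: eq_Ex => w; ring.
  have i1 := itgZ (2 * E2) (iU 2%N); have i2 := itg_cst P (E2 ^+ 2).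
  rewrite (ExB (iU 4%N) (itgB i1 i2)) (ExB i1 i2) (ExZ _ (iU 2%N)) Ex_cst -/E2 -/E4.
  by rewrite expr2; lra.
have H1 : `|Ex P (fun w => cos (U w)) - 1 + E2 / 2| <= E4.
  have -> : Ex P (fun w => cos (U w)) - 1 + E2 / 2 = Ex P (fun w => cos (U w) - 1 + U w ^+ 2 / 2).
    have i1 := bmf_itg P bcos.
    have i2 := itgZ 2^-1 (iU 2%N).
    rewrite (_ : Ex P (fun w => cos (U w) - 1 + U w ^+ 2 / 2) = Ex P (fun w => (cos (U w) - 1) + 2^-1 * U w ^+ 2)); last first.
      by apply: eq_Ex => w; rewrite [_ / 2]mulrC.
    by rewrite (ExD (itgB i1 (itg_cst P 1)) i2) (ExB i1 (itg_cst P 1)) Ex_cst (ExZ _ (iU 2%N)) [_ / 2]mulrC.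
  apply: norm_Ex_le => //; last by move=> w; exact: cos_taylor.
  apply: bmf_itg; apply: bmfD; first by apply: bmfB => //; exact: bmf_cst.
  by apply: bmfM; [exact: bmfX|exact: bmf_cst].
have H2 : `|expR (- E2 / 2) - 1 + E2 / 2| <= E4.
  rewrite mulNr; have := @expRN_taylor R (E2 / 2); rewrite divr_ge0// => /(_ isT) /le_trans; apply.
  by apply: le_trans E24; rewrite !expr2; nra.
have H3 : `|Ex P (fun w => sin (U w))| <= eta * E2 + eta^-1 * E4.
  rewrite -normrN -[- _]add0r -(C0' c k) -(ExB (bmf_itg P bU) (bmf_itg P bsin)).
  rewrite -(ExZ eta (iU 2%N)) -(ExZ eta^-1 (iU 4%N)) -(ExD (itgZ eta (iU 2%N)) (itgZ eta^-1 (iU 4%N))).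
  apply: norm_Ex_le.
  - by apply: itgB; exact: bmf_itg.
  - by apply: itgD; apply: itgZ.
  move=> w; apply: le_trans (sin_taylor _) _.
  rewrite -[U w ^+ 2]real_normK ?num_real// -[U w ^+ 4]ger0_norm ?exprn_even_ge0// normrX.
  set u := `|U w|; have u0 : 0 <= u by exact: normr_ge0.
  have -> : eta * u ^+ 2 + eta^-1 * u ^+ 4 = u ^+ 3 + eta^-1 * u ^+ 2 * (eta ^+ 2 - eta * u + u ^+ 2).
    by field; rewrite gt_eqF.
  rewrite lerDl !mulr_ge0 ?invr_ge0 ?exprn_ge0 ?(ltW eta0)//.
  by have := sqr_ge0 (eta / 2 - u); rewrite !expr2; nra.
apply: (@le_trans _ _ ((E4 + E4) + (eta * E2 + eta^-1 * E4))); last by lra.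
apply: lerD H3; move: H1 H2; rewrite !ler_norml => /andP[? ?] /andP[? ?].
by apply/andP; split; lra.
Qed.

Definition row_sum (c : R) n w := c * (\sum_(1 <= k < n.+1) C k w) / nrm R n.

Lemma row_sumE c n w : row_sum c n w = \sum_(1 <= k < n.+1) (c / nrm R n) * C k w.
Proof. by rewrite /row_sum -mulr_sumr mulrAC. Qed.

Lemma bmf_row_sum c n : bmf (row_sum c n).
Proof.
rewrite (funext (row_sumE c n)); apply: bmf_sum => k; exact: bmfZ.
Qed.

Lemma row_sum2 c n : Ex P (fun w => row_sum c n w ^+ 2) =
  c ^+ 2 / nrm R n ^+ 2 * \sum_(1 <= k < n.+1) Ex P (fun w => C k w ^+ 2).
Proof.
rewrite (funext (row_sumE c n)).
have [_ ->] := Ex_sum2 mY indY (uJ n) (@JA n) (fun k _ => sC' (c / nrm R n) k)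
  (fun k _ => C0' (c / nrm R n) k).
by rewrite mulr_sumr; apply: eq_bigr => k _; rewrite Ex_scale2 expr_div_n.
Qed.

Lemma near_harm : \forall n \near \oo, [/\ (0 < n)%N, 1 <= nrm R n & harm R n <= 2 * nrm R n ^+ 2].
Proof.
near=> n.
have n0 : (0 < n)%N by near: n; exists 1%N.
have l1 : 1 <= ln n%:R :> R by near: n; exact: near_ln.
split => //; first by near: n; exact: near_nrm.
by rewrite nrm_sqr//; have := harm_le R n0; lra.
Unshelve. all: by end_near. Qed.

Lemma row_sum2_bounded c :
  \forall n \near \oo, Ex P (fun w => row_sum c n w ^+ 2) <= 2 * v * c ^+ 2.
Proof.
near=> n.
have [n0 a1 Hn] : [/\ (0 < n)%N, 1 <= nrm R n & harm R n <= 2 * nrm R n ^+ 2].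
  by near: n; exact: near_harm.
rewrite row_sum2; have a0 : 0 < nrm R n ^+ 2 by rewrite exprn_gt0// (lt_le_trans _ a1).
rewrite mulrAC ler_pdivrMr//; apply: le_trans (ler_wpM2l (sqr_ge0 c) (sum_C2_le n)) _.
by have := ler_wpM2l (mulr_ge0 (sqr_ge0 c) v0) Hn; lra.
Unshelve. all: by end_near. Qed.

(** The errors of [row_cos_error] are summed with [U = g n * C k] and [g n = t c / nrm n]. The
    fourth moments contribute [O(1 / nrm n ^ 4)], their sum being bounded; the second moments
    contribute [eta] times a bounded total variance. *)
Lemma row_sum_cos (c t th : R) :
  Ex P (fun w => cos (t * row_sum c n w + th)) @[n --> \oo] -->
  expR (- (t ^+ 2 * c ^+ 2 * v) / 2) * cos th.
Proof.
pose g n := t * (c / nrm R n).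
pose s2 n := \sum_(1 <= k < n.+1) Ex P (fun w => C k w ^+ 2).
have E n : Ex P (fun w => cos (t * row_sum c n w + th)) =
    Ex P (fun w => cos (\sum_(1 <= k < n.+1) g n * C k w + th)).
  apply: eq_Ex => w; rewrite row_sumE mulr_sumr; congr cos; congr (_ + _).
  by apply: eq_bigr => k _; rewrite mulrA.
rewrite (funext E) {E}.
have lim1 : expR (- (t ^+ 2 * c ^+ 2 * (s2 n / ln n%:R)) / 2) * cos th @[n --> \oo] -->
    expR (- (t ^+ 2 * c ^+ 2 * v) / 2) * cos th.
  apply: cvgMl; apply: continuous_cvg; first exact: continuous_expR.
  by apply: cvgMl; apply: cvgN; apply: cvgMr; exact: C2lim.
apply/cvgrPdist_le => e e0.
have e40 : 0 < e / 4 by rewrite divr_gt0.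
have /cvgrPdist_le/(_ _ e40) L1 := lim1.
pose B := (t * c) ^+ 2 * v.
have B0 : 0 <= B by rewrite /B mulr_ge0 ?sqr_ge0.
(* [eta] is fixed before [n]: the second-moment error is at most [2 B eta <= e / 4], because
   [harm n <= 2 (nrm n)^2], and for this [eta] the other error [D / (nrm n)^4] tends to 0. *)
pose eta := e / (8 * (B + 1)).
have B1 : 0 < 8 * (B + 1) by rewrite mulr_gt0// ltr_wpDl.
have eta0 : 0 < eta by rewrite divr_gt0.
have etaB : eta * (2 * B) <= e / 4.
  rewrite /eta mulrAC ler_pdivrMr//.
  have -> : e / 4 * (8 * (B + 1)) = e * (2 * B + 2) by field.
  by rewrite ler_wpM2l ?(ltW e0)// lerDl.
pose D := (2 + eta^-1) * (t * c) ^+ 4 * S4.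
near=> n.
have [n0 a1 Hn] : [/\ (0 < n)%N, 1 <= nrm R n & harm R n <= 2 * nrm R n ^+ 2].
  by near: n; exact: near_harm.
have aD : 4 * `|D| / e <= nrm R n by near: n; exact: near_nrm.
have HL1 : `|expR (- (t ^+ 2 * c ^+ 2 * v) / 2) * cos th -
   expR (- (t ^+ 2 * c ^+ 2 * (s2 n / ln n%:R)) / 2) * cos th| <= e / 4 by near: n; exact: L1.
have a0 : 0 < nrm R n by exact: lt_le_trans a1.
have cosU k : pspan Y (J k) (fun w => cos (g n * C k w)).
  by have := cosC k (g n) 0; under eq_fun do rewrite addr0.
have sinU k : pspan Y (J k) (fun w => sin (g n * C k w)).
  have := cosC k (g n) (- (pi / 2)).
  by under eq_fun do rewrite cosBpihalf.
have := @Ex_cos_sum _ _ _ P _ A Y mY indY _ J (fun k w => g n * C k w) cosU sinU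
  (index_iota 1 n.+1) th (uJ n) (@JA n).
have -> : \sum_(k <- index_iota 1 n.+1) Ex P (fun w => (g n * C k w) ^+ 2) =
   t ^+ 2 * c ^+ 2 * (s2 n / ln n%:R).
  rewrite (eq_bigr _ (fun k _ => Ex_scale2 (g n) k)) -mulr_sumr -/(s2 n).
  by rewrite -(nrm_sqr R n0) /g; field; rewrite gt_eqF.
move=> H.
have {}H : `|Ex P (fun w => cos (\sum_(1 <= k < n.+1) g n * C k w + th)) -
    expR (- (t ^+ 2 * c ^+ 2 * (s2 n / ln n%:R)) / 2) * cos th| <= e / 2.
  apply: le_trans H _.
  apply: (@le_trans _ _ (\sum_(1 <= k < n.+1) ((2 + eta^-1) * g n ^+ 4 * Ex P (fun w => C k w ^+ 4) +
      eta * g n ^+ 2 * Ex P (fun w => C k w ^+ 2)))).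
    apply: ler_sum => k _; apply: le_trans (row_cos_error _ _ eta0) _.
    by rewrite Ex_scale2 Ex_scale4 !mulrA.
  rewrite big_split/= -!mulr_sumr.
  have -> : e / 2 = e / 4 + e / 4 by field.
  apply: lerD.
    apply: (@le_trans _ _ ((2 + eta^-1) * g n ^+ 4 * S4)).
      apply: ler_wpM2l => //.
      by rewrite mulr_ge0 ?addr_ge0 ?invr_ge0 ?(ltW eta0) ?exprn_even_ge0.
    have -> : (2 + eta^-1) * g n ^+ 4 * S4 = D / nrm R n ^+ 4.
      by rewrite /D /g; field; rewrite !gt_eqF.
    rewrite ler_pdivrMr ?exprn_gt0//; apply: le_trans (ler_norm D) _.
    rewrite ler_pdivrMr// in aD.
    have : nrm R n <= nrm R n ^+ 4 by rewrite -[leLHS]expr1 ler_weXn2l.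
    nra.
  apply: le_trans etaB; rewrite -mulrA ler_wpM2l ?(ltW eta0)//.
  have -> : g n ^+ 2 = (t * c) ^+ 2 / nrm R n ^+ 2 by rewrite /g mulrA expr_div_n.
  rewrite mulrAC ler_pdivrMr ?exprn_gt0//.
  apply: le_trans (ler_wpM2l (sqr_ge0 _) (sum_C2_le n)) _.
  by rewrite mulrA -/B; have := ler_wpM2l B0 Hn; lra.
move: H HL1; rewrite !ler_norml => /andP[? ?] /andP[? ?]; apply/andP; split; lra.
Unshelve. all: by end_near. Qed.

(** The variance of [C k ^ 2] is at most [E (C k)^4], so by independence the second moment of the
    sum is at most [S4]; Chebyshev's inequality concludes. *)
Lemma row_square_cvp0 (c : R) : cvp0 P
  (fun n w => c * (\sum_(1 <= k < n.+1) (C k w ^+ 2 - Ex P (fun w => C k w ^+ 2))) / nrm R n).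
Proof.
move=> e e0 dl dl0.
pose Q k w := C k w ^+ 2 - Ex P (fun w => C k w ^+ 2).
have sQ k : pspan Y (J k) (Q k) by apply: pspanB; [exact: pspanX|exact: pspan_cst].
have Q0 k : Ex P (Q k) = 0.
  by rewrite (ExB (iC k 2) (itg_cst P _)) Ex_cst subrr.
have Q2 k : Ex P (fun w => Q k w ^+ 2) <= Ex P (fun w => C k w ^+ 4).
  set m := Ex P (fun w => C k w ^+ 2).
  have -> : Ex P (fun w => Q k w ^+ 2) = Ex P (fun w => C k w ^+ 4 - (2 * m * C k w ^+ 2 - m ^+ 2)).
    by apply: eq_Ex => w; rewrite /Q -/m; ring.
  have i1 := itgZ (2 * m) (iC k 2); have i2 := itg_cst P (m ^+ 2).
  rewrite (ExB (iC k 4) (itgB i1 i2)) (ExB i1 i2) (ExZ _ (iC k 2)) Ex_cst -/m.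
  by have := sqr_ge0 m; rewrite expr2; lra.
near=> n.
have a1 : 1 <= nrm R n by near: n; exact: near_nrm.
have aL : c ^+ 2 * S4 / (dl * e ^+ 2) <= nrm R n by near: n; exact: near_nrm.
have a0 : 0 < nrm R n by exact: lt_le_trans a1.
have E w : c * (\sum_(1 <= k < n.+1) Q k w) / nrm R n = \sum_(1 <= k < n.+1) (c / nrm R n) * Q k w.
  by rewrite -mulr_sumr mulrAC.
rewrite (_ : (fun w => _) = (fun w => \1_(tail e) (\sum_(1 <= k < n.+1) (c / nrm R n) * Q k w))); last first.
  by apply/funext => w; rewrite E.
have bQ k : bmf (Q k) by exact: pspan_bmf (sQ k).
have bS : bmf (fun w => \sum_(1 <= k < n.+1) (c / nrm R n) * Q k w).
  by apply: bmf_sum => k; exact: bmfZ.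
apply: le_trans (chebyshev2 P e0 bS) _.
have [_ ->] := @Ex_sum2 _ _ _ P _ A Y mY indY _ J (fun k w => (c / nrm R n) * Q k w)
  (index_iota 1 n.+1) (uJ n) (@JA n) (fun k _ => pspanZ (c / nrm R n) (sQ k))
  (fun k _ => etrans (ExZ (c / nrm R n) (bmf_itg P (bQ k))) (etrans (congr1 _ (Q0 k)) (mulr0 _))).
rewrite ler_pdivrMl ?exprn_gt0//.
apply: (@le_trans _ _ ((c / nrm R n) ^+ 2 * S4)).
  apply: le_trans (ler_wpM2l (sqr_ge0 _) (C4 n)).
  rewrite mulr_sumr; apply: ler_sum => k _.
  have -> : Ex P (fun w => (c / nrm R n * Q k w) ^+ 2) = (c / nrm R n) ^+ 2 * Ex P (fun w => Q k w ^+ 2).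
    rewrite -(ExZ _ (bmf_itg P (bmfX 2 (bQ k)))); apply: eq_Ex => w; exact: exprMn.
  by rewrite ler_wpM2l ?sqr_ge0.
rewrite expr_div_n mulrAC ler_pdivrMr ?exprn_gt0//.
rewrite ler_pdivrMr ?mulr_gt0 ?exprn_gt0// in aL.
apply: le_trans aL _.
have p0 : 0 <= dl * e ^+ 2 * nrm R n by rewrite ltW// ?mulr_gt0 ?exprn_gt0.
by have := ler_wpM2l p0 a1; lra.
Unshelve. all: by end_near. Qed.

Let mul_frac_le (a x : R) : 0 <= a -> 0 <= x -> a * (x / (a + 1)) <= x.
Proof.
move=> a0 x0; have a1 : 0 < a + 1 by rewrite ltr_wpDl.
by rewrite mulrA ler_pdivrMr// mulrC ler_wpM2l// lerDl.
Qed.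

Variables (r b : nat -> T -> R) (m : nat -> R) (A0 Sb M : R).
Hypothesis mr : forall k, measurable_fun setT (r k).
Hypothesis bb : forall k, bmf (b k).
Hypothesis b0 : forall k w, 0 <= b k w.
Hypothesis sb : forall n, \sum_(1 <= k < n.+1) Ex P (b k) <= Sb.
Hypothesis m0 : forall k, 0 <= m k.
Hypothesis sm : forall n, \sum_(1 <= k < n.+1) m k <= M.
Hypothesis A00 : 0 <= A0.
Hypothesis rb : forall k w eta, (0 < k)%N -> b k w < 1 -> 0 < eta ->
  `|r k w| <= A0 * (eta * C k w ^+ 2 + eta^-1 * C k w ^+ 4 + m k * (1 + C k w ^+ 2)).

(* The first [K] rows contribute a fixed random variable, negligible after
   division by [nrm R n]; the later rows are all good ([b k w < 1]) outside a
   set of small probability, and there [rb] applies with [eta ~ 1 / nrm R n]. *)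
Lemma row_remainder_cvp0 :
  cvp0 P (fun n w => (\sum_(1 <= k < n.+1) r k w) / nrm R n).
Proof.
move=> e e0 dl dl0.
have M0 : 0 <= M by have := sm 0; rewrite big_geq.
have d50 : 0 < dl / 5 by rewrite divr_gt0.
have Eb0 k : 0 <= Ex P (b k) by exact: Ex_ge0.
have EC40 k : 0 <= Ex P (fun w => C k w ^+ 4).
  by apply: Ex_ge0 => w; exact: exprn_even_ge0.
have [K1 K10 HK1] := summable_tail Eb0 sb d50.
(* The budget [dl] is shared by five errors: the first rows, the bad rows, and the three terms of
   [D]. The term in [C k ^ 2] costs [(2 A0 / (e a)) (eta1 / a) v (2 a^2) = 4 A0 v eta1 / e]; the
   [+ 1] keeps the denominator positive. *)
pose eta1 := e * (dl / 5) / (4 * A0 * v + 1).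
have q0 : 0 < 4 * A0 * v + 1 by rewrite ltr_wpDl// !mulr_ge0.
have eta10 : 0 < eta1 by rewrite divr_gt0// mulr_gt0.
have heta1 : 4 * A0 * v * eta1 <= e * (dl / 5).
  by apply: mul_frac_le; [rewrite !mulr_ge0|rewrite ltW// mulr_gt0].
clearbody eta1.
have X0 : 0 < dl / 5 * e * eta1 by apply: mulr_gt0 => //; exact: mulr_gt0.
(* The term in [C k ^ 4] costs [2 A0 e2 / (e eta1)], with no power of [a] left: its smallness can
   only come from the tail [e2] of the series of fourth moments. *)
pose e2 := dl / 5 * e * eta1 / (2 * A0 + 1).
have q20 : 0 < 2 * A0 + 1 by rewrite ltr_wpDl// !mulr_ge0.
have e20 : 0 < e2 by rewrite divr_gt0.
have he2 : 2 * A0 * e2 <= dl / 5 * e * eta1.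
  by apply: mul_frac_le; [rewrite !mulr_ge0|exact: ltW].
clearbody e2.
have [K2 K20 HK2] := summable_tail EC40 C4 e20.
pose K := maxn K1 K2.
pose RK w := \sum_(1 <= k < K) r k w.
have mRK : measurable_fun setT RK by apply: measurable_sum => k; exact: mr.
have [L HL] : exists L : nat, Ex P (fun w => \1_(tail L%:R) (RK w)) <= dl / 5.
  have /cvgr0Pnorm_le/(_ _ d50)[N _ HN] := tail_cvg0 P mRK.
  by exists N; apply: le_trans (HN N _) => /=; rewrite ?ler_norm.
near=> n.
have [n0 a1 Hn] : [/\ (0 < n)%N, 1 <= nrm R n & harm R n <= 2 * nrm R n ^+ 2].
  by near: n; exact: near_harm.
have Kn : (K <= n.+1)%N by near: n; exists K => // n /= /leqW.
have aL : 2 * L%:R / e <= nrm R n by near: n; exact: near_nrm.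
have aM : 10 * A0 * (M * (1 + v)) / (dl * e) <= nrm R n by near: n; exact: near_nrm.
have a0 : 0 < nrm R n by exact: lt_le_trans a1.
set a := nrm R n in a1 Hn aL aM a0 *.
pose eta := eta1 / a.
have eta0 : 0 < eta by rewrite divr_gt0.
pose D k w := eta * C k w ^+ 2 + eta^-1 * C k w ^+ 4 + m k * (1 + C k w ^+ 2).
have D0 k w : 0 <= D k w.
  have q2 := sqr_ge0 (C k w).
  have q4 : 0 <= C k w ^+ 4 by exact: exprn_even_ge0.
  have e1 : 0 <= eta^-1 by rewrite invr_ge0 ltW.
  by apply: addr_ge0; [apply: addr_ge0|]; apply: mulr_ge0 => //; [exact: ltW|exact: addr_ge0].
have bD k : bmf (D k).
  apply: bmfD; first by apply: bmfD; apply: bmfZ; exact: bmfX.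
  by apply: bmfZ; apply: bmfD; [exact: bmf_cst|exact: bmfX].
pose c := 2 * A0 / (e * a).
have c0 : 0 <= c by rewrite divr_ge0 ?mulr_ge0// ltW.
(* [V] majorises the indicator of the deviation: if [V w < 1], then [|RK w| <= L <= e a / 2], all
   later rows are good, and [c * sum D < 1] gives [A0 * sum D <= e a / 2]. *)
pose V w := \1_(tail L%:R) (RK w) + (\sum_(K <= k < n.+1) b k w + c * \sum_(K <= k < n.+1) D k w).
have i1 : itg P (fun w => \1_(tail L%:R) (RK w)) by exact: itg_tail.
have i2 : itg P (fun w => \sum_(K <= k < n.+1) b k w) by apply: itg_sum => k; exact: bmf_itg.
have i3 : itg P (fun w => \sum_(K <= k < n.+1) D k w) by apply: itg_sum => k; exact: bmf_itg.
have K_gt0 : (0 < K)%N by rewrite /K leq_max K10.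
have sb0 w : 0 <= \sum_(K <= k < n.+1) b k w by rewrite sumr_ge0.
have sD0 w : 0 <= c * \sum_(K <= k < n.+1) D k w by apply: mulr_ge0 => //; rewrite sumr_ge0.
apply: (@le_trans _ _ (Ex P V)).
  apply: Ex_tail_le.
  - by apply: measurable_funM => //; apply: measurable_sum => k; exact: mr.
  - by apply: itgD => //; apply: itgD => //; exact: itgZ.
  - move=> w; have /andP[? _] := tail01 L%:R (RK w).
    by apply: addr_ge0 => //; exact: addr_ge0.
  move=> w; apply: contraTT; rewrite -!ltNge -leNgt => V1.
  have s1 := sb0 w; have s2 := sD0 w.
  have /andP[t0 _] := tail01 L%:R (RK w).
  have RL : `|RK w| <= L%:R.
    by rewrite leNgt; apply/negP => h; move: V1; rewrite /V (tail_le h); lra.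
  have bk k : (K <= k < n.+1)%N -> b k w < 1.
    move=> /andP[Kk kn].
    have : b k w <= \sum_(K <= k < n.+1) b k w.
      rewrite (@big_cat_nat _ _ _ k)//=; last exact: ltnW.
      by rewrite [X in _ + X]big_ltn// addrCA lerDl addr_ge0// sumr_ge0.
    by move: V1; rewrite /V; lra.
  have rD : `|\sum_(K <= k < n.+1) r k w| <= A0 * \sum_(K <= k < n.+1) D k w.
    apply: le_trans (ler_norm_sum _ _ _) _.
    rewrite mulr_sumr big_nat_cond [leRHS]big_nat_cond; apply: ler_sum => k /andP[kK _].
    by apply: rb => //; [case/andP: kK => /(leq_trans K_gt0)|exact: bk].
  rewrite normrM normfV (gtr0_norm a0) ler_pdivrMr//.
  rewrite (@big_cat_nat _ _ _ K)//= -/(RK w).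
  apply: le_trans (ler_normD _ _) _.
  have c1 : c * \sum_(K <= k < n.+1) D k w < 1 by move: V1; rewrite /V; lra.
  have : A0 * \sum_(K <= k < n.+1) D k w <= e * a / 2.
    have -> : A0 * \sum_(K <= k < n.+1) D k w = (c * \sum_(K <= k < n.+1) D k w) * (e * a / 2).
      by rewrite /c; field; rewrite !gt_eqF.
    by rewrite ler_piMl ?(ltW c1)// divr_ge0 ?mulr_ge0 ?(ltW e0) ?(ltW a0).
  rewrite ler_pdivrMr// in aL; rewrite mulrC in aL.
  move=> h; have h' := le_trans rD h; lra.
rewrite (ExD i1 (itgD i2 (itgZ c i3))) (ExD i2 (itgZ c i3)) (ExZ _ i3).
have E1 : Ex P (fun w => \sum_(K <= k < n.+1) b k w) <= dl / 5.
  rewrite Ex_sum; last by move=> k; exact: bmf_itg.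
  by apply: HK1; rewrite leq_maxl.
have E2 : c * Ex P (fun w => \sum_(K <= k < n.+1) D k w) <= dl / 5 + (dl / 5 + dl / 5).
  rewrite Ex_sum; last by move=> k; exact: bmf_itg.
  have ED k : (0 < k)%N -> Ex P (D k) <= eta * (v / k%:R) + eta^-1 * Ex P (fun w => C k w ^+ 4) + m k * (1 + v).
    move=> k0; rewrite /D.
    have j2 := itgZ eta (iC k 2); have j4 := itgZ eta^-1 (iC k 4).
    have j5 := itgD (itg_cst P 1) (iC k 2).
    rewrite (ExD (itgD j2 j4) (itgZ (m k) j5)) (ExD j2 j4) (ExZ _ (iC k 2)) (ExZ _ (iC k 4)).
    rewrite (ExZ _ j5) (ExD (itg_cst P 1) (iC k 2)) Ex_cst.
    apply: lerD; first by rewrite lerD2r ler_wpM2l ?(ltW eta0)// C2.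
    rewrite ler_wpM2l// lerD2l; apply: le_trans (C2 k0) _.
    by rewrite ler_piMr// invf_le1 ?ltr0n// ler1n.
  apply: (@le_trans _ _ (c * (eta * (v * harm R n) + (eta^-1 * e2 + M * (1 + v))))).
    apply: ler_wpM2l => //.
    apply: (@le_trans _ _ (\sum_(K <= k < n.+1) (eta * (v / k%:R) + (eta^-1 * Ex P (fun w => C k w ^+ 4) + m k * (1 + v))))).
      rewrite big_nat_cond [leRHS]big_nat_cond; apply: ler_sum => k /andP[/andP[Kk _] _].
      by rewrite addrA; apply: ED; exact: leq_trans Kk.
    rewrite !big_split/= -!mulr_sumr -mulr_suml.
    have sub (u : nat -> R) : (forall k, 0 <= u k) -> \sum_(K <= k < n.+1) u k <= \sum_(1 <= k < n.+1) u k.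
      by move=> u0; rewrite [leRHS](@big_cat_nat _ _ _ K)//= lerDr sumr_ge0.
    apply: lerD; last apply: lerD.
    - rewrite ler_wpM2l ?(ltW eta0)// ler_wpM2l//; apply: sub => k; by rewrite invr_ge0.
    - by rewrite ler_wpM2l ?invr_ge0 ?(ltW eta0)//; apply: HK2; rewrite leq_maxr.
    - by rewrite ler_wpM2r ?addr_ge0//; apply: le_trans (sm n); exact: sub.
  rewrite mulrDr [X in _ + X]mulrDr; apply: lerD; last apply: lerD.
  - apply: (@le_trans _ _ (c * (eta * (v * (2 * a ^+ 2))))).
      by rewrite !ler_wpM2l ?(ltW eta0).
    have -> : c * (eta * (v * (2 * a ^+ 2))) = (4 * A0 * v * eta1) / e.
      by rewrite /c /eta; field; rewrite !gt_eqF.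
    by rewrite ler_pdivrMr// [leRHS]mulrC.
  - have -> : c * (eta^-1 * e2) = (2 * A0 * e2) / (e * eta1).
      by rewrite /c /eta; field; rewrite !gt_eqF.
    by rewrite ler_pdivrMr ?mulr_gt0// mulrA.
  - rewrite /c mulrAC ler_pdivrMr ?mulr_gt0//.
    rewrite ler_pdivrMr ?mulr_gt0// in aM; lra.
lra.
Unshelve. all: by end_near. Qed.

End rows.

(** * Pointwise sums over truncation levels *)

Section truncation_sums.
Variable R : realType.
Implicit Types (s y : R) (n k : nat).

(** Makes [2 / x^2] a telescoping majorant for the tails of [sum 1 / k^3]. *)
Lemma inv_cube_telescope (x : R) : 1 <= x ->
  x ^- 3 + 2 * (x + 1) ^- 2 <= 2 * x ^- 2.
Proof.
move=> x1; have x0 : 0 < x by exact: lt_le_trans x1.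
have x10 : 0 < x + 1 by rewrite addr_gt0.
rewrite -subr_ge0.
have -> : 2 * x ^- 2 - (x ^- 3 + 2 * (x + 1) ^- 2) = (3 * x ^+ 2 - 1) / (x ^+ 3 * (x + 1) ^+ 2).
  by field; rewrite !gt_eqF.
by apply: divr_ge0; [nra|apply: mulr_ge0; rewrite exprn_ge0// ltW].
Qed.

Lemma sum_inv_sqr n : \sum_(1 <= k < n.+1) (k%:R : R) ^- 2 <= 2.
Proof.
case: n => [|n]; first by rewrite big_geq.
suff : \sum_(1 <= k < n.+2) (k%:R : R) ^- 2 <= 2 - n.+1%:R^-1.
  by move/le_trans; apply; rewrite gerBl invr_ge0.
elim: n => [|n IH]; first by rewrite big_nat1 expr1n invr1; lra.
rewrite big_nat_recr//=; apply: le_trans (lerD IH (lexx _)) _.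
have x0 : 0 < n.+1%:R :> R by rewrite ltr0n.
rewrite -[n.+2%:R]natr1; set x := n.+1%:R in x0 *.
have x10 : 0 < x + 1 by rewrite addr_gt0.
rewrite -subr_ge0.
have -> : 2 - (x + 1)^-1 - (2 - x^-1 + (x + 1) ^- 2) = (x * (x + 1) ^+ 2)^-1.
  by field; rewrite !gt_eqF.
by rewrite invr_ge0 mulr_ge0 ?exprn_ge0// ltW.
Qed.

Lemma sum_inv_cube n : \sum_(1 <= k < n.+1) (k%:R : R) ^- 3 <= 2.
Proof.
apply: le_trans (sum_inv_sqr n).
rewrite big_nat_cond [leRHS]big_nat_cond; apply: ler_sum => k /andP[/andP[k1 _] _].
have k0 : 0 < k%:R :> R by rewrite ltr0n.
by rewrite lef_pV2 ?posrE ?exprn_gt0// ler_weXn2l// ler1n.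
Qed.

(** Only the integers below [|y| / s] count. The induction also carries the trivial bound [n], which
    closes the step as long as [s (n + 1) < |y|]. *)
Lemma sum_tail s y n : 0 < s ->
  s * \sum_(1 <= k < n.+1) \1_(tail (s * k%:R)) y <= `|y|.
Proof.
move=> s0.
suff [] : \sum_(1 <= k < n.+1) \1_(tail (s * k%:R)) y <= (n%:R : R) /\
  s * \sum_(1 <= k < n.+1) \1_(tail (s * k%:R)) y <= `|y| by [].
elim: n => [|n [IH1 IH2]]; first by rewrite big_geq// mulr0.
rewrite big_nat_recr//=; case: (ltP (s * n.+1%:R) `|y|) => h.
  rewrite (tail_le h) -natr1 lerD2r; split => //.
  by apply: le_trans (ltW h); rewrite ler_wpM2l ?(ltW s0)// -natr1 lerD2r.
rewrite indicE memNset ?addr0; last by rewrite /tail/= ltNge h.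
by split => //; apply: le_trans IH1 _; rewrite ler_nat.
Qed.

(** The integers up to [N] add up to at most [N^2], and here [s N < |y|]. Integrated, this bounds
    the expected number of entries affected by truncation in the whole array. *)
Lemma sum_weighted_tail s y n : 0 < s ->
  s ^+ 2 * \sum_(1 <= k < n.+1) k%:R * \1_(tail (s * k%:R)) y <= y ^+ 2.
Proof.
move=> s0.
suff [] : \sum_(1 <= k < n.+1) k%:R * \1_(tail (s * k%:R)) y <= (n%:R ^+ 2 : R) /\
  s ^+ 2 * \sum_(1 <= k < n.+1) k%:R * \1_(tail (s * k%:R)) y <= y ^+ 2 by [].
elim: n => [|n [IH1 IH2]]; first by rewrite big_geq// mulr0 !sqr_ge0.
rewrite big_nat_recr//=; case: (ltP (s * n.+1%:R) `|y|) => h.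
  rewrite (tail_le h) mulr1.
  have B : \sum_(1 <= k < n.+1) k%:R * \1_(tail (s * k%:R)) y + n.+1%:R <= (n.+1%:R ^+ 2 : R).
    apply: le_trans (lerD IH1 (lexx _)) _.
    by rewrite -natr1; have : 0 <= n%:R :> R by []; nra.
  split => //; apply: (@le_trans _ _ (s ^+ 2 * n.+1%:R ^+ 2)).
    by rewrite ler_wpM2l ?sqr_ge0.
  rewrite -exprMn -[leRHS]real_normK ?num_real// lerXn2r ?nnegrE ?(ltW h)//.
  by rewrite mulr_ge0 ?(ltW s0).
rewrite indicE memNset ?mulr0 ?addr0; last by rewrite /tail/= ltNge h.
by split => //; apply: le_trans IH1 _; rewrite lerXn2r ?nnegrE// ler_nat.
Qed.

Lemma pow4_add (a b : R) : (a + b) ^+ 4 <= 8 * a ^+ 4 + 8 * b ^+ 4.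
Proof.
have -> : 8 * a ^+ 4 + 8 * b ^+ 4 = (a + b) ^+ 4 + (4 * (a ^+ 2 - b ^+ 2) ^+ 2 +
   (a - b) ^+ 2 * (2 * (a ^+ 2 + b ^+ 2) + (a + b) ^+ 2)) by ring.
have := sqr_ge0 a; have := sqr_ge0 b; have := sqr_ge0 (a + b) => h1 h2 h3.
rewrite lerDl; apply: addr_ge0; apply: mulr_ge0 => //; try exact: sqr_ge0.
by lra.
Qed.

(** Large values are set to 0 rather than clipped at [L], so that the second moment of the result is
    the one occurring in [b_n]. *)
Definition trunc (L y : R) : R := (1 - \1_(tail L) y) * y.

Lemma trunc_le L y : `|y| <= L -> trunc L y = y.
Proof.
by move=> h; rewrite /trunc indicE memNset ?subr0 ?mul1r// /tail/= ltNge h.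
Qed.

Lemma trunc_gt L y : L < `|y| -> trunc L y = 0.
Proof. by move=> h; rewrite /trunc (tail_le h) subrr mul0r. Qed.

Lemma bmf_trunc L : bmf (trunc L).
Proof.
split.
  apply: measurable_funM => //; apply: measurable_funB => //.
  by case: (bmf_tail L).
exists `|L| => y; case: (leP `|y| L) => h.
  by rewrite (trunc_le h) (le_trans h)// ler_norm.
by rewrite (trunc_gt h) normr0.
Qed.

Lemma trunc_norm L y : `|trunc L y| <= `|y|.
Proof. by case: (leP `|y| L) => h; [rewrite (trunc_le h)|rewrite (trunc_gt h) normr0]. Qed.

(** Only the indices [k >= |y| / s] contribute, each [y^4 / k^3], and such a tail of [sum 1 / k^3]
    is of order [(s / |y|)^2]. To make this inductive, the sum is 0 as long as [s n < |y|], and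
    afterwards a reserve [2 y^4 / (n + 1)^2] is kept for the terms to come. *)
Lemma sum_trunc4 s y n : 0 < s ->
  \sum_(1 <= k < n.+1) (k%:R : R) ^- 3 * trunc (s * k%:R) y ^+ 4 <= 2 * s ^+ 2 * y ^+ 2.
Proof.
move=> s0; pose S n := \sum_(1 <= k < n.+1) (k%:R : R) ^- 3 * trunc (s * k%:R) y ^+ 4.
rewrite -/(S n).
suff [H1 H2] : (s * n%:R < `|y| -> S n = 0) /\
    (`|y| <= s * n%:R -> S n <= 2 * s ^+ 2 * y ^+ 2 - 2 * y ^+ 4 * n.+1%:R ^- 2).
  case: (ltP (s * n%:R) `|y|) => [/H1 ->|/H2 /le_trans].
    by apply: mulr_ge0; [apply: mulr_ge0 => //|]; exact: sqr_ge0.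
  apply; rewrite gerBl; apply: mulr_ge0; last by rewrite invr_ge0 exprn_ge0.
  by apply: mulr_ge0 => //; exact: exprn_even_ge0.
elim: n => [|n [IH1 IH2]].
  rewrite /S big_geq//; split => //; rewrite mulr0 normr_le0 => /eqP ->.
  by rewrite !expr0n/= !mulr0 mul0r subr0.
have SE : S n.+1 = S n + n.+1%:R ^- 3 * trunc (s * n.+1%:R) y ^+ 4.
  by rewrite /S big_nat_recr.
have nn : s * n%:R <= s * n.+1%:R by rewrite ler_wpM2l ?(ltW s0)// ler_nat.
split=> h.
  by rewrite SE IH1 ?(le_lt_trans nn h)// (trunc_gt h) expr0n/= mulr0 addr0.
rewrite SE (trunc_le h).
have x1 : 1 <= n.+1%:R :> R by rewrite ler1n.
have tl := inv_cube_telescope x1.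
have y40 : 0 <= y ^+ 4 by exact: exprn_even_ge0.
have x0 : 0 < n.+1%:R :> R by rewrite ltr0n.
have step : n.+1%:R ^- 3 * y ^+ 4 + 2 * y ^+ 4 * n.+2%:R ^- 2 <= 2 * y ^+ 4 * n.+1%:R ^- 2.
  have := ler_wpM2l y40 tl; rewrite natr1.
  by move: (n.+1%:R ^- 3) (n.+2%:R ^- 2) (n.+1%:R ^- 2) => a b c; lra.
have base : S n <= 2 * s ^+ 2 * y ^+ 2 - 2 * y ^+ 4 * n.+1%:R ^- 2.
  case: (ltP (s * n%:R) `|y|) => [/IH1 ->|/IH2//].
  rewrite subr_ge0 ler_pdivrMr ?exprn_gt0//.
  have : y ^+ 2 <= s ^+ 2 * n.+1%:R ^+ 2.
    rewrite -exprMn -[leLHS]real_normK ?num_real// lerXn2r ?nnegrE//.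
    by rewrite mulr_ge0 ?(ltW s0).
  move=> /(ler_wpM2l (sqr_ge0 y)).
  have -> : y ^+ 4 = y ^+ 2 * y ^+ 2 by ring.
  lra.
move: step base; move: (n.+1%:R ^- 3 * y ^+ 4) (2 * y ^+ 4 * n.+2%:R ^- 2) (2 * y ^+ 4 * n.+1%:R ^- 2).
by move=> a b c; lra.
Qed.

End truncation_sums.

(** * Moments of the truncated array *)

Section array.
Context d (T : measurableType d) (R : realType) (P : probability T R).
Variables (Y : nat * nat -> T -> R) (Y0 : T -> R) (s : R).
Hypothesis mY : forall j, measurable_fun setT (Y j).
Let A : set (nat * nat) := [set kn | (1 <= kn.1 <= kn.2)%N].
Hypothesis indY : mutually_independent P A Y.
Hypothesis mY0 : measurable_fun setT Y0.
Hypothesis lawY : forall j, A j -> forall h, bmf h ->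
  Ex P (fun w => h (Y j w)) = Ex P (fun w => h (Y0 w)).
Hypothesis iY2 : itg P (fun w => Y0 w ^+ 2).
Hypothesis EY0 : Ex P Y0 = 0.
Hypothesis s0 : 0 < s.

Definition var0 := Ex P (fun w => Y0 w ^+ 2).
Local Notation v := var0.
Definition tr k : R -> R := trunc (s * k%:R).
Definition trmean k := Ex P (fun w => tr k (Y0 w)).
Definition tau k := Ex P (fun w => tr k (Y0 w) ^+ 2).
Definition phi k (y : R) := tr k y - trmean k.
Definition row k : seq (nat * nat) := [seq (i, k) | i <- index_iota 1 k.+1].
(** The [C k] of the overview. Truncation destroys the centring of [Y0]; subtracting [trmean] in
    [phi] restores it exactly. *)
Definition rowavg k w : R := k%:R^-1 * \sum_(j <- row k) phi k (Y j w).
(** As [Y0] is centred, the truncated mean is minus the mean of the discarded part. This absolute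
    version of that part bounds it and is summable over [k]; it plays the role of the sequence [m]
    in [row_remainder_cvp0]. *)
Definition trtail k := Ex P (fun w => `|Y0 w| * \1_(tail (s * k%:R)) (Y0 w)).

Lemma row_snd k j : j \in row k -> j.2 = k.
Proof. by move=> /mapP[i _ ->]. Qed.

Lemma uniq_row k : uniq (row k).
Proof. by rewrite map_inj_uniq ?iota_uniq// => i i' []. Qed.

Lemma size_row k : size (row k) = k.
Proof. by rewrite size_map size_iota subn1. Qed.

Lemma uniq_rows n : uniq (flatten [seq row k | k <- index_iota 1 n.+1]).
Proof.
have : uniq (index_iota 1 n.+1) by exact: iota_uniq.
elim: (index_iota 1 n.+1) => //= k r IH /andP[kr ur].
rewrite cat_uniq uniq_row IH// andbT /=; apply/hasPn => j /flattenP[_ /mapP[k' k'r ->]] jk'.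
by apply/negP => /row_snd jk; move: kr; rewrite -jk (row_snd jk') k'r.
Qed.

Lemma row_dom k j : j \in row k -> A j.
Proof.
move=> /mapP[i]; rewrite mem_index_iota ltnS => ik ->.
exact: ik.
Qed.

Lemma rows_dom n j : j \in flatten [seq row k | k <- index_iota 1 n.+1] -> A j.
Proof. by move=> /flattenP[_ /mapP[k _ ->]] /row_dom. Qed.

Let btr k : bmf (tr k). Proof. exact: bmf_trunc. Qed.

Let itr k n : itg P (fun w => tr k (Y0 w) ^+ n).
Proof. by apply: bmf_itg; apply: bmfX; exact: bmf_comp. Qed.

Let bphi k : bmf (phi k).
Proof. by apply: bmfB => //; exact: bmf_cst. Qed.

Let iY1 : itg P Y0.
Proof.
apply: (@itg_le _ _ _ _ _ (fun w => 1 + Y0 w ^+ 2)) => //.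
  by apply: itgD => //; exact: itg_cst.
move=> w; rewrite -[Y0 w ^+ 2]real_normK ?num_real//.
by have := sqr_ge0 (`|Y0 w| - 2^-1); rewrite !expr2; nra.
Qed.

Lemma var0_ge0 : 0 <= v. Proof. by apply: Ex_ge0 => w; exact: sqr_ge0. Qed.

Let itt k : itg P (fun w => `|Y0 w| * \1_(tail (s * k%:R)) (Y0 w)).
Proof.
apply: (@itg_le _ _ _ _ _ (fun w => `|Y0 w|)); last 2 first.
- exact: itg_norm.
- move=> w; rewrite normrM normr_id ler_piMr//.
  by have /andP[h1 h2] := tail01 (s * k%:R) (Y0 w); rewrite ger0_norm.
apply: measurable_funM; first exact: measurableT_comp.
by case: (bmf_comp mY0 (bmf_tail (s * k%:R))).
Qed.

Lemma trtail_ge0 k : 0 <= trtail k.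
Proof.
by apply: Ex_ge0 => w; apply: mulr_ge0.
Qed.

Lemma trmean_tail k : `|trmean k| <= trtail k.
Proof.
rewrite /trmean -[X in `|X|]subr0 -EY0 -ExB//; last exact: (itr k 1).
apply: norm_Ex_le => //; first by apply: itgB => //; exact: (itr k 1).
move=> w; case: (leP `|Y0 w| (s * k%:R)) => h.
  by rewrite /tr (trunc_le h) subrr normr0 mulr_ge0.
by rewrite /tr (trunc_gt h) sub0r normrN (tail_le h) mulr1.
Qed.

Lemma sum_trtail n : \sum_(1 <= k < n.+1) trtail k <= v / s.
Proof.
rewrite /trtail -Ex_sum// /var0 mulrC -(ExZ _ iY2).
apply: Ex_le; [exact: itg_sum|exact: itgZ|move=> w].
rewrite -mulr_sumr ler_pdivlMl// mulrCA -[leRHS]real_normK ?num_real// expr2.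
by rewrite ler_wpM2l// sum_tail.
Qed.

Lemma trtail_le k : (0 < k)%N -> trtail k <= v / s.
Proof.
move=> k0; have := sum_trtail k; apply: le_trans.
rewrite big_nat_recr//= lerDr sumr_ge0// => i _; exact: trtail_ge0.
Qed.

Lemma trmean_cvg0 : trmean k @[k --> \oo] --> 0.
Proof.
rewrite -EY0; apply: (@Ex_dominated _ _ _ _ _ _ (fun w => `|Y0 w|)) => //.
- by move=> k; case: (bmf_comp mY0 (btr k)).
- exact: itg_norm.
- by move=> k w; exact: trunc_norm.
- move=> w; apply: cvg_near_cst.
  have [N _ HN] := nbhs_infty_gtr (`|Y0 w| / s).
  exists N => // n /= Nn; apply: trunc_le.
  by rewrite mulrC -ler_pdivrMr// ltW//; exact: HN.
Qed.

Lemma tau_cvg : tau k @[k --> \oo] --> v.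
Proof.
apply: (@Ex_dominated _ _ _ _ _ _ (fun w => Y0 w ^+ 2)) => //.
- by move=> k; case: (bmfX 2 (bmf_comp mY0 (btr k))).
- exact: measurable_funX.
- move=> k w; rewrite normrX -[leRHS]real_normK ?num_real//.
  by rewrite lerXn2r ?nnegrE//; exact: trunc_norm.
- move=> w; apply: cvg_near_cst.
  have [N _ HN] := nbhs_infty_gtr (`|Y0 w| / s).
  exists N => // n /= Nn; congr (_ ^+ 2); apply: trunc_le.
  by rewrite mulrC -ler_pdivrMr// ltW//; exact: HN.
Qed.

Lemma tau_le k : tau k <= v.
Proof.
apply: Ex_le => // w; rewrite -[leLHS]real_normK ?num_real// -[leRHS]real_normK ?num_real//.
by rewrite lerXn2r ?nnegrE//; exact: trunc_norm.
Qed.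

Lemma Ex_phi k : Ex P (fun w => phi k (Y0 w)) = 0.
Proof.
by rewrite /phi (ExB (itr k 1) (itg_cst P _)) Ex_cst subrr.
Qed.

Lemma Ex_phi2 k : Ex P (fun w => phi k (Y0 w) ^+ 2) = tau k - trmean k ^+ 2.
Proof.
transitivity (Ex P (fun w => tr k (Y0 w) ^+ 2 - (2 * trmean k * tr k (Y0 w) ^+ 1 - trmean k ^+ 2))).
  by apply: eq_Ex => w; rewrite /phi; ring.
have i1 := itgZ (2 * trmean k) (itr k 1); have i2 := itg_cst P (trmean k ^+ 2).
rewrite (ExB (itr k 2) (itgB i1 i2)) (ExB i1 i2) (ExZ _ (itr k 1)) Ex_cst.
have -> : Ex P (fun w => tr k (Y0 w) ^+ 1) = trmean k by [].
by rewrite -/(tau k); ring.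
Qed.

Lemma Ex_phi4 k : Ex P (fun w => phi k (Y0 w) ^+ 4) <=
  8 * Ex P (fun w => tr k (Y0 w) ^+ 4) + 8 * trmean k ^+ 4.
Proof.
rewrite -(ExZ _ (itr k 4)) -[X in _ + X](Ex_cst P) -ExD; [|exact: itgZ|exact: itg_cst].
apply: Ex_le.
- by apply: bmf_itg; apply: bmfX; apply: bmf_comp.
- by apply: itgD; [exact: itgZ|exact: itg_cst].
move=> w; have := pow4_add (tr k (Y0 w)) (- trmean k).
by have -> : (- trmean k) ^+ 4 = trmean k ^+ 4 by ring.
Qed.

Let Ephi j k : j \in row k -> Ex P (fun w => phi k (Y j w)) = 0.
Proof. by move=> /row_dom jk; rewrite (lawY jk (bphi k)) Ex_phi. Qed.

Let flat1 (J : seq (nat * nat)) : flatten [seq [:: j] | j <- J] = J.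
Proof. by elim: J => //= j J ->. Qed.

Let sphi k j : j \in row k -> pspan Y [:: j] (fun w => phi k (Y j w)).
Proof. by move=> _; apply: (pspan_gen Y) => //; rewrite mem_head. Qed.

(** Inside a row, [Ex_sum2] and [Ex_sum4] are applied with one-entry blocks. *)
Let row_sums k :
  (Ex P (fun w => \sum_(j <- row k) phi k (Y j w)) = 0 /\
  Ex P (fun w => (\sum_(j <- row k) phi k (Y j w)) ^+ 2) =
     k%:R * (tau k - trmean k ^+ 2)) /\
  Ex P (fun w => (\sum_(j <- row k) phi k (Y j w)) ^+ 4) <=
     k%:R * Ex P (fun w => phi k (Y0 w) ^+ 4) + 3 * (k%:R * (tau k - trmean k ^+ 2)) ^+ 2.
Proof.
pose J1 (j : nat * nat) := [:: j].
have u1 : uniq (flatten [seq J1 j | j <- row k]) by rewrite flat1 uniq_row.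
have d1 j : j \in flatten [seq J1 j | j <- row k] -> A j by rewrite flat1; exact: row_dom.
have E2 : \sum_(j <- row k) Ex P (fun w => phi k (Y j w) ^+ 2) = k%:R * (tau k - trmean k ^+ 2).
  rewrite (eq_big_seq (fun=> tau k - trmean k ^+ 2)) => [|j jk].
    by rewrite big_const_seq count_predT size_row iter_addr_0 mulr_natl.
  by rewrite (lawY (row_dom jk) (bmfX 2 (bphi k))) Ex_phi2.
have E4 : \sum_(j <- row k) Ex P (fun w => phi k (Y j w) ^+ 4) =
    k%:R * Ex P (fun w => phi k (Y0 w) ^+ 4).
  rewrite (eq_big_seq (fun=> Ex P (fun w => phi k (Y0 w) ^+ 4))) => [|j jk].
    by rewrite big_const_seq count_predT size_row iter_addr_0 mulr_natl.
  by rewrite (lawY (row_dom jk) (bmfX 4 (bphi k))).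
have [S1 S2] := @Ex_sum2 _ _ _ P _ A Y mY indY _ J1 (fun j w => phi k (Y j w)) (row k)
  u1 d1 (@sphi k) (@Ephi ^~ k).
have S4 := @Ex_sum4 _ _ _ P _ A Y mY indY _ J1 (fun j w => phi k (Y j w)) (row k)
  u1 d1 (@sphi k) (@Ephi ^~ k).
by rewrite E2 in S2; rewrite E2 E4 in S4.
Qed.

Lemma pspan_rowavg k : pspan Y (row k) (rowavg k).
Proof.
apply: pspanZ; apply: pspan_sum => j jk.
by apply: (pspan_gen Y) => //; exact: uniq_row.
Qed.

Lemma pspan_cos_rowavg k t th : pspan Y (row k) (fun w => cos (t * rowavg k w + th)).
Proof.
have -> : (fun w => cos (t * rowavg k w + th)) =
    (fun w => cos (t / k%:R * (\sum_(j <- row k) phi k (Y j w)) + th)).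
  by apply/funext => w; rewrite /rowavg mulrA.
apply: (@pspan_cos_sum _ _ _ _ Y (row k) (row k) (fun=> phi k)) => //; first exact: uniq_row.
by move=> _; case: (bphi k).
Qed.

Lemma Ex_rowavg k : Ex P (rowavg k) = 0.
Proof.
have [[E _] _] := row_sums k.
rewrite /rowavg ExZ ?E ?mulr0//; apply: itg_sum => j.
by apply: bmf_itg; exact: bmf_comp.
Qed.

Let ipow k n : itg P (fun w => (\sum_(j <- row k) phi k (Y j w)) ^+ n).
Proof. by apply: bmf_itg; apply: bmfX; apply: bmf_sum => j; exact: bmf_comp. Qed.

Lemma Ex_rowavg2 k : Ex P (fun w => rowavg k w ^+ 2) = k%:R^-1 * (tau k - trmean k ^+ 2).
Proof.
have [[_ E] _] := row_sums k.
transitivity (k%:R ^- 2 * Ex P (fun w => (\sum_(j <- row k) phi k (Y j w)) ^+ 2)).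
  by rewrite -(ExZ _ (ipow k 2)); apply: eq_Ex => w; rewrite /rowavg exprMn exprVn.
rewrite E; case: k {E} => [|k]; first by rewrite !mul0r mulr0 invr0 mul0r.
have : k.+1%:R != 0 :> R by rewrite pnatr_eq0.
by move: k.+1%:R => x x0; field.
Qed.

Lemma Ex_rowavg2_le k : Ex P (fun w => rowavg k w ^+ 2) <= v / k%:R.
Proof.
rewrite Ex_rowavg2 mulrC ler_wpM2r ?invr_ge0//.
by apply: le_trans (tau_le k); rewrite gerBl sqr_ge0.
Qed.

Lemma rowavg2_cvg :
  (\sum_(1 <= k < n.+1) Ex P (fun w => rowavg k w ^+ 2)) / ln n%:R @[n --> \oo] --> v.
Proof.
under eq_fun do under eq_bigr do rewrite Ex_rowavg2.
apply: log_cesaro; rewrite -[X in _ --> X]subr0 -[X in _ - X](mulr0 0).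
by apply: cvgB; [exact: tau_cvg|apply: cvgM; exact: trmean_cvg0].
Qed.

Let cm := v / s.

Lemma trmean_le k : (0 < k)%N -> `|trmean k| <= cm.
Proof. by move=> k0; apply: le_trans (trmean_tail k) _; exact: trtail_le. Qed.

Lemma trmean4_le k : (0 < k)%N -> trmean k ^+ 4 <= cm ^+ 3 * trtail k.
Proof.
move=> k0; rewrite -[leLHS]ger0_norm ?exprn_even_ge0// normrX.
rewrite exprSr; apply: ler_pM => //; last exact: trmean_tail.
by rewrite lerXn2r ?nnegrE ?divr_ge0 ?var0_ge0 ?(ltW s0)//; exact: trmean_le.
Qed.

(** Comes from [E (C k)^4 <= k^-3 (8 E tr^4 + 8 cm^4) + 3 k^-2 v^2]: the first part sums to at most
    [8 * 2 s^2 v] by [sum_trunc4], and the series of [k^-3] and [k^-2] are each bounded by 2. *)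
Definition fourth_bound := 16 * s ^+ 2 * v + (8 * cm ^+ 4 + 3 * v ^+ 2) * 2.

Lemma sum_rowavg4 n : \sum_(1 <= k < n.+1) Ex P (fun w => rowavg k w ^+ 4) <= fourth_bound.
Proof.
pose F k := k%:R ^- 3 * Ex P (fun w => tr k (Y0 w) ^+ 4).
have F1 : \sum_(1 <= k < n.+1) F k <= 2 * s ^+ 2 * v.
  have i4 k := itgZ (k%:R ^- 3) (itr k 4).
  rewrite /var0 -(ExZ _ iY2) /F (eq_bigr _ (fun k _ => esym (ExZ (k%:R ^- 3) (itr k 4)))).
  rewrite -Ex_sum//; apply: Ex_le; [exact: itg_sum|exact: itgZ|move=> w].
  exact: sum_trunc4.
apply: (@le_trans _ _ (\sum_(1 <= k < n.+1) (8 * F k + (8 * cm ^+ 4 * k%:R ^- 3 + 3 * v ^+ 2 * k%:R ^- 2)))).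
  rewrite big_nat_cond [leRHS]big_nat_cond; apply: ler_sum => k /andP[/andP[k1 _] _].
  have k0 : 0 < k%:R :> R by rewrite ltr0n.
  have -> : Ex P (fun w => rowavg k w ^+ 4) = k%:R ^- 4 * Ex P (fun w => (\sum_(j <- row k) phi k (Y j w)) ^+ 4).
    by rewrite -(ExZ _ (ipow k 4)); apply: eq_Ex => w; rewrite /rowavg exprMn exprVn.
  have [_ E4] := row_sums k.
  apply: le_trans (ler_wpM2l _ E4) _; first by rewrite invr_ge0 exprn_ge0.
  have -> : 8 * F k + (8 * cm ^+ 4 * k%:R ^- 3 + 3 * v ^+ 2 * k%:R ^- 2) =
     k%:R ^- 4 * (k%:R * (8 * Ex P (fun w => tr k (Y0 w) ^+ 4) + 8 * cm ^+ 4) + 3 * (k%:R * v) ^+ 2).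
    by rewrite /F; field; rewrite gt_eqF.
  apply: ler_wpM2l; first by rewrite invr_ge0 exprn_ge0.
  apply: lerD.
    apply: ler_wpM2l => //; apply: le_trans (Ex_phi4 k) _; rewrite lerD2l ler_wpM2l//.
    rewrite -[leLHS]ger0_norm ?exprn_even_ge0// normrX lerXn2r ?nnegrE//.
      by rewrite divr_ge0 ?var0_ge0 ?(ltW s0).
    exact: trmean_le.
  apply: ler_wpM2l => //; rewrite lerXn2r ?nnegrE ?mulr_ge0 ?var0_ge0//.
    by rewrite -Ex_phi2; apply: Ex_ge0 => w; exact: sqr_ge0.
  by rewrite ler_wpM2l//; apply: le_trans (tau_le k); rewrite gerBl sqr_ge0.
rewrite !big_split/= -!mulr_sumr /fourth_bound.
have c4 : 0 <= 8 * cm ^+ 4 by apply: mulr_ge0 => //; exact: exprn_even_ge0.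
have v2 : 0 <= 3 * v ^+ 2 by apply: mulr_ge0 => //; exact: sqr_ge0.
have := ler_wpM2l c4 (sum_inv_cube R n); have := ler_wpM2l v2 (sum_inv_sqr R n).
move: F1; lra.
Qed.

(* [badness e k < 1] forces row [k] to be untruncated and its average to be within [e] of 0. *)
Definition badness (e : R) k w : R :=
  \sum_(j <- row k) \1_(tail (s * k%:R)) (Y j w) +
  8 * e ^- 4 * (rowavg k w ^+ 4 + trmean k ^+ 4).

Lemma bmf_badness e k : bmf (badness e k).
Proof.
apply: bmfD.
  by apply: bmf_sum => j; apply: bmf_comp => //; exact: bmf_tail.
apply: bmfZ; apply: bmfD; last exact: bmf_cst.
by apply: bmfX; exact: pspan_bmf (pspan_rowavg k).
Qed.

Lemma badness_ge0 e k w : 0 <= badness e k w.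
Proof.
apply: addr_ge0; first by rewrite sumr_ge0.
apply: mulr_ge0; last by apply: addr_ge0; exact: exprn_even_ge0.
by apply: mulr_ge0 => //; rewrite invr_ge0 exprn_even_ge0.
Qed.

(** A truncated entry alone contributes 1 to [badness]. Without one, the row average is [rowavg]
    plus the mean that was subtracted, and if this sum reached [e], then
    [e^4 <= 8 (rowavg^4 + trmean^4)] by [pow4_add], which explains the weight [8 e^-4]. *)
Lemma badness_lt1 e k w : 0 < e -> (0 < k)%N -> badness e k w < 1 ->
  (\sum_(j <- row k) Y j w) / k%:R = rowavg k w + trmean k /\
  `|rowavg k w + trmean k| < e.
Proof.
move=> e0 k1 bd; have k0 : 0 < k%:R :> R by rewrite ltr0n.
have B0 : 0 <= 8 * e ^- 4 * (rowavg k w ^+ 4 + trmean k ^+ 4).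
  apply: mulr_ge0; last by apply: addr_ge0; exact: exprn_even_ge0.
  by apply: mulr_ge0 => //; rewrite invr_ge0 exprn_even_ge0.
have S0 : 0 <= \sum_(j <- row k) \1_(tail (s * k%:R)) (Y j w) :> R by rewrite sumr_ge0.
split.
  have tY j : j \in row k -> tr k (Y j w) = Y j w.
    move=> jk; case: (leP `|Y j w| (s * k%:R)) => h; first exact: trunc_le.
    have : 1 <= \sum_(j <- row k) \1_(tail (s * k%:R)) (Y j w) :> R.
      rewrite (bigD1_seq j)//= ?uniq_row// (tail_le h) lerDl sumr_ge0//.
    by move: bd; rewrite /badness; lra.
  rewrite /rowavg /phi sumrB (eq_big_seq _ tY).
  rewrite big_const_seq count_predT size_row iter_addr_0 -mulr_natl.
  by field; rewrite gt_eqF.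
rewrite ltNge; apply/negP => h.
have : 1 <= 8 * e ^- 4 * (rowavg k w ^+ 4 + trmean k ^+ 4).
  rewrite mulrAC ler_pdivlMr ?exprn_gt0// mul1r mulrDr.
  apply: le_trans (pow4_add _ _).
  rewrite -[leRHS]ger0_norm ?exprn_even_ge0// normrX lerXn2r ?nnegrE//.
  exact: ltW.
by move: bd; rewrite /badness; lra.
Qed.

(** A row has [k] entries of the same law, so the indicators sum to at most [v / s^2] by
    [sum_weighted_tail]. In [trmean k ^ 4] three factors are bounded by [cm], and the last one is
    summable with sum at most [v / s], again [cm]. *)
Definition bad_bound (e : R) := v / s ^+ 2 + 8 * e ^- 4 * (fourth_bound + cm ^+ 3 * cm).

Lemma sum_badness e n : \sum_(1 <= k < n.+1) Ex P (badness e k) <= bad_bound e.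
Proof.
have it j k : itg P (fun w => \1_(tail (s * k%:R)) (Y j w)) by exact: itg_tail.
have it0 k : itg P (fun w => \1_(tail (s * k%:R)) (Y0 w)) by exact: itg_tail.
have i4 k : itg P (fun w => rowavg k w ^+ 4).
  by apply: bmf_itg; apply: bmfX; exact: pspan_bmf (pspan_rowavg k).
have E k : Ex P (badness e k) = k%:R * Ex P (fun w => \1_(tail (s * k%:R)) (Y0 w)) +
    8 * e ^- 4 * (Ex P (fun w => rowavg k w ^+ 4) + trmean k ^+ 4).
  have i5 := itgD (i4 k) (itg_cst P (trmean k ^+ 4)).
  rewrite /badness ExD; [|by apply: itg_sum|exact: itgZ].
  rewrite (ExZ _ i5) (ExD (i4 k) (itg_cst P _)) Ex_cst; congr (_ + _).
  rewrite Ex_sum// (eq_big_seq (fun=> Ex P (fun w => \1_(tail (s * k%:R)) (Y0 w)))) => [|j jk].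
    by rewrite big_const_seq count_predT size_row iter_addr_0 mulr_natl.
  by rewrite (lawY (row_dom jk) (bmf_tail _)).
rewrite (eq_bigr _ (fun k _ => E k)) big_split/= -mulr_sumr big_split/=; apply: lerD.
  rewrite (eq_bigr _ (fun k _ => esym (ExZ k%:R (it0 k)))) -Ex_sum; last by move=> k; exact: itgZ.
  rewrite ler_pdivlMr ?exprn_gt0// mulrC /var0.
  have is_ : itg P (fun w => \sum_(1 <= k < n.+1) k%:R * \1_(tail (s * k%:R)) (Y0 w)).
    by apply: itg_sum => k; exact: itgZ.
  rewrite -(ExZ _ is_); apply: Ex_le => //; first exact: itgZ.
  by move=> w; exact: sum_weighted_tail.
apply: ler_wpM2l; first by apply: mulr_ge0 => //; rewrite invr_ge0 exprn_even_ge0.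
apply: lerD; first exact: sum_rowavg4.
have c3 : 0 <= cm ^+ 3 by rewrite exprn_ge0// divr_ge0 ?var0_ge0 ?(ltW s0).
apply: le_trans (ler_wpM2l c3 (sum_trtail n)).
rewrite mulr_sumr big_nat_cond [leRHS]big_nat_cond.
by apply: ler_sum => k /andP[/andP[k1 _] _]; exact: trmean4_le.
Qed.

End array.

(** * Taylor's formula for [f] at the mean *)

Section taylor.
Variable R : realType.

Let is_derive_shift (F : R -> R) (a x : R) : derivable F (a + x) 1 ->
  is_derive x 1 (fun y : R => F (a + y)) (derive1 F (a + x)).
Proof.
move=> dF; rewrite -[X in is_derive _ _ _ X]mulr1.
apply: (@is_derive1_comp _ F (fun y => a + y)).
  by apply: DeriveDef => //; rewrite derive1E.
rewrite (_ : (fun y => a + y) = (fun y => y + a)).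
  by apply: is_derive_eq; rewrite addr0.
by apply/funext => y; rewrite addrC.
Qed.

(** [derive_pow_bound] is applied three times, descending from the bounded third derivative to [f];
    the constant stays [M] instead of [M / 6]. *)
Lemma taylor2_remainder (f : R -> R) (a e M : R) : 0 <= M ->
  (forall x, `|x - a| < e -> derivable f x 1 /\ derivable (derive1 f) x 1 /\
     derivable (derive1n 2 f) x 1) ->
  (forall x, `|x - a| < e -> `|(derive1n 3 f) x| <= M) ->
  forall x : R, `|x| < e ->
  `|f (a + x) - f a - derive1 f a * x - derive1n 2 f a / 2 * x ^+ 2| <= M * `|x| ^+ 3.
Proof.
move=> M0 df f3.
have ball_ (x : R) : `|x| < e -> `|a + x - a| < e by rewrite addrC addKr.
set d1 := derive1 f a; set d2 := derive1n 2 f a.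
have H2 (x : R) : `|x| < e -> `|derive1n 2 f (a + x) - d2| <= M * `|x| ^+ 1.
  apply: (@derive_pow_bound _ (fun x => derive1n 2 f (a + x) - d2)
    (fun x => derive1n 3 f (a + x)) M e 0) => //.
  - move=> y ye; have [_ [_ D]] := df _ (ball_ _ ye).
    have D' := is_derive_shift D.
    by apply: is_derive_eq; rewrite subr0.
  - by rewrite addr0 subrr.
  - by move=> y ye; rewrite expr0 mulr1; apply: f3; exact: ball_.
have H1 (x : R) : `|x| < e -> `|derive1 f (a + x) - d1 - d2 * x| <= M * `|x| ^+ 2.
  apply: (@derive_pow_bound _ (fun x => derive1 f (a + x) - d1 - d2 * x)
    (fun x => derive1n 2 f (a + x) - d2) M e 1) => //.
  - move=> y ye; have [_ [D _]] := df _ (ball_ _ ye).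
    have D' := is_derive_shift D.
    by apply: is_derive_eq; rewrite /GRing.scale/= ; ring.
  - by rewrite addr0 subrr mulr0 subrr.
apply: (@derive_pow_bound _ (fun x => f (a + x) - f a - d1 * x - d2 / 2 * x ^+ 2)
    (fun x => derive1 f (a + x) - d1 - d2 * x) M e 2) => //.
- move=> y ye; have [D _] := df _ (ball_ _ ye).
  have D' := is_derive_shift D.
  by apply: is_derive_eq; rewrite /GRing.scale/= ; field.
- by rewrite addr0 subrr mulr0 expr0n/= mulr0 !subr0.
Qed.

End taylor.

(** * Decomposition of the normalised sum and its limit *)

Section array_limit.
Context d (T : measurableType d) (R : realType) (P : probability T R).
Variables (Y : nat * nat -> T -> R) (Y0 : T -> R) (s : R).
Hypothesis mY : forall j, measurable_fun setT (Y j).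
Let A : set (nat * nat) := [set kn | (1 <= kn.1 <= kn.2)%N].
Hypothesis indY : mutually_independent P A Y.
Hypothesis mY0 : measurable_fun setT Y0.
Hypothesis lawY : forall j, A j -> forall h, bmf h ->
  Ex P (fun w => h (Y j w)) = Ex P (fun w => h (Y0 w)).
Hypothesis iY2 : itg P (fun w => Y0 w ^+ 2).
Hypothesis EY0 : Ex P Y0 = 0.
Hypothesis s0 : 0 < s.
Variables (f : R -> R) (a d1 d2 e M : R).
Hypothesis mf : measurable_fun setT f.
Hypothesis e0 : 0 < e.
Hypothesis M0 : 0 <= M.
Hypothesis taylor : forall x, `|x| < e ->
  `|f (a + x) - f a - d1 * x - d2 / 2 * x ^+ 2| <= M * `|x| ^+ 3.

Local Notation C := (rowavg P Y Y0 s).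
Local Notation m := (trmean P Y0 s).
Local Notation v := (var0 P Y0).
Local Notation tau := (tau P Y0 s).
Let C2 k := Ex P (fun w => C k w ^+ 2).

Definition average k w := (\sum_(j <- row k) Y j w) / k%:R.

(** The centring subtracted is [tau k / k], as in [b_n], whereas
    [E (C k)^2 = (tau k - trmean k ^ 2) / k]. The discrepancy [trmean k ^ 2 / k] therefore belongs
    to the remainder. *)
Definition remainder k w :=
  f (a + average k w) - f a - d1 * C k w - d2 / 2 * (C k w ^+ 2 - C2 k) - d2 / 2 * (k%:R^-1 * tau k).

Lemma measurable_average k : measurable_fun setT (average k).
Proof. by apply: measurable_funM => //; apply: measurable_sum. Qed.

Let bC k : bmf (C k). Proof. exact (pspan_bmf mY (pspan_rowavg P Y Y0 s k)). Qed.

Lemma measurable_remainder k : measurable_fun setT (remainder k).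
Proof.
have mC : measurable_fun setT (C k) by case: (bC k).
have mfa : measurable_fun setT (fun w => f (a + average k w)).
  by apply: measurableT_comp => //; apply: measurable_funD => //; exact: measurable_average.
apply: measurable_funB => //; apply: measurable_funB.
  by apply: measurable_funB; [exact: measurable_funB|exact: measurable_funM].
by apply: measurable_funM => //; apply: measurable_funB => //; exact: measurable_funX.
Qed.

Let cm := v / s.

(** The 4 is the constant of [(x + y)^3 <= 4 (x^3 + y^3)], applied to [|C k|] and [|trmean k|], the
    second cube being at most [cm^2 * trtail k]. The summand with [d1] pays for the linear shift,
    the one with [d2] for the cross term and the square of the shift. *)
Definition rem_const := 4 * M + 4 * M * cm ^+ 2 + `|d1| + `|d2| * (1 + cm).

Let cm0 : 0 <= cm. Proof. by rewrite divr_ge0 ?var0_ge0 ?(ltW s0). Qed.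

Lemma rem_const_ge0 : 0 <= rem_const.
Proof.
rewrite /rem_const; have h : 0 <= 4 * M * cm ^+ 2 by apply: mulr_ge0; [exact: mulr_ge0|exact: sqr_ge0].
have h' : 0 <= `|d2| * (1 + cm) by apply: mulr_ge0 => //; exact: addr_ge0.
by apply: addr_ge0 => //; apply: addr_ge0 => //; apply: addr_ge0 => //; exact: mulr_ge0.
Qed.

(** In a good row the average is exactly [C k + m k] and lies within [e] of 0, so Taylor's formula
    applies there. Every error other than the cube of [C k] carries a factor [m k], hence a summable
    weight. *)
Lemma remainder_bound k w eta : (0 < k)%N -> badness P Y Y0 s e k w < 1 -> 0 < eta ->
  `|remainder k w| <= rem_const * (eta * C k w ^+ 2 + eta^-1 * C k w ^+ 4 +
     trtail P Y0 s k * (1 + C k w ^+ 2)).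
Proof.
move=> k1 bd eta0.
have k0 : 0 < k%:R :> R by rewrite ltr0n.
have ki : k%:R^-1 <= 1 :> R by rewrite invf_le1// ler1n.
have [avE Ce] := badness_lt1 e0 k1 bd.
have mt := trmean_tail s mY0 iY2 EY0 k.
have tc : trtail P Y0 s k <= cm := trtail_le mY0 iY2 s0 k1.
have T0 := taylor Ce.
have RE : remainder k w =
   (f (a + (C k w + m k)) - f a - d1 * (C k w + m k) - d2 / 2 * (C k w + m k) ^+ 2) +
   (d1 * m k + d2 / 2 * (2 * m k * C k w + m k ^+ 2 - k%:R^-1 * m k ^+ 2)).
  rewrite /remainder /average avE /C2 (Ex_rowavg2 s mY indY mY0 lawY).
  by ring.
rewrite RE {RE}; apply: le_trans (ler_normD _ _) _.
set c := C k w; set mu := m k; set mm := trtail P Y0 s k.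
have mt' : `|mu| <= mm := mt.
have mm0 : 0 <= mm by exact: le_trans mt'.
have q4 : 0 <= c ^+ 4 by exact: exprn_even_ge0.
have q2 : 0 <= c ^+ 2 by exact: sqr_ge0.
have N2 : c ^+ 2 = `|c| ^+ 2 by rewrite real_normK ?num_real.
have N4 : c ^+ 4 = `|c| ^+ 4 by rewrite -normrX ger0_norm.
have n0 : 0 <= `|c| by exact: normr_ge0.
have nm0 : 0 <= `|mu| by exact: normr_ge0.
have cm2 : mu ^+ 2 <= cm * mm.
  rewrite -[leLHS]real_normK ?num_real// expr2 ler_pM//.
  exact: le_trans mt' tc.
have cube1 : `|c| ^+ 3 <= eta * c ^+ 2 + eta^-1 * c ^+ 4.
  rewrite N2 N4; move: n0; move: `|c| => u u0.
  have -> : eta * u ^+ 2 + eta^-1 * u ^+ 4 = u ^+ 3 + eta^-1 * u ^+ 2 * (eta ^+ 2 - eta * u + u ^+ 2).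
    by field; rewrite gt_eqF.
  rewrite lerDl; apply: mulr_ge0; last by have := sqr_ge0 (eta / 2 - u); rewrite !expr2; nra.
  by apply: mulr_ge0; [rewrite invr_ge0 ltW|exact: sqr_ge0].
have cube2 : `|mu| ^+ 3 <= cm ^+ 2 * mm.
  rewrite exprSr ler_pM ?exprn_ge0// lerXn2r ?nnegrE//.
  exact: le_trans mt' tc.
have cube3 : `|c + mu| ^+ 3 <= 4 * (`|c| ^+ 3 + `|mu| ^+ 3).
  apply: (@le_trans _ _ ((`|c| + `|mu|) ^+ 3)).
    by rewrite lerXn2r ?nnegrE ?addr_ge0//; exact: ler_normD.
  rewrite -subr_ge0.
  have -> : 4 * (`|c| ^+ 3 + `|mu| ^+ 3) - (`|c| + `|mu|) ^+ 3 =
    3 * ((`|c| + `|mu|) * (`|c| - `|mu|) ^+ 2) by ring.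
  by apply: mulr_ge0 => //; apply: mulr_ge0; [exact: addr_ge0|exact: sqr_ge0].
have mc : `|mu| * `|c| <= mm * (1 + c ^+ 2).
  apply: ler_pM => //; rewrite N2.
  by have := sqr_ge0 (`|c| - 2^-1); rewrite !expr2; nra.
have mm1 : mm <= mm * (1 + c ^+ 2) by rewrite ler_peMr// lerDl.
set X := eta * c ^+ 2 + eta^-1 * c ^+ 4; set Z := mm * (1 + c ^+ 2).
have X0 : 0 <= X.
  by apply: addr_ge0; apply: mulr_ge0 => //; rewrite ?invr_ge0 ltW.
have Z0 : 0 <= Z by exact: le_trans mm1.
have P1 : `|f (a + (c + mu)) - f a - d1 * (c + mu) - d2 / 2 * (c + mu) ^+ 2| <=
    4 * M * X + 4 * M * cm ^+ 2 * Z.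
  apply: le_trans T0 _.
  have h1 := ler_wpM2l M0 cube3.
  have h2 := ler_wpM2l M0 cube1.
  have h3 := ler_wpM2l M0 cube2.
  have h4 : M * cm ^+ 2 * mm <= M * cm ^+ 2 * Z.
    by apply: ler_wpM2l => //; apply: mulr_ge0 => //; exact: sqr_ge0.
  by move: h1 h2 h3 h4; rewrite -/X; lra.
have P2 : `|d1 * mu + d2 / 2 * (2 * mu * c + mu ^+ 2 - k%:R^-1 * mu ^+ 2)| <=
    `|d1| * Z + `|d2| * (1 + cm) * Z.
  apply: le_trans (ler_normD _ _) _; apply: lerD.
    by rewrite normrM ler_wpM2l//; exact: le_trans mt' mm1.
  have -> : d2 / 2 * (2 * mu * c + mu ^+ 2 - k%:R^-1 * mu ^+ 2) =
      d2 * (mu * c + (1 - k%:R^-1) / 2 * mu ^+ 2) by field; rewrite gt_eqF.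
  rewrite normrM -[leRHS]mulrA ler_wpM2l//; apply: le_trans (ler_normD _ _) _.
  rewrite [leRHS]mulrDl mul1r; apply: lerD; first by rewrite normrM.
  have ki0 : 0 <= k%:R^-1 :> R by rewrite invr_ge0.
  have h5 : (1 - k%:R^-1) / 2 * mu ^+ 2 <= mu ^+ 2 by rewrite ler_piMl ?sqr_ge0//; lra.
  rewrite ger0_norm; last by apply: mulr_ge0; [lra|exact: sqr_ge0].
  apply: le_trans h5 _; apply: le_trans cm2 _; exact: ler_wpM2l.
apply: le_trans (lerD P1 P2) _.
have Q1 : 0 <= 4 * M * cm ^+ 2 * X by apply: mulr_ge0 => //; apply: mulr_ge0; [exact: mulr_ge0|exact: sqr_ge0].
have Q2 : 0 <= `|d1| * X by exact: mulr_ge0.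
have Q3 : 0 <= `|d2| * (1 + cm) * X by apply: mulr_ge0 => //; apply: mulr_ge0 => //; exact: addr_ge0.
have Q4 : 0 <= 4 * M * Z by apply: mulr_ge0 => //; exact: mulr_ge0.
have -> : rem_const * (X + Z) = 4 * M * X + 4 * M * cm ^+ 2 * Z + (`|d1| * Z + `|d2| * (1 + cm) * Z) +
    (4 * M * cm ^+ 2 * X + `|d1| * X + `|d2| * (1 + cm) * X + 4 * M * Z) by rewrite /rem_const; ring.
by rewrite lerDl; apply: addr_ge0 => //; apply: addr_ge0 => //; exact: addr_ge0.
Qed.

Definition normalized n w :=
  (\sum_(1 <= k < n.+1) f (a + average k w) -
    (n%:R * f a + d2 / 2 * \sum_(1 <= k < n.+1) k%:R^-1 * tau k)) / nrm R n.

(** The Gaussian cosine transform depends on [c] through [c^2] only; this form accommodates both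
    signs of [f'(mu)]. *)
Theorem array_limit (c : R) (g : R -> R) : c ^+ 2 = d1 ^+ 2 * v -> continuous g ->
  (exists K, forall x, `|g x| <= K) ->
  Ex P (fun w => g (normalized n w)) @[n --> \oo] -->
  Ex (normal_prob (0 : R) 1) (fun x => g (c * x)).
Proof.
move=> c2 cg bg.
have uJ := uniq_rows; have JA := rows_dom.
have sC k := pspan_rowavg P Y Y0 s k.
have cosC k t th := pspan_cos_rowavg P Y Y0 s k t th.
have C0 k := Ex_rowavg s mY indY mY0 lawY k.
have HC2 k (k0 : (0 < k)%N) := Ex_rowavg2_le s mY indY mY0 lawY iY2 k.
have C2lim := rowavg2_cvg mY indY mY0 lawY iY2 EY0 s0.
have C4 := sum_rowavg4 mY indY mY0 lawY iY2 EY0 s0.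
pose Q n w := d2 / 2 * (\sum_(1 <= k < n.+1) (C k w ^+ 2 - C2 k)) / nrm R n.
pose r n w := (\sum_(1 <= k < n.+1) remainder k w) / nrm R n.
have E n w : normalized n w = row_sum C d1 n w + (Q n w + r n w).
  rewrite /normalized /row_sum /Q /r -!mulrDl; congr (_ / _).
  have -> : \sum_(1 <= k < n.+1) f (a + average k w) = \sum_(1 <= k < n.+1)
    (f a + (d1 * C k w + (d2 / 2 * (C k w ^+ 2 - C2 k) + (d2 / 2 * (k%:R^-1 * tau k) + remainder k w)))).
    by apply: eq_bigr => k _; rewrite /remainder; ring.
  have S (x y z u : nat -> R) : \sum_(1 <= k < n.+1)
      (f a + (d1 * x k + (d2 / 2 * y k + (d2 / 2 * z k + u k)))) =
      n%:R * f a + (d1 * \sum_(1 <= k < n.+1) x k + (d2 / 2 * \sum_(1 <= k < n.+1) y k +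
      (d2 / 2 * \sum_(1 <= k < n.+1) z k + \sum_(1 <= k < n.+1) u k))).
    by rewrite !big_split/= -!mulr_sumr sumr_const_nat subn1/= mulr_natl.
  rewrite (S (fun k => C k w) (fun k => C k w ^+ 2 - C2 k) (fun k => k%:R^-1 * tau k)
    (fun k => remainder k w)).
  by ring.
have bA n : bmf (row_sum C d1 n) := bmf_row_sum mY sC d1 n.
have mA n : measurable_fun setT (row_sum C d1 n) by case: (bA n).
have mQ n : measurable_fun setT (Q n).
  apply: measurable_funM => //; apply: measurable_funM => //.
  by apply: measurable_sum => k; apply: measurable_funB => //; apply: measurable_funX; case: (bC k).
have mr n : measurable_fun setT (r n).
  by apply: measurable_funM => //; apply: measurable_sum => k; exact: measurable_remainder.
have mU n : measurable_fun setT (fun w => Q n w + r n w) by exact: measurable_funD.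
have U0 : cvp0 P (fun n w => Q n w + r n w).
  apply: cvp0D => //.
    exact: (row_square_cvp0 mY indY uJ JA sC C4).
  have mr' := measurable_remainder.
  have bb := bmf_badness P Y0 s mY e.
  have b0 := badness_ge0 P Y Y0 s e.
  have sb := sum_badness mY indY mY0 lawY iY2 EY0 s0 e.
  have m0 := trtail_ge0 P Y0 s.
  have sm := sum_trtail mY0 iY2 s0.
  exact (row_remainder_cvp0 mY sC HC2 C4 mr' bb b0 sb m0 sm rem_const_ge0 remainder_bound).
rewrite (_ : (fun n => Ex P (fun w => g (normalized n w))) =
   (fun n => Ex P (fun w => g (row_sum C d1 n w + (Q n w + r n w))))); last first.
  by apply/funext => n; apply: eq_Ex => w; rewrite E.
apply: (@cvg_continuous_bounded _ _ _ P _ _ (normal_prob (0 : R) 1)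
  (fun n w => row_sum C d1 n w + (Q n w + r n w)) (fun x => c * x)) => //.
- by move=> n; exact: measurable_funD.
- exact: measurable_funM.
- move=> t th; apply: slutsky_cos => //.
  under [X in _ --> X]eq_Ex do rewrite mulrA.
  rewrite Ex_normal_cos.
  have -> : - (t * c) ^+ 2 / 2 = - (t ^+ 2 * d1 ^+ 2 * v) / 2 by rewrite exprMn c2 mulrA.
  exact: (row_sum_cos mY indY uJ JA sC cosC C0 HC2 C2lim C4).
- apply: slutsky_tight => //.
  exact: (row_sum2_bounded mY indY uJ JA sC C0 HC2 d1).
Qed.

End array_limit.

(** * Translation to the original random variables and conclusion *)

Lemma fine_expectation d (T : measurableType d) (R : realType) (P : probability T R)
  (U : T -> R) : fine 'E_P[U] = Ex P U.
Proof. by rewrite expectation.unlock. Qed.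

(* When [sigma = 0] both sides vanish, so any positive truncation scale will do. *)
Lemma Ex_truncated_square d (T : measurableType d) (R : realType) (P : probability T R)
    (Y0 : T -> R) (sigma : R) k :
  measurable_fun setT Y0 -> itg P (fun w => Y0 w ^+ 2) ->
  0 <= sigma -> sigma ^+ 2 = var0 P Y0 ->
  Ex P (fun w => Y0 w ^+ 2 * \1_[set w' | `|Y0 w'| <= sigma * k%:R] w) =
  tau P Y0 (if sigma == 0 then 1 else sigma) k.
Proof.
move=> mY0 iY2 sg0 sg2.
have mI L : measurable_fun setT (fun w => \1_[set w' | `|Y0 w'| <= L] w : R).
  apply/measurable_indicP; rewrite -[X in measurable X]setTI.
  by apply: (measurable_fun_le (f := fun w => `|Y0 w|) (g := fun=> L)) => //;
    exact: measurableT_comp.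
have iI L : itg P (fun w => Y0 w ^+ 2 * \1_[set w' | `|Y0 w'| <= L] w).
  apply: (@itg_le _ _ _ _ _ (fun w => Y0 w ^+ 2)) => //.
    by apply: measurable_funM => //; exact: measurable_funX.
  by move=> w; rewrite normrM (ger0_norm (sqr_ge0 _)) ler_piMr ?sqr_ge0// indicE; case: (_ \in _);
    rewrite ?normr1 ?normr0.
case: eqP => [sE|_].
  have v0 : var0 P Y0 = 0 by rewrite -sg2 sE expr0n.
  transitivity (0 : R).
    apply/eqP; rewrite eq_le; apply/andP; split; last first.
      by apply: Ex_ge0 => w; apply: mulr_ge0 => //; exact: sqr_ge0.
    rewrite -v0; apply: Ex_le => // w.
    by rewrite ler_piMr ?sqr_ge0// indicE lern1 leq_b1.
  apply/eqP; rewrite eq_le; apply/andP; split.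
    by apply: Ex_ge0 => w; exact: sqr_ge0.
  by rewrite -v0; exact: tau_le.
apply: eq_Ex => w; rewrite indicE.
case: (leP `|Y0 w| (sigma * k%:R)) => h.
  by rewrite mem_set//= mulr1 /tr trunc_le.
by rewrite memNset/= ?leNgt ?h// mulr0 /tr trunc_gt// expr0n.
Qed.

Theorem theorem1 (d : measure_display) (T : measurableType d) (R : realType)
  (P : probability T R) (X : {RV P >-> R})
  (Xa : nat -> nat -> {RV P >-> R}) (I : interval R) (f : R -> R) :
  (X : T -> R) \in Lfun P 2%:E ->
  mutually_independent P [set kn | (1 <= kn.1 <= kn.2)%N]
    (fun kn : nat * nat => (Xa kn.1 kn.2 : T -> R)) ->
  (forall k n, (1 <= k <= n)%N ->
     forall B : set R, measurable B ->
       distribution P (Xa k n) B = distribution P X B) ->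
  P (X @^-1` [set` I]) = 1%E ->
  measurable_fun setT f ->
  let mu := fine 'E_P[X] in
  let sigma := Num.sqrt (fine 'V_P[X]) in
  (exists e : R, 0 < e /\
    (forall x, `|x - mu| < e ->
       derivable f x 1 /\ derivable (derive1 f) x 1 /\ derivable (derive1n 2 f) x 1) /\
    (exists M : R, forall x, `|x - mu| < e -> `|(derive1n 3 f) x| <= M)) ->
  let Skk k := fun w => \sum_(1 <= i < k.+1) Xa i k w in
  let a n := Num.sqrt (ln n%:R) in
  let b n := n%:R * f mu + (derive1n 2 f) mu / 2 *
     \sum_(1 <= k < n.+1) k%:R^-1 *
        fine 'E_P[fun w => (X w - mu) ^+ 2 *
                 \1_[set w' | `|X w' - mu| <= sigma * k%:R] w] in
  cvg_distr_scaled_std_normal P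
    (fun n w => (\sum_(1 <= k < n.+1) f (Skk k w / k%:R) - b n) / a n)
    (sigma * (derive1 f) mu).
Proof.
move=> X2 ind law _ mf mu sigma [e [e0 [df [M hM]]]] Skk a b.
have M0 : 0 <= M by apply: le_trans (normr_ge0 _) (hM mu _); rewrite subrr normr0.
have fP : P setT \is a fin_num by exact: fin_num_measure.
have iX : itg P X by apply/Lfun1_integrable; exact: Lfun_subset12.
have iX2 : itg P (fun w => X w ^+ 2) by exact: Lfun2_integrable_sqr.
have mX : measurable_fun setT X by exact: measurable_funPT.
pose Y (j : nat * nat) w : R := Xa j.1 j.2 w - mu.
pose Y0 w : R := X w - mu.
have mY j : measurable_fun setT (Y j).
  by apply: measurable_funB => //; exact: measurable_funPT.
have mY0 : measurable_fun setT Y0 by exact: measurable_funB.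
have muE : mu = Ex P X by exact: fine_expectation.
have iY2 : itg P (fun w => Y0 w ^+ 2).
  have -> : (fun w => Y0 w ^+ 2) = (fun w => X w ^+ 2 - (2 * mu * X w - mu ^+ 2)).
    by apply/funext => w; rewrite /Y0; ring.
  by apply: itgB => //; apply: itgB; [exact: itgZ|exact: itg_cst].
have EY0 : Ex P Y0 = 0.
  by rewrite (ExB iX (itg_cst P mu)) Ex_cst -muE subrr.
have varE : fine 'V_P[X] = var0 P Y0.
  by rewrite /variance covariance.unlock fine_expectation.
have sg2 : sigma ^+ 2 = var0 P Y0 by rewrite sqr_sqrtr varE ?var0_ge0.
have sg0 : 0 <= sigma by exact: sqrtr_ge0.
(* The array lemmas need a positive scale; in the degenerate case the default 1 leaves [b]
   unchanged, as [bE] confirms below. *)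
set s := if sigma == 0 then 1 else sigma.
have s0 : 0 < s by rewrite /s; case: eqP => // /eqP h; rewrite lt_neqAle eq_sym h.
have mshift : measurable_fun setT (fun x : R => x - mu) by exact: measurable_funB.
have indY : mutually_independent P [set kn | (1 <= kn.1 <= kn.2)%N] Y.
  move=> J uJ JA B mB.
  apply: (ind J uJ JA (fun j => (fun x => x - mu) @^-1` B j)) => j.
  by rewrite -[X in measurable X]setTI; exact: mshift.
have lawY (j : nat * nat) : [set kn | (1 <= kn.1 <= kn.2)%N] j -> forall h, bmf h ->
    Ex P (fun w => h (Y j w)) = Ex P (fun w => h (Y0 w)).
  (* Equality of the laws on Borel sets is equality on indicators, which extends to bounded
     functions. *)
  move=> Aj; apply: bounded_linear_eq; [exact: bounded_linear_Ex1|exact: bounded_linear_Ex1|].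
  move=> B mB; apply: EFin_inj.
  have mB' : measurable ((fun x => x - mu) @^-1` B).
    by rewrite -[X in measurable X]setTI; exact: mshift.
  have indE (Z : {RV P >-> R}) : (Ex P (fun w => \1_B (Z w - mu)))%:E =
      distribution P Z ((fun x => x - mu) @^-1` B).
    rewrite /distribution /pushforward -Ex_indic; first by [].
    by rewrite -[X in measurable X]setTI; exact: measurable_funPT.
  by rewrite (indE (Xa j.1 j.2)) (indE X); exact: law.
have tay := taylor2_remainder M0 df hM.
have c2 : (sigma * derive1 f mu) ^+ 2 = derive1 f mu ^+ 2 * var0 P Y0.
  by rewrite exprMn sg2 mulrC.
have lim := array_limit mY indY mY0 lawY iY2 EY0 s0 mf e0 M0 tay c2.
have avE k w : (0 < k)%N -> mu + average Y k w = Skk k w / k%:R.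
  move=> k0; rewrite /average /Skk /row big_map /Y/= sumrB sumr_const_nat subn1/= -mulr_natl.
  by field; rewrite pnatr_eq0 -lt0n.
have bE n : b n = n%:R * f mu + (derive1n 2 f) mu / 2 *
    \sum_(1 <= k < n.+1) k%:R^-1 * tau P Y0 s k.
  rewrite /b; congr (_ + _ * _); apply: eq_bigr => k _.
  by rewrite fine_expectation; congr (_ * _); exact: Ex_truncated_square.
have normE n w : (\sum_(1 <= k < n.+1) f (Skk k w / k%:R) - b n) / a n =
    normalized P Y Y0 s f mu (derive1n 2 f mu) n w.
  rewrite /normalized bE; congr ((_ - _) / _).
  rewrite big_nat_cond [RHS]big_nat_cond; apply: eq_bigr => k /andP[/andP[k0 _] _].
  by rewrite avE.
move=> g cg [K gK].
have mg : measurable_fun setT g by exact: continuous_measurable_fun.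
have gN (U : T -> R) : measurable_fun setT U -> ('E_P[g \o U] = (Ex P (fun w => g (U w)))%:E)%E.
  move=> mU; apply: expectationE; apply: bmf_itg; split; first exact: measurableT_comp.
  by exists K => w; exact: gK.
have mS k : measurable_fun setT (Skk k).
  by apply: measurable_sum => i; exact: measurable_funPT.
have -> : (fun n => 'E_P[g \o (fun w => ((\sum_(1 <= k < n.+1) f (Skk k w / k%:R) - b n) / a n)%R)])%E =
    (fun n => (Ex P (fun w => g (normalized P Y Y0 s f mu (derive1n 2 f mu) n w)))%:E).
  apply/funext => n; rewrite gN; last first.
    apply: measurable_funM => //; apply: measurable_funB => //; apply: measurable_sum => k.
    by apply: measurableT_comp => //; exact: measurable_funM.
  by congr (_%:E); apply: eq_Ex => w; rewrite normE.
have -> : (\int[normal_prob (0 : R) 1]_x (g (sigma * derive1 f mu * x))%:E)%E =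
    (Ex (normal_prob (0 : R) 1) (fun x => g (sigma * derive1 f mu * x)))%:E.
  rewrite /Ex /Rintegral fineK//; apply: integrable_fin_num => //.
  apply: bmf_itg; split; last by exists K => x; exact: gK.
  by apply: measurableT_comp => //; exact: measurable_funM.
by apply: cvg_EFin; [exact: nearW|apply: lim => //; exists K].
Qed.
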